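(* Let $N\ge 1$, $c\ge 0$ and $1\le p\le\infty$. Let $J:\mathbb{R}^N\to\mathbb{R}$ be a non-negative, radially non-increasing function with $J\in L^1(\mathbb{R}^N)\cap L^r(\mathbb{R}^N)$ for some $1<r\le 2$, $\|J\|_{L^1(\mathbb{R}^N)}=1$ and $\sigma^2:=\int_{\mathbb{R}^N}|x|^2J(x)\,dx<\infty$. Set $C_1=2/\sigma^2$ and, for $\varepsilon>0$, $J_\varepsilon(x)=C_1\varepsilon^{-(N+2)}J(x/\varepsilon)$. Let $\Omega\subset\mathbb{R}^N$ be an open bounded set with smooth boundary and let $F\in L^p(\Omega)$ be non-negative. Assume: (i) for every $\varepsilon>0$ the problems SNP$(\Omega,F,\varepsilon)$ and SNP$(\Omega^*,F^*,\varepsilon)$ have unique solutions $v_\varepsilon\in L^p(\mathbb{R}^N)$ and $u_\varepsilon\in L^p(\mathbb{R}^N)$, respectively, and the problems SLP$(\Omega,F)$ and SLP$(\Omega^*,F^* )$ have unique solutions $V\in L^p(\Omega)$ and $U\in L^p(\Omega^* )$, respectively; (ii) $\|v_\varepsilon-V\|_{L^p(\Omega)}\to0$ and $\|u_\varepsilon-U\|_{L^p(\Omega^* )}\to 0$ as $\varepsilon\to0$. Then, for every $\varepsilon>0$, $u_\varepsilon$ is radially non-increasing and $$\|v_\varepsilon\|_{L^p(\Omega)}\le \|u_\varepsilon\|_{L^p(\Omega^* )}.$$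
   Context: Radially non-increasing: a function $g$ is radially non-increasing if $g(x)=g(y)$ whenever $|x|=|y|$ and $g(x)\le g(y)$ whenever $|x|\ge|y|$; for elements of $L^p$ this is understood up to modification on a null set. Symmetrization: for a measurable set $E\subset\mathbb{R}^N$ of finite measure, $E^*$ is the ball centered at the origin with $|E^*|=|E|$. For a non-negative measurable function $f$ on $\mathbb{R}^N$ vanishing at infinity, its Schwarz symmetrization is $f^*(x)=\int_0^\infty \chi_{\{f>s\}^*}(x)\,ds$. For $f$ defined on a bounded set $E$, $f$ is extended by zero to $\mathbb{R}^N$, and $f^*$ is regarded as a function on $E^*$. Problem SNP$(E,h,\varepsilon)$ (stationary nonlocal), for $E$ open bounded with smooth boundary and $h:E\to\mathbb{R}$ non-negative measurable: find $w:\mathbb{R}^N\to\mathbb{R}$ with $$-\int_{\mathbb{R}^N}J_\varepsilon(x-y)(w(y)-w(x))\,dy+c\,w(x)=h(x)\ \text{ for }x\in E,\qquad w(x)=0\ \text{ for }x\in\mathbb{R}^N\setminus E.$$ Problem SLP$(E,h)$ (stationary local): find $W:E\to\mathbb{R}$ with $-\Delta W+cW=h$ in $E$ and $W=0$ on $\partial E$. *)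

(* Defs.v *)
From HB Require Import structures.
From mathcomp Require Import all_boot all_order all_algebra.
From mathcomp Require Import all_classical all_reals all_analysis.
Set Implicit Arguments.
Unset Strict Implicit.
Unset Printing Implicit Defensive.
Import Order.TTheory GRing.Theory Num.Theory.
Import numFieldNormedType.Exports.
Local Open Scope classical_set_scope.
Local Open Scope ring_scope.

(* R^N is 'rV[R]_N with the sigma-algebra generated by the coordinates, which
   is the Borel sigma-algebra. *)
Definition rV_display : measure_display.
Proof. exact: default_measure_display. Qed.

Section measurable_rV.
Context (R : realType) (N : nat).

Let coors : 'I_N -> 'rV[R]_N -> R := fun i x => x ord0 i.

Let rV_set0 : g_sigma_preimage coors set0.
Proof. exact: sigma_algebra0. Qed.

Let rV_setC A : g_sigma_preimage coors A -> g_sigma_preimage coors (~` A).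
Proof. exact: sigma_algebraC. Qed.

Let rV_bigcup (F : _^nat) : (forall i, g_sigma_preimage coors (F i)) ->
  g_sigma_preimage coors (\bigcup_i (F i)).
Proof. exact: sigma_algebra_bigcup. Qed.

HB.instance Definition _ := @isMeasurable.Build rV_display
  'rV[R]_N (g_sigma_preimage coors) rV_set0 rV_setC rV_bigcup.

End measurable_rV.

Lemma measurable_coord (R : realType) N (i : 'I_N) :
  measurable_fun [set: 'rV[R]_N] (fun x => x ord0 i : R).
Proof.
move=> _ Y mY; rewrite setTI; apply: sub_sigma_algebra => /=.
rewrite -bigcup_seq/=; exists i => /=; first by rewrite mem_index_enum.
by exists Y => //; rewrite setTI.
Qed.

Lemma measurable_fun_rV (R : realType) N d (T : measurableType d)
    (f : T -> 'rV[R]_N) :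
  (forall i, measurable_fun [set: T] (fun t => f t ord0 i : R)) ->
  measurable_fun [set: T] f.
Proof.
move=> mf _ A mA; rewrite setTI.
pose G : set (set 'rV[R]_N) := [set B | measurable (f @^-1` B)].
suff : @measurable _ 'rV[R]_N `<=` G by apply.
apply: smallest_sub.
  split => /=.
  - by rewrite /G /= preimage_set0.
  - by move=> B GB; rewrite /G /= setTD preimage_setC; exact: measurableC.
  - move=> F GF; rewrite /G /= preimage_bigcup.
    exact: bigcupT_measurable.
move=> B; rewrite -bigcup_seq/= => -[i _ [C mC <-]].
by rewrite /G /= setTI; have := mf i measurableT C mC; rewrite setTI.
Qed.

Definition cons_rV (R : realType) N (z : R * 'rV[R]_N) : 'rV[R]_N.+1 :=
  \row_i oapp (z.2 ord0) z.1 (unlift ord0 i).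

Lemma measurable_cons_rV (R : realType) N :
  measurable_fun [set: measurableTypeR R * 'rV[R]_N] (@cons_rV R N).
Proof.
apply: measurable_fun_rV => i; rewrite /cons_rV.
have [j ->|->] := unliftP ord0 i.
- under eq_fun do rewrite mxE liftK.
  exact: (measurableT_comp (measurable_coord j) measurable_snd).
- under eq_fun do rewrite mxE unlift_none /=.
  exact: measurable_fst.
Qed.

Section lebesgue_rV_succ.
Context (R : realType) (N : nat).
Variable mu : {sigma_finite_measure set 'rV[R]_N -> \bar R}.

Definition lebesgue_rV_succ : set 'rV[R]_N.+1 -> \bar R :=
  pushforward (@lebesgue_measure R \x mu)%E (@cons_rV R N).

Let succ0 : lebesgue_rV_succ set0 = 0%E.
Proof. by rewrite /lebesgue_rV_succ /pushforward preimage_set0 measure0. Qed.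

Let succ_ge0 A : (0 <= lebesgue_rV_succ A)%E.
Proof. by rewrite /lebesgue_rV_succ /pushforward measure_ge0. Qed.

Let mpre A : measurable A -> measurable (@cons_rV R N @^-1` A).
Proof.
by move=> mA; rewrite -[X in measurable X]setTI; exact: measurable_cons_rV.
Qed.

Let succ_sigma_additive : semi_sigma_additive lebesgue_rV_succ.
Proof.
move=> F mF tF mUF; rewrite /lebesgue_rV_succ /pushforward preimage_bigcup.
apply: measure_semi_sigma_additive.
- by move=> n; exact: mpre.
- apply/trivIsetP => /= i j _ _ ij; rewrite -preimage_setI.
  by move/trivIsetP : tF => /(_ _ _ _ _ ij) ->//; rewrite preimage_set0.
- by rewrite -preimage_bigcup; exact: mpre.
Qed.

HB.instance Definition _ := isMeasure.Build _ _ _ lebesgue_rV_succ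
  succ0 succ_ge0 succ_sigma_additive.

Let succ_sigma_finite : sigma_finite setT lebesgue_rV_succ.
Proof.
have /sigma_finiteP[F [TF ndF Foo]] := sigma_finiteT (@lebesgue_measure R).
have /sigma_finiteP[G [TG ndG Goo]] := sigma_finiteT mu.
pose tl (x : 'rV[R]_N.+1) : 'rV[R]_N := \row_j x ord0 (lift ord0 j).
exists (fun n => [set x : 'rV[R]_N.+1 | F n (x ord0 ord0) /\ G n (tl x)]).
  rewrite predeqE => x; split => // _.
  have [n _ Fn] : (\bigcup_i F i) (x ord0 ord0) by rewrite -TF.
  have [k _ Gk] : (\bigcup_i G i) (tl x) by rewrite -TG.
  exists (maxn n k) => //; split.
  - by move: Fn; exact/subsetPset/ndF/leq_maxl.
  - by move: Gk; exact/subsetPset/ndG/leq_maxr.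
move=> k; have [mF Fk] := Foo k; have [mG Gk] := Goo k; split.
  apply: measurableI.
    by rewrite -[X in measurable X]setTI; exact: (measurable_coord ord0).
  rewrite -[X in measurable X]setTI; apply: (_ : measurable_fun _ tl) => //.
  apply: measurable_fun_rV => i; under eq_fun do rewrite mxE.
  exact: measurable_coord.
rewrite /lebesgue_rV_succ /pushforward.
rewrite (_ : _ @^-1` _ = F k `*` G k).
  by rewrite product_measure1E// lte_mul_pinfty ?measure_ge0 ?ge0_fin_numE.
rewrite predeqE => -[a y]; rewrite /cons_rV /= mxE unlift_none /=.
suff -> : tl (cons_rV (a, y)) = y by [].
by apply/rowP => j; rewrite !mxE liftK.
Qed.

HB.instance Definition _ := Measure_isSigmaFinite.Build _ _ _ lebesgue_rV_succ
  succ_sigma_finite.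

End lebesgue_rV_succ.

Fixpoint lebesgue_rV (R : realType) (N : nat) :
    {sigma_finite_measure set 'rV[R]_N -> \bar R} :=
  match N with
  | 0 => [the {sigma_finite_measure set 'rV[R]_0 -> \bar R} of
            dirac (0 : 'rV[R]_0)]
  | n.+1 => [the {sigma_finite_measure set 'rV[R]_n.+1 -> \bar R} of
            lebesgue_rV_succ (lebesgue_rV R n)]
  end.
Arguments lebesgue_rV {R N}.

Section definitions.
Context (R : realType) (N : nat).
Local Notation E := 'rV[R]_N.
Local Notation leb := (@lebesgue_rV R N).
Implicit Types (A : set E) (f w W : E -> R) (h : E -> \bar R) (p : \bar R).

(* The library norm `|x| on 'rV[R]_N is the sup norm. *)
Definition enorm (x : E) : R := Num.sqrt (\sum_i x ord0 i ^+ 2).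

Definition eball (r : R) : set E := [set x | enorm x < r].

(* L^p(A): only the values of f on A matter, f \_ A being the extension by
   zero. *)
Definition Lp_norm A p f : \bar R := ('N[leb]_p[EFin \o (f \_ A)])%E.

Definition Lp A p : set (E -> R) := [set f | (f \_ A) \in Lfun leb p].

(* Extended values are needed: a radially non-increasing element of L^p may be
   unbounded near the origin, and then its monotone representative is +oo at
   the origin. *)
Definition radially_nonincreasing (g : E -> \bar R) :=
  (forall x y, enorm x = enorm y -> g x = g y) /\
  (forall x y, enorm y <= enorm x -> (g x <= g y)%E).

Definition ae_radially_nonincreasing f :=
  exists2 g, radially_nonincreasing g & {ae leb, forall x, (f x)%:E = g x}.

(* Lebesgue measure of balls is strictly increasing in the radius, so that the
   radius selected here is unique when A has finite measure. *)
Definition symm_radius A : R :=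
  get [set r | 0 <= r /\ leb (eball r) = leb A].

Definition symm_set A : set E := eball (symm_radius A).

Definition schwarz f : E -> \bar R := fun x =>
  (\int[@lebesgue_measure R]_(s in `]0%R, +oo[)
    (\1_(symm_set [set y | s < f y]) x)%:E)%E.

Definition second_moment (J : E -> R) : \bar R :=
  (\int[leb]_x (enorm x ^+ 2 * J x)%:E)%E.

Definition rescaled (J : E -> R) (eps : R) : E -> R := fun x =>
  2 / fine (second_moment J) / eps ^+ (N + 2) * J (eps^-1 *: x).

(* The equation is stated in \bar R because the datum h = F^* may be +oo at
   the origin. *)
Definition solves_SNP p (J : E -> R) (c : R) A h (eps : R) w :=
  [/\ Lp setT p w,
      {ae leb, forall x, A x ->
        (- (\int[leb]_y (rescaled J eps (x - y) * (w y - w x))%:E)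
         + (c * w x)%:E = h x)%E} &
      {ae leb, forall x, ~ A x -> w x = 0}].

Definition unique_solution_SNP p (J : E -> R) (c : R) A h (eps : R) w :=
  solves_SNP p J c A h eps w /\
  forall w', solves_SNP p J c A h eps w' -> {ae leb, forall x, w' x = w x}.

Definition partial (i : 'I_N) f : E -> R := fun x => 'D_(delta_mx 0 i) f x.

(* C^infinity: differentiability of every iterated partial derivative makes
   all of them continuous. *)
Definition smooth f :=
  forall (s : seq 'I_N) (x : E), differentiable (foldr partial f s) x.

Definition laplacian f : E -> R := fun x => \sum_i partial i (partial i f) x.

(* C^infinity boundary, by local defining functions: near x0 the boundary is
   the regular level set {rho = 0} and A lies on one side of it. *)
Definition smooth_boundary A :=
  forall x0, (closure A `\` interior A) x0 ->
  exists rho : E -> R,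
    [/\ smooth rho, exists i, partial i rho x0 != 0 &
        \forall x \near x0, A x <-> rho x < 0].

Definition test_function A f :=
  smooth f /\
  exists K, [/\ compact K, K `<=` A & forall x, ~ K x -> f x = 0].

(* W = 0 on the boundary of A in the sense W \in W_0^{1,1}(A): W is the limit
   of test functions phi_n in L^1(A), and the gradients of the phi_n converge
   in L^1(A). *)
Definition zero_on_boundary A W :=
  exists (phi : nat -> E -> R) (G : 'I_N -> E -> R),
    [/\ forall n, test_function A (phi n),
        Lp A 1%E W /\ (forall i, Lp A 1%E (G i)),
        Lp_norm A 1%E (phi n \- W) @[n --> \oo] --> 0%E &
        forall i, Lp_norm A 1%E (partial i (phi n) \- G i) @[n --> \oo] --> 0%E].

(* The equation holds in the sense of distributions on A. *)
Definition solves_SLP p (c : R) A h W :=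
  [/\ Lp A p W,
      forall phi, test_function A phi ->
        (\int[leb]_(x in A) (W x * (- laplacian phi x + c * phi x))%:E =
         \int[leb]_(x in A) (h x * (phi x)%:E))%E &
      zero_on_boundary A W].

Definition unique_solution_SLP p (c : R) A h W :=
  solves_SLP p c A h W /\
  forall W', solves_SLP p c A h W' -> {ae leb, forall x, A x -> W' x = W x}.

End definitions.

(* Main.v *)
(* Write K for the rescaled kernel and k for its integral. On a bounded set A,
   an integrable solution w of the stationary problem with datum h >= 0 is the
   increasing limit of the Picard iterates
     w_0 = 0,   w_(n+1) = (k + c)^-1 (K * w_n + h) on A, 0 off A,
   because a nonnegative integrable f supported in A with k f <= K * f on A
   vanishes: apply this to the negative part of w, then to the difference
   between w and the limit. On the ball Omega^* with datum F^* every iterate is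
   radially non-increasing, hence so is the limit.
   The iterates v_n on Omega and u_n on Omega^* satisfy
     int (v_n - t)^+ <= int (u_n - t)^+   for every t >= 0.
   The induction step rests on Riesz' rearrangement inequality (obtained from
   polarizations), which turns this relation into
     int_A K * v_n <= int_{A^*} K * u_n   for every A,
   and this in turn into the relation at rank n + 1. The relation passes to the
   limit and yields the comparison of L^p norms, as a^p is a superposition of
   the functions (a - t)^+. *)
Require Import Defs.
From HB Require Import structures.
From mathcomp Require Import all_boot all_order all_algebra.
From mathcomp Require Import all_classical all_reals all_analysis.
From mathcomp Require Import measurable_realfun ring lra.
Set Implicit Arguments.
Unset Strict Implicit.
Unset Printing Implicit Defensive.
Import Order.TTheory GRing.Theory Num.Theory.
Import numFieldNormedType.Exports.
Local Open Scope classical_set_scope.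
Local Open Scope ring_scope.

(** * Measurability and Lebesgue measure on row vectors *)

(** Three difficulties shape the argument. When [c = 0], convolution divided by [k + c] preserves
    the integral of a non-negative function on the whole space, so no contraction factor is at hand.
    Uniqueness comes from the mass that convolution carries out of the bounded set, detected by an
    exponential weight in one coordinate. The Riesz inequality is obtained without compactness of
    sets: an average over all reflections shows that a set differing from its ball by at least [d]
    admits one polarization that lowers the difference by an amount depending only on [d] and on an
    enclosing ball. Domination is used in two forms: tails survive monotone limits and control every
    norm, whereas one step of the iteration is compared through masses on sets. Going from tails
    back to masses uses that the majorant is radially non-increasing. Finally, [J] is radial only
    almost everywhere, and its representative, like the symmetrized datum, may be [+oo] at the
    origin. The functions compared are therefore non-negative with values in [\bar R], and the
    equation is arranged so that all of its terms are non-negative. *)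

Section measurability.
Context (R : realType) (N : nat) d (T : measurableType d).
Local Notation E := 'rV[R]_N.
Implicit Types f g : T -> E.

Lemma measurable_coordf f i :
  measurable_fun [set: T] f -> measurable_fun [set: T] (fun t => f t ord0 i : R).
Proof. by move=> mf; exact: (measurableT_comp (measurable_coord i) mf). Qed.

Lemma measurable_addrV f g : measurable_fun [set: T] f ->
  measurable_fun [set: T] g -> measurable_fun [set: T] (fun t => f t + g t).
Proof.
move=> mf mg; apply: measurable_fun_rV => i; under eq_fun do rewrite mxE.
by apply: measurable_funD; exact: measurable_coordf.
Qed.

Lemma measurable_scalerV (a : T -> R) f : measurable_fun [set: T] a ->
  measurable_fun [set: T] f -> measurable_fun [set: T] (fun t => a t *: f t).
Proof.
move=> ma mf; apply: measurable_fun_rV => i; under eq_fun do rewrite mxE.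
by apply: measurable_funM => //; exact: measurable_coordf.
Qed.

Lemma measurable_opprV f : measurable_fun [set: T] f ->
  measurable_fun [set: T] (fun t => - f t).
Proof.
move=> mf; under eq_fun do rewrite -scaleN1r.
by apply: measurable_scalerV.
Qed.

Lemma measurable_subrV f g : measurable_fun [set: T] f ->
  measurable_fun [set: T] g -> measurable_fun [set: T] (fun t => f t - g t).
Proof. by move=> mf mg; apply: measurable_addrV => //; exact: measurable_opprV. Qed.

End measurability.

(** * Euclidean inner product and norm *)

Section dot.
Context (R : realType) (N : nat).
Local Notation E := 'rV[R]_N.
Implicit Types x y z : E.

Definition dot x y : R := \sum_i x ord0 i * y ord0 i.

Lemma dotC x y : dot x y = dot y x.
Proof. by apply: eq_bigr => i _; rewrite mulrC. Qed.

Lemma dotDl x y z : dot (x + y) z = dot x z + dot y z.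
Proof. by rewrite -big_split; apply: eq_bigr => i _; rewrite mxE mulrDl. Qed.

Lemma dotZl a x y : dot (a *: x) y = a * dot x y.
Proof. by rewrite mulr_sumr; apply: eq_bigr => i _; rewrite mxE mulrA. Qed.

Lemma dotNl x y : dot (- x) y = - dot x y.
Proof. by rewrite -scaleN1r dotZl mulN1r. Qed.

Lemma dotBl x y z : dot (x - y) z = dot x z - dot y z.
Proof. by rewrite dotDl dotNl. Qed.

Lemma dotDr x y z : dot x (y + z) = dot x y + dot x z.
Proof. by rewrite dotC dotDl !(dotC x). Qed.

Lemma dotZr a x y : dot x (a *: y) = a * dot x y.
Proof. by rewrite dotC dotZl dotC. Qed.

Lemma dotNr x y : dot x (- y) = - dot x y.
Proof. by rewrite dotC dotNl dotC. Qed.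

Lemma dotBr x y z : dot x (y - z) = dot x y - dot x z.
Proof. by rewrite dotDr dotNr. Qed.

Lemma dot_ge0 x : 0 <= dot x x.
Proof. by apply: sumr_ge0 => i _; rewrite -expr2 sqr_ge0. Qed.

Lemma dot_eq0 x : (dot x x == 0) = (x == 0).
Proof.
rewrite psumr_eq0; last by move=> i _; rewrite -expr2 sqr_ge0.
apply/allP/eqP => [h|-> i _]; last by rewrite mxE mul0r eqxx.
apply/rowP => i; rewrite mxE; apply/eqP.
by have := h i (mem_index_enum _); rewrite /= mulf_eq0 orbb.
Qed.

Lemma dot_gt0 x : x != 0 -> 0 < dot x x.
Proof. by move=> x0; rewrite lt_neqAle dot_ge0 eq_sym dot_eq0 x0. Qed.

Lemma enormE x : enorm x = Num.sqrt (dot x x).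
Proof. by congr Num.sqrt; apply: eq_bigr => i _; rewrite expr2. Qed.

Lemma enorm_ge0 x : 0 <= enorm x. Proof. exact: sqrtr_ge0. Qed.

Lemma sqr_enorm x : enorm x ^+ 2 = dot x x.
Proof. by rewrite enormE sqr_sqrtr// dot_ge0. Qed.

Lemma enorm_eq0 x : (enorm x == 0) = (x == 0).
Proof. by rewrite -dot_eq0 -sqr_enorm sqrf_eq0. Qed.

Lemma enorm0 : enorm (0 : E) = 0.
Proof. by apply/eqP; rewrite enorm_eq0. Qed.

Lemma enorm_gt0 x : x != 0 -> 0 < enorm x.
Proof. by move=> x0; rewrite lt_neqAle enorm_ge0 eq_sym enorm_eq0 x0. Qed.

Lemma ler_enorm x y : (enorm x <= enorm y) = (dot x x <= dot y y).
Proof. by rewrite -!sqr_enorm ler_sqr ?nnegrE ?enorm_ge0. Qed.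

Lemma enorm_lt x r : 0 <= r -> (enorm x < r) = (dot x x < r ^+ 2).
Proof. by move=> r0; rewrite -!sqr_enorm ltr_sqr ?nnegrE ?enorm_ge0. Qed.

Lemma enormZ a x : enorm (a *: x) = `|a| * enorm x.
Proof.
by rewrite !enormE dotZl dotZr mulrA -expr2 sqrtrM ?sqr_ge0// sqrtr_sqr.
Qed.

Lemma enormN x : enorm (- x) = enorm x.
Proof. by rewrite -scaleN1r enormZ normrN1 mul1r. Qed.

Lemma coord_le_enorm x i : `|x ord0 i| <= enorm x.
Proof.
rewrite -ler_sqr ?nnegrE ?enorm_ge0// sqr_enorm real_normK ?num_real//.
rewrite /dot (bigD1 i)//= -expr2 lerDl.
by apply: sumr_ge0 => j _; rewrite -expr2 sqr_ge0.
Qed.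

Lemma enorm_le_coord x r : 0 <= r -> (forall i, `|x ord0 i| <= r) ->
  enorm x <= N%:R * r.
Proof.
move=> r0 h; rewrite -ler_sqr ?nnegrE ?enorm_ge0 ?mulr_ge0// sqr_enorm.
rewrite (@le_trans _ _ (N%:R * r ^+ 2))//.
  rewrite mulr_natl -[X in _ *+ X]card_ord -sumr_const ler_sum// => i _.
  by rewrite -expr2 -real_normK ?num_real// ler_sqr ?nnegrE.
rewrite exprMn ler_wpM2r ?sqr_ge0//.
case: (N) => [|n]; first by rewrite expr0n.
by rewrite expr2 ler_peMr// ler1n.
Qed.

Lemma dot_sub_le x y : dot (x - y) (x - y) <= 2 * dot x x + 2 * dot y y.
Proof.
have := dot_ge0 (x + y); rewrite !(dotDl, dotDr, dotNl, dotNr, dotBl, dotBr) (dotC y x).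
by move=> ?; lra.
Qed.

End dot.

Lemma measurable_dot d (T : measurableType d) (R : realType) N (f g : T -> 'rV[R]_N) :
  measurable_fun [set: T] f -> measurable_fun [set: T] g ->
  measurable_fun [set: T] (fun t => dot (f t) (g t)).
Proof.
move=> mf mg; rewrite /dot.
apply: measurable_sum => i.
by apply: measurable_funM; exact: measurable_coordf.
Qed.

Lemma measurable_enorm d (T : measurableType d) (R : realType) N (f : T -> 'rV[R]_N) :
  measurable_fun [set: T] f -> measurable_fun [set: T] (fun t => enorm (f t)).
Proof.
move=> mf; under eq_fun do rewrite enormE.
apply: (@measurableT_comp _ _ _ _ _ _ (@Num.sqrt R)); last exact: measurable_dot.
by apply: continuous_measurable_fun; exact: sqrt_continuous.
Qed.

(** Balls of the library norm are cubes, so an open set is the union of the countably many cubes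
    with rational centre and radius that it contains; each of these is a finite intersection of
    coordinate conditions. *)
Lemma open_measurable_rV (R : realType) N (A : set 'rV[R]_N) :
  open A -> measurable A.
Proof.
move=> oA.
pose cube (z : 'rV[rat]_N * rat) : set 'rV[R]_N :=
  [set y | forall i, `|y ord0 i - ratr (z.1 ord0 i)| < ratr z.2].
have mcube z : measurable (cube z).
  rewrite (_ : cube z = \bigcap_(i in [set: 'I_N])
      (fun y : 'rV[R]_N => `|y ord0 i - ratr (z.1 ord0 i)|) @^-1` `]-oo, ratr z.2[).
    apply: fin_bigcap_measurable => // i _; rewrite -[X in measurable X]setTI.
    apply: measurableT_comp => //; apply: measurable_funB => //.
    exact: measurable_coord.
  apply/seteqP; split => y /= h i; last by have := h i I; rewrite /= in_itv.
  by move=> _; rewrite /= in_itv /=; exact: h.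
have -> : A = \bigcup_z (if `[< cube z `<=` A >] then cube z else set0).
  apply/seteqP; split => [x Ax|x [z _]]; last first.
    by case: asboolP => [zA|//]; exact: zA.
  have /nbhs_ballP[e /= e0 xeA] : nbhs x A by exact: open_nbhs_nbhs.
  have /rat_in_itvoo[r] : 0 < e / 2 by rewrite divr_gt0.
  rewrite in_itv /= => /andP[r0 re].
  have /choice[q hq] : forall i, exists q : rat, `|x ord0 i - ratr q| < ratr r.
    move=> i; have /rat_in_itvoo[q] : x ord0 i - ratr r < x ord0 i + ratr r by lra.
    rewrite in_itv /= => h; exists q; rewrite ltr_norml; lra.
  exists (\row_i q i, r) => //; case: asboolP => [_ i|]; first by rewrite /= mxE.
  move=> []; move=> y hy; apply: xeA; split=> // i j; rewrite (ord1 i).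
  have := hy j; have := hq j; rewrite /= mxE /ball /=.
  move=> h1 h2; rewrite (_ : _ - _ = (x ord0 j - ratr (q j)) - (y ord0 j - ratr (q j))); last by ring.
  apply: le_lt_trans (ler_normB _ _) _; lra.
apply: countable_bigcupT_measurable => // z; case: asboolP => // _; exact: mcube.
Qed.

Section preimage_measurable.
Context d d' (T : measurableType d) (T' : measurableType d').

Lemma measurable_preimageT (f : T -> T') (A : set T') :
  measurable_fun [set: T] f -> measurable A -> measurable (f @^-1` A).
Proof. by move=> mf mA; rewrite -[X in measurable X]setTI; exact: mf. Qed.

Lemma measurable_mem (f : T -> T') (A : set T') :
  measurable_fun [set: T] f -> measurable A -> measurable_fun [set: T] (fun x => f x \in A).
Proof.
move=> mf mA; apply: (measurable_fun_bool true); rewrite setTI (_ : _ @^-1` _ = f @^-1` A).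
  exact: measurable_preimageT.
by apply/seteqP; split => x /=; [exact: set_mem|exact: mem_set].
Qed.

End preimage_measurable.

Lemma lebesgue_measure_shift (R : realType) (a : R) (A : set (measurableTypeR R)) :
  measurable A ->
  lebesgue_measure ((fun t : measurableTypeR R => t + a : measurableTypeR R) @^-1` A)
  = lebesgue_measure A.
Proof.
move=> mA.
have mf : measurable_fun [set: measurableTypeR R]
    (fun t : measurableTypeR R => t + a : measurableTypeR R).
  exact: measurable_funD.
pose f : {mfun measurableTypeR R >-> measurableTypeR R} :=
  HB.pack (fun t : measurableTypeR R => t + a : measurableTypeR R)
    (isMeasurableFun.Build _ _ _ _ _ mf).
rewrite [RHS](@lebesgue_measure_unique R (pushforward lebesgue_measure f))//.
move=> X [[x y] /= _ <-]; rewrite /pushforward.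
rewrite (_ : _ @^-1` _ = `](x - a), (y - a)]%classic); last first.
  by apply/seteqP; split => t /=; rewrite !in_itv /= ltrBlDr lerBrDr.
by rewrite !lebesgue_measure_itv /= !lte_fin ltrD2r; case: ifPn => // _;
  rewrite -!EFinB; congr EFin; ring.
Qed.

Lemma product_measure_map d1 d2 (T1 : measurableType d1) (T2 : measurableType d2)
    (R : realType) (m1 : {sigma_finite_measure set T1 -> \bar R})
    (m2 : {sigma_finite_measure set T2 -> \bar R}) (f1 : T1 -> T1) (f2 : T2 -> T2) :
  measurable_fun [set: T1] f1 -> measurable_fun [set: T2] f2 ->
  (forall A, measurable A -> m1 (f1 @^-1` A) = m1 A) ->
  (forall A, measurable A -> m2 (f2 @^-1` A) = m2 A) ->
  forall A, measurable A ->
    ((m1 \x m2) ((fun z => (f1 z.1, f2 z.2)) @^-1` A) = (m1 \x m2) A)%E.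
Proof.
move=> mf1 mf2 f1E f2E A mA.
have mf : measurable_fun [set: T1 * T2] (fun z : T1 * T2 => (f1 z.1, f2 z.2)).
  by apply: measurable_fun_pair; apply: measurableT_comp.
pose f : {mfun (T1 * T2)%type >-> (T1 * T2)%type} :=
  HB.pack (fun z : T1 * T2 => (f1 z.1, f2 z.2)) (isMeasurableFun.Build _ _ _ _ _ mf).
rewrite [RHS](@product_measure_unique _ _ _ _ _ m1 m2 (pushforward (m1 \x m2)%E f))//.
move=> B C mB mC; rewrite /= /pushforward.
rewrite (_ : _ @^-1` _ = (f1 @^-1` B) `*` (f2 @^-1` C))//.
have := measurable_preimageT mf1 mB; have := measurable_preimageT mf2 mC => m2' m1'.
rewrite product_measure1E//.
by congr (_ * _)%E; [exact: f1E|exact: f2E].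
Qed.

(** Induction on the dimension: under [cons_rV] a translation acts separately on the first
    coordinate and on the remaining ones. *)
Lemma lebesgue_rV_shift (R : realType) N (a : 'rV[R]_N) (A : set 'rV[R]_N) :
  measurable A -> lebesgue_rV ((fun x => x + a) @^-1` A) = lebesgue_rV A.
Proof.
elim: N a A => [|N IH] a A mA.
  by congr (lebesgue_rV _); apply/seteqP; split => x /=; rewrite (thinmx0 (x + a)) (thinmx0 x).
rewrite /= /lebesgue_rV_succ /pushforward.
pose a' : 'rV[R]_N := \row_i a ord0 (lift ord0 i).
rewrite -[RHS](@product_measure_map _ _ (measurableTypeR R) 'rV[R]_N R
  lebesgue_measure lebesgue_rV
  (fun t : measurableTypeR R => t + a ord0 ord0 : measurableTypeR R)
  (fun x : 'rV[R]_N => x + a')).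
- congr (_ _); apply/seteqP; split => -[t x] /=;
  rewrite (_ : cons_rV (t, x) + a = cons_rV (t + a ord0 ord0, x + a'))//;
    by apply/rowP => i; rewrite !mxE; have [j ->|->] := unliftP ord0 i;
      rewrite ?liftK ?unlift_none /= ?mxE.
- exact: measurable_funD.
- by apply: measurable_addrV.
- by move=> B mB; exact: lebesgue_measure_shift.
- exact: IH.
- by apply: measurable_preimageT => //; exact: measurable_cons_rV.
Qed.

Lemma tonelli_set d1 d2 (T1 : measurableType d1) (T2 : measurableType d2)
    (R : realType) (m1 : {sigma_finite_measure set T1 -> \bar R})
    (m2 : {sigma_finite_measure set T2 -> \bar R}) (S : set (T1 * T2)) :
  measurable S ->
  (\int[m1]_x m2 [set y | S (x, y)] = \int[m2]_y m1 [set x | S (x, y)])%E.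
Proof.
move=> mS.
have := @fubini_tonelli _ _ _ _ _ m1 m2 (EFin \o \1_S).
move=> /(_ _ _)/= h; transitivity (\int[m1]_x \int[m2]_y (\1_S (x, y))%:E)%E.
  apply: eq_integral => x _; rewrite -[X in m2 X]setIT -integral_indic//.
  by apply: measurable_preimageT mS; exact: pair1_measurable.
rewrite h.
- apply: eq_integral => y _; rewrite -[X in m1 X]setIT -integral_indic//.
  by apply: measurable_preimageT mS; exact: pair2_measurable.
- by apply/measurable_EFinP; exact: measurable_indic.
- by move=> z; rewrite lee_fin.
Qed.

Lemma integral_mul_indic d (T : measurableType d) (R : realType)
    (m : {measure set T -> \bar R}) (A : set T) (k : \bar R) :
  measurable A -> (0 <= k)%E -> (\int[m]_x (k * (\1_A x)%:E) = k * m A)%E.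
Proof.
move=> mA k0; rewrite ge0_integralZl//.
- by rewrite integral_indic// setIT.
- by apply/measurable_EFinP; exact: measurable_indic.
Qed.

(** * Uniqueness of translation-invariant measures and images of Lebesgue measure *)

Section haar.
Context (R : realType) (N : nat).
Local Notation E := 'rV[R]_N.
Local Notation leb := (@lebesgue_rV R N).

(** Fubini proof of the uniqueness of Haar measure. Both sides are the product measure of the pairs
    with [x] in [A] and [x + y] in [B]: translating in [y] gives the left side, translating in [x]
    by [y] gives the right side. The mirror image of [A] appears because [y] then ranges over
    [x - A]. Stated as an equality of products, it needs no division and allows infinite values. *)
Lemma lebesgue_rV_unique (nu : {sigma_finite_measure set E -> \bar R})
    (nu_shift : forall (a : E) A, measurable A -> nu ((fun x => x + a) @^-1` A) = nu A)
    (A B : set E) : measurable A -> measurable B ->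
  (nu A * leb B = nu B * leb (-%R @^-1` A))%E.
Proof.
move=> mA mB.
have mN : measurable (-%R @^-1` A : set E).
  by apply: measurable_preimageT => //; exact: measurable_opprV.
have mP (f g : E * E -> E) : measurable_fun setT f -> measurable_fun setT g ->
    measurable [set z | A (f z) /\ B (g z)].
  move=> mf mg; rewrite (_ : [set _ | _] = f @^-1` A `&` g @^-1` B)//.
  by apply: measurableI; exact: measurable_preimageT.
transitivity (\int[nu]_x leb [set y : E | A x /\ B ((x : E) + y)%R])%E.
  rewrite muleC -integral_mul_indic//; apply: eq_integral => x _.
  rewrite indicE; case: (boolP (x \in A)) => xA /=.
    rewrite mule1 -(lebesgue_rV_shift x mB); congr (leb _).
    by apply/seteqP; split => y /=; rewrite addrC; [split => //; exact: set_mem|case].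
  rewrite mule0 (_ : [set _ | _] = set0) ?measure0//.
  by apply/seteqP; split => y //= [/mem_set]; rewrite (negbTE xA).
rewrite (@tonelli_set _ _ _ _ _ nu leb [set z : E * E | A z.1 /\ B (z.1 + z.2)]); last first.
  by apply: mP => //; exact: measurable_addrV.
transitivity (\int[leb]_y nu [set x : E | A (x - (y : E))%R /\ B x])%E.
  apply: eq_integral => y _.
  have mS : measurable [set x : E | A (x - y) /\ B x].
    rewrite (_ : [set _ | _] = (fun x => x - y) @^-1` A `&` B)//.
    apply: measurableI => //; apply: measurable_preimageT => //.
    exact: measurable_subrV.
  rewrite -[RHS](nu_shift y)//; congr (nu _).
  by apply/seteqP; split => x /=; rewrite addrK.
rewrite -(@tonelli_set _ _ _ _ _ nu leb [set z : E * E | A (z.1 - z.2) /\ B z.1]); last first.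
  by apply: mP => //; exact: measurable_subrV.
rewrite muleC -integral_mul_indic//; apply: eq_integral => x _.
rewrite indicE; case: (boolP (x \in B)) => xB /=.
  rewrite mule1 -(lebesgue_rV_shift (- x) mN); congr (leb _).
  by apply/seteqP; split => y /=; rewrite opprB; [case|split => //; exact: set_mem].
rewrite mule0 (_ : [set _ | _] = set0) ?measure0//.
by apply/seteqP; split => y //= [_ /mem_set]; rewrite (negbTE xB).
Qed.

End haar.

(** Pushforwards and products are built as measures only; this equips them with the structure that
    Tonelli's theorem expects, without changing their values. *)
Lemma sigma_finite_measure_pack d (T : measurableType d) (R : realType)
    (m : {measure set T -> \bar R}) : sigma_finite setT m ->
  exists m' : {sigma_finite_measure set T -> \bar R}, forall A, m' A = m A.
Proof.
move=> sf; have sfin := @sfinite_measure_sigma_finite _ _ _ m sf.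
move: m sf sfin => [mu [c1 c2]] /= sf sfin.
by exists (SigmaFiniteMeasure.Pack (SigmaFiniteMeasure.Class c2
  (isSFinite.Axioms_ _ _ _ sfin) (isSigmaFinite.Axioms_ _ _ _ sf))).
Qed.

(** As [f] turns translations into translations, the image of Lebesgue measure is
    translation-invariant and [lebesgue_rV_unique] applies; [g] transports an exhaustion by sets of
    finite measure. The scaling factor of [f] is then read off from one convenient [B]: a cube for
    dilations, a ball for reflections. *)
Lemma lebesgue_rV_map (R : realType) N (f g : 'rV[R]_N -> 'rV[R]_N) (A B : set 'rV[R]_N) :
  measurable_fun setT f -> measurable_fun setT g -> cancel f g ->
  (forall a, exists b, forall x, f (x + b) = f x + a) ->
  measurable A -> measurable B ->
  (lebesgue_rV (f @^-1` A) * lebesgue_rV B =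
   lebesgue_rV (f @^-1` B) * lebesgue_rV (-%R @^-1` A))%E.
Proof.
move=> mf mg fK fD mA mB.
pose m := [the {measure set _ -> \bar R} of pushforward (@lebesgue_rV R N) f].
have [|nu nuE] := @sigma_finite_measure_pack _ _ _ (m mf).
  have /sigma_finiteP[G [TG ndG Goo]] := sigma_finiteT (@lebesgue_rV R N).
  exists (fun n => g @^-1` G n).
    by rewrite -preimage_bigcup -TG preimage_setT.
  move=> n; have [mG Gn] := Goo n; split; first exact: measurable_preimageT.
  rewrite /= /pushforward (_ : _ @^-1` _ = G n)//.
  by apply/seteqP; split => x /=; rewrite fK.
have := @lebesgue_rV_unique _ _ nu _ A B; rewrite !nuE; apply => // a C mC.
rewrite !nuE /= /pushforward; have [b hb] := fD a.
rewrite -[RHS](@lebesgue_rV_shift _ _ b); last exact: measurable_preimageT.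
by congr (lebesgue_rV _); apply/seteqP; split => x /=; rewrite hb.
Qed.

Section cube.
Context (R : realType).

Definition cube N (l : R) : set 'rV[R]_N := [set x | forall i, 0 < x ord0 i <= l].

Lemma measurable_cube N l : measurable (@cube N l).
Proof.
rewrite (_ : @cube N l = \bigcap_(i in [set: 'I_N])
    (fun y : 'rV[R]_N => y ord0 i) @^-1` `]0, l]).
  apply: fin_bigcap_measurable => // i _; apply: measurable_preimageT => //.
  exact: measurable_coord.
apply/seteqP; split => y /= h i; last by have := h i I; rewrite /= in_itv.
by move=> _; rewrite /= in_itv /=; exact: h.
Qed.

Lemma lebesgue_cube N l : 0 <= l -> lebesgue_rV (@cube N l) = (l ^+ N)%:E.
Proof.
move=> l0; elim: N => [|N IH].
  by rewrite /= diracE mem_set//= => -[].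
rewrite /= /lebesgue_rV_succ /pushforward.
have -> : @cons_rV R N @^-1` @cube N.+1 l = `]0, l]%classic `*` @cube N l.
  apply/seteqP; split => [[t x] /= h|[t x] /= [+ h] i]; rewrite in_itv /=.
    split; first by have := h ord0; rewrite /cons_rV mxE unlift_none.
    by move=> i; have := h (lift ord0 i); rewrite /cons_rV mxE liftK.
  by move=> t0; rewrite /cons_rV mxE; case: unliftP => [j _|_] //=.
rewrite product_measure1E//; last exact: measurable_cube.
have := IH; rewrite /= => ->.
rewrite lebesgue_measure_itv /= lte_fin exprS EFinM oppr0 addr0.
by case: ltgtP l0 => // <-; rewrite !mul0e.
Qed.

End cube.

Section lebesgue_map.
Context (R : realType) (N : nat).
Local Notation E := 'rV[R]_N.
Local Notation leb := (@lebesgue_rV R N).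

Lemma cube1_neq0 : leb (@cube R N 1) = 1%E.
Proof. by rewrite lebesgue_cube// expr1n. Qed.

Lemma lebesgue_rVN (A : set E) : measurable A -> leb (-%R @^-1` A) = leb A.
Proof.
move=> mA; have := lebesgue_rV_unique (@lebesgue_rV_shift R N) mA (@measurable_cube R N 1).
by rewrite cube1_neq0 mule1 mul1e => ->.
Qed.

Lemma measurable_eball (r : R) : measurable (@eball R N r).
Proof.
rewrite (_ : eball r = (@enorm R N) @^-1` `]-oo, r[).
  by apply: measurable_preimageT => //; exact: measurable_enorm.
by apply/seteqP; split => x /=; rewrite in_itv.
Qed.

Lemma lebesgue_eball_gt0 (r : R) : 0 < r -> (0 < leb (eball r))%E.
Proof.
(* With this side the cube has norms at most [N * l], which is strictly below [r], also when
   [N = 0]. *)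
move=> r0; pose l := r / N.+1%:R.
have l0 : 0 < l by rewrite divr_gt0.
apply: (@lt_le_trans _ _ (leb (@cube R N l))).
  by rewrite lebesgue_cube ?lte_fin ?exprn_gt0// ltW.
apply: le_measure; rewrite ?inE; [exact: measurable_cube|exact: measurable_eball|].
move=> x /= h; apply: (@le_lt_trans _ _ (N%:R * l)).
  apply: enorm_le_coord; first exact: ltW.
  by move=> i; have /andP[? ?] := h i; rewrite ger0_norm// ltW.
by rewrite /l mulrCA gtr_pMr// ltr_pdivrMr// mul1r ltr_nat.
Qed.

Lemma lebesgue_eball_lty (r : R) : (leb (eball r) < +oo)%E.
Proof.
have mc : measurable ((fun x => x + const_mx r) @^-1` @cube R N (2 * `|r|)).
  apply: measurable_preimageT; last exact: measurable_cube.
  by apply: measurable_addrV.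
apply: (@le_lt_trans _ _ (leb ((fun x => x + const_mx r) @^-1` @cube R N (2 * `|r|)))).
  apply: le_measure; rewrite ?inE//; first exact: measurable_eball.
  move=> x /= xr i; rewrite !mxE.
  have := le_lt_trans (coord_le_enorm x i) xr.
  rewrite ltr_norml => /andP[h1 h2]; have r0 : 0 < r by apply: le_lt_trans xr; exact: enorm_ge0.
  rewrite gtr0_norm//; apply/andP; split; lra.
rewrite lebesgue_rV_shift; last exact: measurable_cube.
by rewrite lebesgue_cube ?ltry.
Qed.

Lemma lebesgue_eball_fin (r : R) : leb (eball r) \is a fin_num.
Proof. by rewrite ge0_fin_numE// lebesgue_eball_lty. Qed.

(** Tested on the unit cube, [lebesgue_rV_map] reduces the factor to the measure of the dilated
    cube, which is again a cube when the ratio is positive; a negative ratio adds a change of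
    sign. *)
Lemma lebesgue_rV_scale (a : R) (A : set E) : a != 0 -> measurable A ->
  leb ((fun x => a *: x) @^-1` A) = ((`|a| ^- N)%:E * leb A)%E.
Proof.
move=> a0 mA.
have mZ b : measurable_fun [set: E] (fun x : E => b *: x) by apply: measurable_scalerV.
have K (b : R) (C : set E) : b != 0 -> measurable C ->
    leb ((fun x => b *: x) @^-1` C) = (leb ((fun x => b *: x) @^-1` @cube R N 1) * leb C)%E.
  move=> b0 mC; rewrite -(lebesgue_rVN mC) -(@lebesgue_rV_map _ _ _ _ _ _ (mZ b) (mZ b^-1))//.
  - by rewrite cube1_neq0 mule1.
  - by move=> x; rewrite scalerA mulVf// scale1r.
  - by move=> x; exists (b^-1 *: x) => y; rewrite scalerDr scalerA mulfV// scale1r.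
  - exact: measurable_cube.
have posK (b : R) (C : set E) : 0 < b -> measurable C ->
    leb ((fun x => b *: x) @^-1` C) = ((b ^- N)%:E * leb C)%E.
  move=> b0 mC; rewrite K ?gt_eqF//; congr (_ * _)%E.
  rewrite (_ : _ @^-1` _ = @cube R N b^-1); first by rewrite lebesgue_cube ?exprVn// invr_ge0 ltW.
  apply/seteqP; split => x /= h i; have := h i; rewrite !mxE.
    by rewrite pmulr_rgt0// -ler_pdivlMl// mulr1.
  by rewrite pmulr_rgt0// -ler_pdivlMl// mulr1.
case: (ltgtP a 0) a0 => // a0 _; last by rewrite posK// gtr0_norm.
rewrite ltr0_norm// -posK ?oppr_gt0// -lebesgue_rVN; last by apply: measurable_preimageT.
by congr (leb _); apply/seteqP; split => x /=; rewrite scalerN scaleNr.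
Qed.

Lemma lebesgue_eballE (r : R) : (0 < N)%N -> 0 <= r ->
  leb (eball r) = ((r ^+ N)%:E * leb (eball 1))%E.
Proof.
move=> N0; rewrite le_eqVlt => /predU1P[<-|r0].
  rewrite expr0n gtn_eqF// mul0e (_ : eball 0 = set0) ?measure0//.
  by apply/seteqP; split => x //=; rewrite /eball /= ltNge enorm_ge0.
have : leb ((fun x => r *: x) @^-1` (eball r)) = leb (eball 1).
  congr (leb _); apply/seteqP; split => x; rewrite /eball /= enormZ gtr0_norm//.
    by rewrite -ltr_pdivlMl// mulVf// gt_eqF.
  by rewrite -ltr_pdivlMl// mulVf// gt_eqF.
rewrite lebesgue_rV_scale ?gt_eqF//; last exact: measurable_eball.
move=> <-; rewrite gtr0_norm// muleA -EFinM mulfV ?mul1e//.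
by rewrite expf_neq0// gt_eqF.
Qed.

End lebesgue_map.

(** * Reflections and polarization *)

Section integral_map.
Local Open Scope ereal_scope.

Lemma ge0_integral_preserving d (T : measurableType d) (R : realType)
    (m : {measure set T -> \bar R}) (phi : T -> T) (f : T -> \bar R) :
  measurable_fun setT phi ->
  (forall A, measurable A -> m (phi @^-1` A) = m A) ->
  measurable_fun setT f -> (forall x, 0 <= f x) ->
  \int[m]_x f (phi x) = \int[m]_x f x.
Proof.
move=> mphi mp mf f0.
have := @ge0_integral_pushforward _ _ _ _ _ _ mphi m setT f measurableT mf (fun _ _ => f0 _).
rewrite preimage_setT => <-.
by apply: eq_measure_integral => A mA _; rewrite -[RHS]mp.
Qed.

End integral_map.

Lemma mule_cancelr (R : realType) (x y b : \bar R) :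
  b \is a fin_num -> (0 < b)%E -> (x * b = y * b)%E -> x = y.
Proof.
move=> bfin b0 h; have bi : (b * (fine b)^-1%:E = 1)%E.
  by rewrite -{1}(fineK bfin) -EFinM divff// gt_eqF// fine_gt0// b0 ltey_eq bfin.
by rewrite -[x]mule1 -[y]mule1 -bi !muleA h.
Qed.

Section reflection.
Context (R : realType) (N : nat).
Local Notation E := 'rV[R]_N.
Local Notation leb := (@lebesgue_rV R N).
Implicit Types (x y z a : E) (s : R).

(** Reflection across the hyperplane [dot x z = s]. The normal [z] need not be a unit vector, and
    [z = 0] gives the identity. *)
Definition refl z s x : E := x - (2 * (dot x z - s) / dot z z) *: z.

Lemma dot_refl z s x : z != 0 -> dot (refl z s x) z - s = - (dot x z - s).
Proof.
move=> z0; rewrite dotBl dotZl divfK ?dot_eq0//; lra.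
Qed.

Lemma refl0 s x : refl 0 s x = x.
Proof. by rewrite /refl scaler0 subr0. Qed.

Lemma reflK z s : involutive (refl z s).
Proof.
move=> x; have [->|z0] := eqVneq z 0; first by rewrite !refl0.
by rewrite {1}/refl dot_refl// mulrN mulNr scaleNr opprK addrNK.
Qed.

(** The correction term has the sign of the product of the heights of [x] and [y] above the
    hyperplane: reflecting [y] moves it away from points on its own side. That reflections are
    isometries also follows, by using the identity twice. *)
Lemma dist_refl z s x y : dot (x - refl z s y) (x - refl z s y) =
  dot (x - y) (x - y) + 4 * (dot x z - s) * (dot y z - s) / dot z z.
Proof.
have [->|z0] := eqVneq z 0.
  by rewrite refl0 (_ : dot 0 0 = 0) ?invr0 ?mulr0 ?addr0//; apply/eqP; rewrite dot_eq0.
rewrite /refl; set b := _ / _.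
have bz : b * dot z z = 2 * (dot y z - s) by rewrite divfK// dot_eq0.
rewrite opprB addrA; rewrite -mulrA; set c := _ / _.
have -> : 4 * (dot x z - s) * c = 2 * (dot x z - s) * b.
  by rewrite /b /c; field; rewrite dot_eq0.
rewrite (_ : x + b *: z - y = (x - y) + b *: z); last by rewrite addrAC.
rewrite (dotDl _ (b *: z)) !(dotDr _ _ (b *: z)) !(dotZl, dotZr) dotBl (dotC z (x - y)) dotBl bz.
rewrite !mulrDr -!addrA; congr (_ + _). lra.
Qed.

Lemma enorm_refl z s x y :
  enorm (refl z s x - refl z s y) = enorm (x - y).
Proof.
have [->|z0] := eqVneq z 0; first by rewrite !refl0.
rewrite !enormE dist_refl dot_refl//; congr Num.sqrt.
rewrite -(opprB _ (refl _ _ _)) dotNl dotNr opprK dist_refl.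
rewrite -(opprB x) dotNl dotNr opprK; lra.
Qed.

Lemma measurable_refl z s : measurable_fun setT (refl z s).
Proof.
apply: measurable_subrV => //; apply: measurable_scalerV => //.
apply: measurable_funM => //; apply: measurable_funM => //.
by apply: measurable_funB => //; exact: measurable_dot.
Qed.

(** The point [p] is fixed by the reflection, so the unit ball around it is its own mirror image,
    which forces the factor in [lebesgue_rV_map] to be 1. The linear part [refl z 0] accounts for
    the action on translations. *)
Lemma lebesgue_refl z s (A : set E) : measurable A -> leb (refl z s @^-1` A) = leb A.
Proof.
move=> mA; pose p := (s / dot z z) *: z.
have pE : refl z s p = p.
  have [->|z0] := eqVneq z 0; first by rewrite refl0.
  by rewrite /refl /p dotZl divfK ?dot_eq0// subrr mulr0 mul0r scale0r subr0.
pose B := (fun x => x - p) @^-1` @eball R N 1.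
have mB : measurable B.
  by apply: measurable_preimageT; [exact: measurable_subrV|exact: measurable_eball].
have lB : leb B = leb (eball 1) by rewrite lebesgue_rV_shift//; exact: measurable_eball.
have reflB : refl z s @^-1` B = B.
  have e x : enorm (refl z s x - p) = enorm (x - p) by rewrite -{1}pE enorm_refl.
  by apply/seteqP; split => x; rewrite /B /eball /= e.
have := @lebesgue_rV_map R N _ _ A B (measurable_refl z s) (measurable_refl z s) (reflK z s).
rewrite reflB (lebesgue_rVN mA) (muleC (leb B)) lB => h.
apply: mule_cancelr (h _ mA mB); first exact: lebesgue_eball_fin.
  exact: lebesgue_eball_gt0.
move=> a; exists (refl z 0 a) => x.
have -> b : refl z s (x + b) = refl z s x + refl z 0 b.
  rewrite /refl dotDl subr0 addrACA -opprD -scalerDl; congr (_ - _ *: _); lra.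
by rewrite reflK.
Qed.

Lemma refl_same_side z s x y : 0 <= (dot x z - s) * (dot y z - s) ->
  enorm (x - y) <= enorm (x - refl z s y).
Proof.
move=> h; rewrite ler_enorm dist_refl lerDl mulr_ge0 ?invr_ge0 ?dot_ge0//.
by rewrite -mulrA mulr_ge0.
Qed.

Lemma enorm_reflC z s x y : enorm (refl z s x - y) = enorm (x - refl z s y).
Proof. by rewrite -{1}(reflK z s y) enorm_refl. Qed.

End reflection.

Section radial.
Context (R : realType) (N : nat).
Local Notation E := 'rV[R]_N.
Local Notation leb := (@lebesgue_rV R N).
Local Open Scope ereal_scope.

Lemma radial_le (g : E -> \bar R) x y :
  radially_nonincreasing g -> (enorm y <= enorm x)%R -> g x <= g y.
Proof. by move=> [_ /(_ x y)]. Qed.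

Lemma radial_eq (g : E -> \bar R) x y :
  radially_nonincreasing g -> enorm x = enorm y -> g x = g y.
Proof. by move=> [/(_ x y)]. Qed.

Lemma radialP (g : E -> \bar R) :
  (forall x y, (enorm y <= enorm x)%R -> g x <= g y) -> radially_nonincreasing g.
Proof.
move=> h; split => // x y xy; apply/eqP.
by rewrite eq_le !h// xy.
Qed.

(** Such a set is the preimage under [enorm] of an interval, and every interval is Borel. Radially
    non-increasing functions are therefore measurable with no further assumption. *)
Lemma measurable_radial_downset (D : set E) :
  (forall x y, (enorm y <= enorm x)%R -> D x -> D y) -> measurable D.
Proof.
move=> hD; pose I := [set t : R | exists2 x, D x & (0 <= t <= enorm x)%R].
have -> : D = (@enorm R N) @^-1` I.
  apply/seteqP; split => [x Dx|x [y Dy /andP[_ xy]]]; last exact: hD xy Dy.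
  by exists x => //; rewrite enorm_ge0 lexx.
apply: measurable_preimageT; first exact: measurable_enorm.
apply: is_interval_measurable => t u [x Dx /andP[t0 tx]] [y Dy /andP[u0 uy]] v /andP[tv vu].
by exists y => //; rewrite (le_trans t0 tv) (le_trans vu uy).
Qed.

Lemma measurable_radial (g : E -> \bar R) :
  radially_nonincreasing g -> measurable_fun setT g.
Proof.
move=> gr; apply: (measurability _ (ErealGenOInfty.measurableE R)) => _ [_ [y ->] <-].
apply: measurableI => //; apply: measurable_radial_downset => x z xz /=.
by rewrite !in_itv /= !andbT => /lt_le_trans; apply; exact: radial_le xz.
Qed.

End radial.

Section symmetrize_integral.
Local Open Scope ereal_scope.

Lemma lee_double (R : realType) (x y : \bar R) : 0 <= x -> 0 <= y -> x + x <= y + y -> x <= y.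
Proof.
move: x y => [x| |] [y| |]//=; rewrite ?leey// !lee_fin => x0 y0; lra.
Qed.

(** Since [phi] preserves the measure, twice the integral of [f] is the integral of
    [f x + f (phi x)], so it suffices to compare sums over the pairs formed by [x] and [phi x]. *)
Lemma le_integral_sym d (T : measurableType d) (R : realType)
    (m : {measure set T -> \bar R}) (phi : T -> T) (f g : T -> \bar R) :
  measurable_fun setT phi -> (forall A, measurable A -> m (phi @^-1` A) = m A) ->
  measurable_fun setT f -> measurable_fun setT g ->
  (forall x, 0 <= f x) -> (forall x, 0 <= g x) ->
  (forall x, f x + f (phi x) <= g x + g (phi x)) ->
  \int[m]_x f x <= \int[m]_x g x.
Proof.
move=> mphi mp mf mg f0 g0 fg; apply: lee_double; rewrite ?integral_ge0//.
rewrite -{2}(ge0_integral_preserving mphi mp mf f0).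
rewrite -{2}(ge0_integral_preserving mphi mp mg g0).
have mfp : measurable_fun setT (fun x => f (phi x)) by exact: measurableT_comp.
have mgp : measurable_fun setT (fun x => g (phi x)) by exact: measurableT_comp.
rewrite -!ge0_integralD//; apply: ge0_le_integral => //.
- by move=> x _; rewrite adde_ge0.
- exact: emeasurable_funD.
- exact: emeasurable_funD.
Qed.

End symmetrize_integral.

(** * Polarization and its effect on the Riesz functional *)

Section polarization.
Context (R : realType) (N : nat).
Local Notation E := 'rV[R]_N.
Local Notation leb := (@lebesgue_rV R N).
Local Open Scope ereal_scope.

(** Two-point rearrangement: when [A] contains exactly one point of a mirror pair, the point kept is
    the one on the side [dot x z <= s]. For [s >= 0] that side contains the origin, so points move
    towards the origin. *)
Definition polarize (z : E) (s : R) (A : set E) : set E :=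
  [set x | A x /\ A (refl z s x) \/
           (dot x z <= s)%R /\ (A x \/ A (refl z s x))].

Variables (z : E) (s : R).
Hypotheses (z_neq0 : z != 0%R) (s_ge0 : (0 <= s)%R).
Local Notation sg := (refl z s).
Local Notation pol := (polarize z s).
Implicit Types (A B : set E) (x y : E).

Lemma mem_polarize A x : (x \in pol A) =
  (x \in A) && (sg x \in A) || (dot x z <= s)%R && ((x \in A) || (sg x \in A)).
Proof.
apply/idP/idP => [/set_mem[[/mem_set -> /mem_set ->]//|[-> [/mem_set ->|/mem_set ->]]]|].
- by rewrite orbT.
- by rewrite !orbT.
- move=> h; apply/mem_set; case/orP: h => [/andP[/set_mem ? /set_mem ?]|]; first by left.
  by move=> /andP[? /orP[/set_mem ?|/set_mem ?]]; right; split=> //; [left|right].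
Qed.

Lemma refl_fixed x : dot x z = s -> sg x = x.
Proof. by move=> h; rewrite /refl h subrr mulr0 mul0r scale0r subr0. Qed.

Lemma dot_refl_gt x : (dot x z < s)%R -> (dot (sg x) z <= s)%R = false.
Proof. by move=> h; have := dot_refl s x z_neq0 => h'; apply/negbTE; rewrite -ltNge; lra. Qed.

Lemma dot_refl_le x : (s < dot x z)%R -> (dot (sg x) z <= s)%R.
Proof. by move=> h; have := dot_refl s x z_neq0 => h'; lra. Qed.

Lemma polarize_le A x : (dot x z <= s)%R ->
  ((x \in pol A) = (x \in A) || (sg x \in A)) *
  ((sg x \in pol A) = (x \in A) && (sg x \in A)).
Proof.
rewrite !mem_polarize reflK => xs; rewrite xs.
move: xs; rewrite le_eqVlt => /predU1P[xs|xs].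
  by rewrite (refl_fixed xs) xs lexx orbb andbb; case: (_ \in _).
rewrite dot_refl_gt//; case: (x \in A); case: (sg x \in A) => //.
Qed.

Lemma measurable_polarize A : measurable A -> measurable (pol A).
Proof.
move=> mA; have mS : measurable (sg @^-1` A).
  by apply: measurable_preimageT => //; exact: measurable_refl.
have mH : measurable [set x : E | (dot x z <= s)%R].
  rewrite (_ : [set _ | _] = (fun x => dot x z) @^-1` `]-oo, s]).
    by apply: measurable_preimageT => //; exact: measurable_dot.
  by apply/seteqP; split => x /=; rewrite in_itv.
rewrite (_ : pol A = (A `&` sg @^-1` A) `|` ([set x : E | (dot x z <= s)%R] `&` (A `|` sg @^-1` A)))//.
by apply: measurableU; apply: measurableI => //; exact: measurableU.
Qed.

Lemma enorm_refl_ge x : (dot x z <= s)%R -> (enorm x <= enorm (sg x))%R.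
Proof.
move=> h; have := @refl_same_side R N z s 0%R x.
rewrite !sub0r !enormN; apply.
by rewrite (_ : dot 0 z = 0)%R;
  [rewrite sub0r mulNr -mulrN opprB mulr_ge0// subr_ge0 | rewrite /dot big1// => i _; rewrite mxE mul0r].
Qed.

Lemma polarize_eball A r : A `<=` eball r -> pol A `<=` eball r.
Proof.
move=> Ar x [[/Ar//]|[xs [/Ar//|/Ar]]].
by rewrite /eball /=; apply: le_lt_trans; exact: enorm_refl_ge.
Qed.

Let wlog_side (P : E -> Prop) : (forall x, P (sg x) -> P x) ->
  (forall x, (dot x z <= s)%R -> P x) -> forall x, P x.
Proof.
move=> hs h x; case: (leP (dot x z) s) => [/h//|xs].
by apply: hs; apply: h; exact: dot_refl_le.
Qed.

(** Counting form of [le_integral_sym]: each mirror pair has a representative with [dot x z <= s],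
    and it is enough to count how many of its points lie in [A] and in [B]. *)
Lemma le_measure_refl (A B : set E) : measurable A -> measurable B ->
  (forall x, (dot x z <= s)%R ->
    ((x \in A) + (sg x \in A) <= (x \in B) + (sg x \in B))%N) ->
  leb A <= leb B.
Proof.
move=> mA mB AB; rewrite -[A]setIT -[B]setIT -!integral_indic//.
apply: (@le_integral_sym _ _ _ _ sg) => //.
- exact: measurable_refl.
- by move=> C; exact: lebesgue_refl.
- by apply/measurable_EFinP; exact: measurable_indic.
- by apply/measurable_EFinP; exact: measurable_indic.
apply: wlog_side => x; first by rewrite reflK addeC (addeC (\1_B _)%:E).
by move=> /AB; rewrite /= !indicE -!EFinD lee_fin -!natrD ler_nat.
Qed.

Lemma lebesgue_polarize A : measurable A -> leb (pol A) = leb A.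
Proof.
move=> mA; have mP := measurable_polarize mA.
by apply/eqP; rewrite eq_le; apply/andP; split; apply: le_measure_refl => // x xs;
  rewrite !(polarize_le _ xs); case: (x \in A); case: (sg x \in A).
Qed.

(* Every point of [A] outside the ball that is reflected onto a point of the
   ball missing from [A] leaves the excess set. *)
Lemma lebesgue_polarize_excess A r : measurable A ->
  leb (pol A `\` eball r) + leb ((A `\` eball r) `&` sg @^-1` (eball r `\` A)) <=
  leb (A `\` eball r).
Proof.
move=> mA; have mP := measurable_polarize mA; have mb := @measurable_eball R N r.
have mS : measurable ((A `\` eball r) `&` sg @^-1` (eball r `\` A)).
  apply: measurableI; first exact: measurableD.
  by apply: measurable_preimageT; [exact: measurable_refl|exact: measurableD].
rewrite -measureU//; [|exact: measurableD|]; last first.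
  apply/seteqP; split => x //= [[polx nb] [_ [bx nAx]]].
  case: polx => [[_ //]|[xs _]]; apply: nb.
  by move: bx; rewrite /eball /=; apply: le_lt_trans; exact: enorm_refl_ge.
apply: le_measure_refl => //; [by apply: measurableU => //; exact: measurableD|exact: measurableD|].
move=> x xs; have bb : sg x \in eball r -> x \in eball r.
  by rewrite !inE; apply: le_lt_trans; exact: enorm_refl_ge.
have memS y : (y \in ((A `\` eball r) `&` sg @^-1` (eball r `\` A))) =
    [&& (y \in A), (y \notin eball r), (sg y \in eball r) & (sg y \notin A)].
  by rewrite in_setI in_setD -andbA; congr [&& _, _ & _];
    rewrite -[LHS]/(sg y \in eball r `\` A) in_setD.
rewrite !in_setU !in_setD !memS reflK !(polarize_le _ xs).
by move: bb; case: (x \in A); case: (sg x \in A); case: (x \in eball r);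
  case: (sg x \in eball r) => //= /(_ isT).
Qed.

(** Here [j] is the kernel between points on the same side and [j'] between points on opposite
    sides; [a], [a'] tell whether [x] and its mirror image lie in the first set, [b], [b'] do so for
    [y] and the second set. The two sides agree except in the two crossed cases, where polarization
    replaces one [j'] by [j]. *)
Lemma polarize_4terms (a a' b b' : bool) (j j' : \bar R) : 0 <= j' -> j' <= j ->
  (if a && b then j else 0) + (if a' && b then j' else 0) +
  ((if a && b' then j' else 0) + (if a' && b' then j else 0)) <=
  (if (a || a') && (b || b') then j else 0) + (if (a && a') && (b || b') then j' else 0) +
  ((if (a || a') && (b && b') then j' else 0) + (if (a && a') && (b && b') then j else 0)).
Proof.
move=> j0 jj; case: a; case: a'; case: b; case: b';
  rewrite /= ?adde0 ?add0e //; by rewrite addeC.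
Qed.

Variables (K : E -> \bar R).
Hypotheses (K_ge0 : forall x, 0 <= K x) (K_radial : radially_nonincreasing K).

Definition riesz_kernel A B (z : E * E) : \bar R :=
  if (z.1 \in A) && (z.2 \in B) then K (z.1 - z.2)%R else 0.

Definition riesz A B : \bar R := \int[leb]_x \int[leb]_y riesz_kernel A B (x, y).

Lemma riesz_kernel_ge0 A B u : 0 <= riesz_kernel A B u.
Proof. by rewrite /riesz_kernel; case: ifP. Qed.

Lemma measurable_riesz_kernel A B : measurable A -> measurable B ->
  measurable_fun setT (riesz_kernel A B).
Proof.
move=> mA mB; apply: measurable_fun_ifT => //.
  by apply: measurable_and; exact: measurable_mem.
apply: (measurableT_comp (measurable_radial K_radial)).
by apply: measurable_subrV.
Qed.

Lemma riesz_kernel_polarize A B x y :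
  (riesz_kernel A B (x, y) + riesz_kernel A B (sg x, y)) +
  (riesz_kernel A B (x, sg y) + riesz_kernel A B (sg x, sg y)) <=
  (riesz_kernel (pol A) (pol B) (x, y) + riesz_kernel (pol A) (pol B) (sg x, y)) +
  (riesz_kernel (pol A) (pol B) (x, sg y) + riesz_kernel (pol A) (pol B) (sg x, sg y)).
Proof.
rewrite /riesz_kernel /=.
have KC u w : K (sg u - w)%R = K (u - sg w)%R.
  by apply: radial_eq => //; exact: enorm_reflC.
(* The sum runs over all mirror images of [(x, y)], so replacing either point by its image only
   permutes the terms. *)
wlog xs : x / (dot x z <= s)%R => [h|].
  case: (leP (dot x z) s) => [/h//|xs]; have := h (sg x) (dot_refl_le xs).
  have comm a b c d : a + b + (c + d) = b + a + (d + c) :> \bar R.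
    by rewrite (addeC a) (addeC c).
  by rewrite reflK comm [X in _ <= X]comm.
wlog ys : y / (dot y z <= s)%R => [h|].
  case: (leP (dot y z) s) => [/h//|ys]; have := h (sg y) (dot_refl_le ys).
  by rewrite reflK addeC [X in _ <= X]addeC.
rewrite !KC reflK !(polarize_le _ xs) !(polarize_le _ ys).
apply: polarize_4terms => //; apply: radial_le => //; apply: refl_same_side.
by rewrite -mulrNN !opprB mulr_ge0// subr_ge0.
Qed.

(** Using [le_integral_sym] once in each variable reduces the claim to the four mirror images of a
    single pair of points. *)
Lemma riesz_polarize A B : measurable A -> measurable B ->
  riesz A B <= riesz (pol A) (pol B).
Proof.
move=> mA mB.
have mk := measurable_riesz_kernel mA mB.
have mkp := measurable_riesz_kernel (measurable_polarize mA) (measurable_polarize mB).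
have mr : measurable_fun setT sg by exact: measurable_refl.
have leb_sg C : measurable C -> leb (sg @^-1` C) = leb C by exact: lebesgue_refl.
have m2 C D x : measurable_fun setT (riesz_kernel C D) ->
    measurable_fun setT (fun y => riesz_kernel C D (x, y)).
  by move=> h; exact: measurable_fun_pair2.
apply: (le_integral_sym mr leb_sg).
- exact: (measurable_fun_fubini_tonelli_F _ mk (riesz_kernel_ge0 A B)).
- exact: (measurable_fun_fubini_tonelli_F _ mkp (riesz_kernel_ge0 _ _)).
- by move=> x; apply: integral_ge0 => y _; exact: riesz_kernel_ge0.
- by move=> x; apply: integral_ge0 => y _; exact: riesz_kernel_ge0.
move=> x; rewrite -!ge0_integralD//; try (by move=> y _; exact: riesz_kernel_ge0);
  try exact: m2.
apply: (le_integral_sym mr leb_sg).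
- by apply: emeasurable_funD; exact: m2.
- by apply: emeasurable_funD; exact: m2.
- by move=> y; rewrite adde_ge0// riesz_kernel_ge0.
- by move=> y; rewrite adde_ge0// riesz_kernel_ge0.
move=> y; exact: riesz_kernel_polarize.
Qed.

End polarization.

(** * Averaging over reflections *)

Section measurable_sets.
Context d (T : measurableType d) (R : realType).
Implicit Types f g : T -> R.

Lemma measurable_boolP (b : T -> bool) :
  measurable_fun setT b -> measurable [set t | b t].
Proof.
move=> mb; rewrite (_ : [set _ | _] = b @^-1` [set true]).
  exact: measurable_preimageT.
by apply/seteqP; split => x /=.
Qed.

Lemma measurable_set_lt f g : measurable_fun setT f -> measurable_fun setT g ->
  measurable [set t | f t < g t].
Proof. by move=> mf mg; apply: measurable_boolP; exact: measurable_fun_ltr. Qed.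

Lemma measurable_set_le f g : measurable_fun setT f -> measurable_fun setT g ->
  measurable [set t | f t <= g t].
Proof. by move=> mf mg; apply: measurable_boolP; exact: measurable_fun_ler. Qed.

Lemma measurable_set_and (A B : set T) : measurable A -> measurable B ->
  measurable [set t | A t /\ B t].
Proof. exact: measurableI. Qed.

Lemma measurable_inv_ge0 f : measurable_fun setT f -> (forall t, 0 <= f t) ->
  measurable_fun setT (fun t => (f t)^-1).
Proof.
move=> mf f0; under eq_fun do rewrite -powR_inv1//.
exact: (measurableT_comp (measurable_powR (-1)) mf).
Qed.

Lemma measurable_reflf N (z x : T -> 'rV[R]_N) (s : T -> R) :
  measurable_fun setT z -> measurable_fun setT s -> measurable_fun setT x ->
  measurable_fun setT (fun t => refl (z t) (s t) (x t)).
Proof.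
move=> mz ms mx; apply: measurable_subrV => //; apply: measurable_scalerV => //.
apply: measurable_funM; last first.
  by apply: measurable_inv_ge0; [exact: measurable_dot|move=> t; exact: dot_ge0].
apply: measurable_funM => //; apply: measurable_funB => //; exact: measurable_dot.
Qed.

End measurable_sets.

Lemma product_measureE d1 d2 (T1 : measurableType d1) (T2 : measurableType d2)
    (R : realType) (m1 : {sigma_finite_measure set T1 -> \bar R})
    (m2 : {sigma_finite_measure set T2 -> \bar R}) (S : set (T1 * T2)) :
  ((m1 \x m2) S = \int[m1]_x m2 [set y | S (x, y)])%E.
Proof.
by apply: eq_integral => x _ /=; congr (m2 _); apply/seteqP; split => y /=;
  rewrite /xsection /=; [exact: set_mem|exact: mem_set].
Qed.

Lemma sigma_finite_product d1 d2 (T1 : measurableType d1) (T2 : measurableType d2)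
    (R : realType) (m1 : {sigma_finite_measure set T1 -> \bar R})
    (m2 : {sigma_finite_measure set T2 -> \bar R}) :
  exists m : {sigma_finite_measure set (T1 * T2)%type -> \bar R},
    forall A, m A = (m1 \x m2)%E A.
Proof.
have /sigma_finiteP[F [TF ndF Foo]] := sigma_finiteT m1.
have /sigma_finiteP[G [TG ndG Goo]] := sigma_finiteT m2.
apply: sigma_finite_measure_pack; exists (fun n => F n `*` G n) => [|n].
  apply/seteqP; split => // -[x y] _.
  have [i _ Fx] : (\bigcup_n F n) x by rewrite -TF.
  have [j _ Gy] : (\bigcup_n G n) y by rewrite -TG.
  exists (maxn i j) => //; split => /=.
    by have /subsetPset := ndF _ _ (leq_maxl i j); exact.
  by have /subsetPset := ndG _ _ (leq_maxr i j); exact.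
have [[mF Ffin] [mG Gfin]] := (Foo n, Goo n).
by split; [exact: measurableX|rewrite /= product_measure1E// lte_mul_pinfty// ge0_fin_numE].
Qed.

Section measurable_sections.
Context d1 d2 (T1 : measurableType d1) (T2 : measurableType d2) (R : realType).
Variables (m1 : {sigma_finite_measure set T1 -> \bar R})
  (m2 : {sigma_finite_measure set T2 -> \bar R}) (S : set (T1 * T2)).
Hypothesis mS : measurable S.

Lemma measurable_fun_section1 : measurable_fun setT (fun x => m2 [set y | S (x, y)]).
Proof.
rewrite (_ : (fun x => _) = m2 \o xsection S); first exact: measurable_fun_xsection.
apply/funext => x /=; congr (m2 _); apply/seteqP; split => y /=;
  [exact: mem_set|exact: set_mem].
Qed.

Lemma measurable_fun_section2 : measurable_fun setT (fun y => m1 [set x | S (x, y)]).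
Proof.
rewrite (_ : (fun x => _) = m1 \o ysection S); first exact: measurable_fun_ysection.
apply/funext => x /=; congr (m1 _); apply/seteqP; split => y /=;
  [exact: mem_set|exact: set_mem].
Qed.

End measurable_sections.

Lemma lebesgue_rV_affine (R : realType) N (a : 'rV[R]_N) (b : R) (A : set 'rV[R]_N) :
  b != 0 -> measurable A ->
  lebesgue_rV ((fun x => a + b *: x) @^-1` A) = ((`|b| ^- N)%:E * lebesgue_rV A)%E.
Proof.
move=> b0 mA; rewrite -(lebesgue_rV_shift a mA) -lebesgue_rV_scale//.
  by congr (lebesgue_rV _); apply/seteqP; split => x /=; rewrite addrC.
by apply: measurable_preimageT => //; exact: measurable_addrV.
Qed.

Lemma integral_ge_indic d (T : measurableType d) (R : realType)
    (m : {measure set T -> \bar R}) (A : set T) (f : T -> \bar R) (k : \bar R) :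
  measurable A -> (0 <= k)%E -> measurable_fun setT f -> (forall x, 0 <= f x)%E ->
  (forall x, A x -> k <= f x)%E -> (k * m A <= \int[m]_x f x)%E.
Proof.
move=> mA k0 mf f0 kf; rewrite -integral_mul_indic//; apply: ge0_le_integral => //.
- by move=> x _; rewrite mule_ge0// lee_fin.
- apply: emeasurable_funM => //; apply/measurable_EFinP; exact: measurable_indic.
- move=> x _; rewrite indicE; case: (boolP (x \in A)) => xA; rewrite ?mule1 ?mule0//.
  by apply: kf; exact: set_mem.
Qed.

Lemma integral_le_indic d (T : measurableType d) (R : realType)
    (m : {measure set T -> \bar R}) (A : set T) (f : T -> \bar R) (k : \bar R) :
  measurable A -> (0 <= k)%E -> measurable_fun setT f -> (forall x, 0 <= f x)%E ->
  (forall x, A x -> f x <= k)%E -> (forall x, ~ A x -> f x = 0)%E ->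
  (\int[m]_x f x <= k * m A)%E.
Proof.
move=> mA k0 mf f0 kf fA; rewrite -integral_mul_indic//; apply: ge0_le_integral => //.
- apply: emeasurable_funM => //; apply/measurable_EFinP; exact: measurable_indic.
- move=> x _; rewrite indicE; case: (boolP (x \in A)) => xA; rewrite ?mule1 ?mule0//.
    by apply: kf; exact: set_mem.
  by rewrite fA// => /mem_set; rewrite (negbTE xA).
Qed.

Section averaging.
Context (R : realType) (N : nat).
Local Notation E := 'rV[R]_N.
Local Notation F := 'rV[R]_1.
Local Notation leb := (@lebesgue_rV R N).
Local Notation leb1 := (@lebesgue_rV R 1).
Local Open Scope ereal_scope.

Variables (r del d : R) (P Q : set E).
Hypotheses (mP : measurable P) (mQ : measurable Q).
Hypotheses (P_ball : P `<=` eball r) (Q_ball : Q `<=` eball r).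
Hypothesis PQ : forall x y, P x -> Q y -> (enorm y < enorm x)%R.
Hypotheses (r_gt0 : (0 < r)%R) (del_gt0 : (0 < del)%R) (d_gt0 : (0 < d)%R).
Hypothesis del_small : leb (eball (2 * del)%R) <= (d / 2)%:E.
Hypothesis Q_large : d%:E <= leb Q.

(** Parameters [(z, s)] of the reflections that carry [x] into [Q], cut off to a bounded region of
    finite measure. The level [s] is a row vector of length one so that [lebesgue_rV_affine] covers
    its change of variable. *)
Let W (x : E) : set (E * F) := [set w : E * F |
  [/\ Q (refl w.1 (w.2 ord0 ord0) x), (enorm w.1 < 2 * r)%R, (enorm w.2 < r ^+ 2)%R,
      w.1 != 0%R & (0 <= w.2 ord0 ord0)%R]].

Let I12 : set R := `]1%R, 2%R]%classic.

Let measure_unit_shift : leb1 [set a : F | I12 (a ord0 ord0)] = 1.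
Proof.
have -> : [set a : F | I12 (a ord0 ord0)] = (fun x => x + const_mx (- 1)%R)%R @^-1` @cube R 1 1.
  apply/seteqP; split => a /=.
    by rewrite /I12/= in_itv /= => /andP[h1 h2] i; rewrite (ord1 i) !mxE; apply/andP; split; lra.
  by move=> /(_ ord0); rewrite /I12/= !mxE in_itv /= => /andP[h1 h2]; apply/andP; split; lra.
rewrite lebesgue_rV_shift; last exact: measurable_cube.
by rewrite lebesgue_cube// expr1n.
Qed.

(* The substitution [s = x.z - a |z|^2 / 2] turns the reflection of [x] into
   [x - a z]. *)
Let refl_subst (x z : E) (a : R) : z != 0%R ->
  refl z (dot x z - a * dot z z / 2) x = (x - a *: z)%R.
Proof.
move=> z0; rewrite /refl; congr (_ - _ *: _)%R.
by rewrite opprB addrC subrK; field; rewrite dot_eq0.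
Qed.

Let enorm1 (a : F) : enorm a = `|a ord0 ord0|%R.
Proof. by rewrite enormE /dot big_ord1 -expr2 sqrtr_sqr. Qed.

Let dotBB (x z : E) a : dot (x - a *: z) (x - a *: z) =
  (dot x x - 2 * a * dot x z + a ^+ 2 * dot z z)%R.
Proof. by rewrite !(dotBl, dotBr, dotZl, dotZr) (dotC z x); ring. Qed.

(** The same reflections in the coordinates [(z, a)], where the image of [x] is [x - a *: z].
    Keeping [a] between 1 and 2 fits the cut-off of [W], and the lower bound on [enorm z] controls
    the Jacobian of the substitution. *)
Let G (x : E) : set (E * F) := [set w : E * F |
  [/\ I12 (w.2 ord0 ord0), Q (x - w.2 ord0 ord0 *: w.1)%R & (del <= enorm w.1)%R]].

Let W_of_G x z (a : F) : P x -> G x (z, a) ->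
  W x (z, const_mx (dot x z) + (- (dot z z / 2)) *: a)%R.
Proof.
move=> Px [] /=; set b := a ord0 ord0; rewrite /I12 /= in_itv /= => /andP[b1 b2] Qy zdel.
set y := (x - b *: z)%R in Qy.
have z0 : z != 0%R by rewrite -enorm_eq0 gt_eqF// (lt_le_trans del_gt0).
have sE : ((const_mx (dot x z) + (- (dot z z / 2)) *: a : F) ord0 ord0 =
    dot x z - b * dot z z / 2)%R by rewrite !mxE -/b; ring.
have yx := PQ Px Qy; have /= xr := P_ball Px; have /= yr := Q_ball Qy.
rewrite /eball /= in xr yr.
rewrite enorm_lt ?enorm_ge0// sqr_enorm in yx.
rewrite enorm_lt ?ltW// in xr; rewrite enorm_lt ?ltW// in yr.
have yE : dot y y = (dot x x - 2 * b * dot x z + b ^+ 2 * dot z z)%R by exact: dotBB.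
(* This identity yields both bounds on the level: it is positive because [x] is farther from the
   origin than [y], and below [r ^+ 2] because [x] lies in the ball and [b > 1]. *)
have bs : (2 * b * (dot x z - b * dot z z / 2) = dot x x - dot y y)%R by rewrite yE; field.
have s0 : (0 < dot x z - b * dot z z / 2)%R.
  by rewrite -(@pmulr_rgt0 _ (2 * b)%R) ?bs; lra.
split => /=.
- by rewrite sE refl_subst.
- rewrite enorm_lt; last by rewrite mulr_ge0// ltW.
  have h := dot_sub_le x y; rewrite /y subKr !(dotZl, dotZr) in h.
  apply: le_lt_trans (_ : (b * (b * dot z z) < _)%R); last by lra.
  by rewrite mulrA ler_peMl ?dot_ge0// -expr2 exprn_ege1// ltW.
- rewrite enorm1 sE gtr0_norm//.
  have := dot_ge0 y; nra.
- by [].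
- by rewrite sE ltW.
Qed.

Let measurable_W x : measurable (W x).
Proof.
rewrite (_ : W x = [set w : E * F | Q (refl w.1 (w.2 ord0 ord0) x) /\
   (((enorm w.1 < 2 * r)%R /\ (enorm w.2 < r ^+ 2)%R) /\
    ((0 < enorm w.1)%R /\ (0 <= w.2 ord0 ord0)%R))]); last first.
  apply/seteqP; split => -[z a] [].
    move=> /= ? ? ? z0 ?; do ! split => //; exact: enorm_gt0.
  by move=> ? [[? ?] [/lt0r_neq0 + ?]]; rewrite enorm_eq0 => ?; split.
have ms : measurable_fun setT (fun w : E * F => w.2 ord0 ord0).
  exact: (measurableT_comp (measurable_coord ord0) measurable_snd).
apply: measurable_set_and.
  by apply: (measurable_preimageT _ mQ); exact: measurable_reflf.
apply: measurable_set_and; apply: measurable_set_and.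
- by apply: measurable_set_lt => //; exact: measurable_enorm.
- by apply: measurable_set_lt => //; exact: measurable_enorm.
- by apply: measurable_set_lt => //; exact: measurable_enorm.
- exact: measurable_set_le.
Qed.

Let measurable_I12 : measurable [set a : F | I12 (a ord0 ord0)].
Proof.
apply: (@measurable_preimageT _ _ _ _ (fun a : F => a ord0 ord0) I12).
  exact: measurable_coord.
exact: measurable_itv.
Qed.

Let measurable_G x : measurable (G x).
Proof.
have ms : measurable_fun setT (fun w : E * F => w.2 ord0 ord0).
  exact: (measurableT_comp (measurable_coord ord0) measurable_snd).
rewrite (_ : G x = [set w : E * F | I12 (w.2 ord0 ord0) /\
    (Q (x - w.2 ord0 ord0 *: w.1)%R /\ (del <= enorm w.1)%R)]); last first.
  by apply/seteqP; split => -[z a] []//= ? []//.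
apply: measurable_set_and.
  by apply: (measurable_preimageT ms); exact: measurable_itv.
apply: measurable_set_and.
  apply: (measurable_preimageT _ mQ); apply: measurable_subrV => //.
  exact: measurable_scalerV.
by apply: measurable_set_le => //; exact: measurable_enorm.
Qed.

(** For fixed [z] the level is affine in [a] with slope [- (dot z z / 2)], whose absolute value is
    at least [del ^+ 2 / 2] where [G] has a non-empty section. *)
Let leb1_W x z : P x ->
  (del ^+ 2 / 2)%:E * leb1 [set a | G x (z, a)] <= leb1 [set a | W x (z, a)].
Proof.
move=> Px; have mW : measurable [set a | W x (z, a)].
  by apply: measurable_preimageT (measurable_W x); exact: pair1_measurable.
have mG : measurable [set a | G x (z, a)].
  by apply: measurable_preimageT (measurable_G x); exact: pair1_measurable.
case: (ltP (enorm z) del) => zdel.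
  rewrite (_ : [set a | G x (z, a)] = set0) ?measure0 ?mule0//.
  by apply/seteqP; split => a //= [] /= _ _; rewrite leNgt zdel.
have z0 : z != 0%R by rewrite -enorm_eq0 gt_eqF// (lt_le_trans del_gt0).
have zz : (0 < dot z z / 2)%R by rewrite divr_gt0// dot_gt0.
pose phi (a : F) : F := (const_mx (dot x z) + (- (dot z z / 2)) *: a)%R.
have phiE : leb1 (phi @^-1` [set a | W x (z, a)]) =
    ((dot z z / 2)^-1)%:E * leb1 [set a | W x (z, a)].
  rewrite lebesgue_rV_affine//; last by rewrite oppr_eq0 gt_eqF.
  by rewrite normrN gtr0_norm// expr1.
have -> : leb1 [set a | W x (z, a)] =
    (dot z z / 2)%:E * leb1 (phi @^-1` [set a | W x (z, a)]).
  by rewrite phiE muleA -EFinM mulfV ?gt_eqF// mul1e.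
apply: lee_pmul => //; first by rewrite lee_fin divr_ge0// sqr_ge0.
  rewrite lee_fin ler_pM2r// -sqr_enorm ler_sqr ?nnegrE ?enorm_ge0//; exact: ltW.
apply: le_measure; rewrite ?inE//; last by move=> a; exact: W_of_G.
apply: measurable_preimageT => //; apply: measurable_addrV => //.
exact: measurable_scalerV.
Qed.

Let leb_G x (a : F) : I12 (a ord0 ord0) ->
  (2 ^- N * (d / 2))%:E <= leb [set z | G x (z, a)].
Proof.
move=> ha; have := ha; rewrite /I12 /= in_itv /=; set b := a ord0 ord0 => /andP[b1 b2].
(* Removing from [Q] the ball of radius [2 * del] around [x] costs at most half of [d], and leaves
   only [z] with [enorm (b *: z) >= 2 * del], hence [enorm z >= del] as [b <= 2]. *)
pose B' := (fun y : E => x + (- 1) *: y)%R @^-1` eball (2 * del)%R.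
have mB' : measurable B'.
  apply: measurable_preimageT; last exact: measurable_eball.
  by apply: measurable_addrV => //; exact: measurable_scalerV.
have lB' : leb B' <= (d / 2)%:E.
  rewrite lebesgue_rV_affine//; last exact: measurable_eball.
  by rewrite normrN1 expr1n invr1 mul1e.
have lQ : (d / 2)%:E <= leb (Q `\` B').
  have : leb Q <= leb (Q `\` B') + leb B'.
    rewrite (le_trans _ (measureU2 _ _ _))//; [|exact: measurableD].
    apply: le_measure; rewrite ?inE//; first by apply: measurableU => //; exact: measurableD.
    by move=> y Qy; have [?|?] := pselect (B' y); [right|left].
  move=> /(le_trans Q_large) h.
  have := le_trans h (leeD2l _ lB').
  by rewrite -leeBlDr// -EFinB; apply: le_trans; rewrite lee_fin; lra.
have mG : measurable [set z | G x (z, a)].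
  by apply: measurable_preimageT (measurable_G x); exact: pair2_measurable.
have mS : measurable (Q `\` B') by exact: measurableD.
apply: (@le_trans _ _ (leb ((fun z : E => x + (- b) *: z)%R @^-1` (Q `\` B')))).
  rewrite lebesgue_rV_affine ?oppr_eq0 ?gt_eqF//; last by lra.
  rewrite EFinM; apply: lee_pmul => //; rewrite ?lee_fin ?invr_ge0 ?exprn_ge0//.
    by rewrite divr_ge0// ltW.
  have b0 : (0 < b)%R by lra.
  rewrite normrN gtr0_norm// lef_pV2 ?posrE ?exprn_gt0//.
  by apply: lerXn2r; rewrite ?nnegrE//; exact: ltW.
apply: le_measure; rewrite ?inE//.
  apply: measurable_preimageT => //.
  by apply: measurable_addrV => //; exact: measurable_scalerV.
move=> z /= [Qy nB]; split => //=; first by rewrite -scaleNr.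
have : ~ (enorm (b *: z) < 2 * del)%R.
  move: nB; rewrite /B' /eball /= scaleN1r opprD -scaleNr opprK addrA subrr add0r.
  exact.
move/negP; rewrite -leNgt enormZ gtr0_norm; last by lra.
have := enorm_ge0 z; nra.
Qed.

Let measure_W x : P x ->
  (del ^+ 2 / 2 * (2 ^- N * (d / 2)))%:E <= (leb \x leb1) (W x).
Proof.
move=> Px; have mW := measurable_W x; have mG := measurable_G x.
have del0 : (0 <= del ^+ 2 / 2)%R by rewrite divr_ge0// sqr_ge0.
rewrite product_measureE.
apply: (@le_trans _ _ (\int[leb]_z ((del ^+ 2 / 2)%:E * leb1 [set a | G x (z, a)]))); last first.
  apply: ge0_le_integral => //.
  - by move=> z _; rewrite mule_ge0.
  - by apply: measurable_funeM; exact: measurable_fun_section1.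
  - exact: measurable_fun_section1.
  - by move=> z _; exact: leb1_W.
rewrite ge0_integralZl_EFin//; last exact: measurable_fun_section1.
rewrite EFinM; apply: lee_pmul => //.
  by rewrite lee_fin mulr_ge0 ?invr_ge0 ?exprn_ge0// divr_ge0// ltW.
rewrite (tonelli_set _ _ mG) -[leLHS]mule1 -measure_unit_shift.
apply: integral_ge_indic => //.
- by rewrite lee_fin mulr_ge0 ?invr_ge0 ?exprn_ge0// divr_ge0// ltW.
- exact: measurable_fun_section2.
- by move=> a; exact: leb_G.
Qed.

(** The triples [(z, s, x)] with [x] in [P] reflected into [Q] are measured in two orders: each [x]
    admits many parameters by [measure_W], while each parameter serves points of measure at most
    [eta]. Read contrapositively, some reflection carries a definite part of [P] into [Q]. *)
Lemma averaging (eta : \bar R) : 0 <= eta ->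
  (forall z s, z != 0%R -> (0 <= s)%R -> leb (P `&` refl z s @^-1` Q) <= eta) ->
  (del ^+ 2 / 2 * (2 ^- N * (d / 2)))%:E * leb P <=
  eta * (leb (eball (2 * r)%R) * leb1 (eball (r ^+ 2)%R)).
Proof.
move=> eta0 heta.
(* [m12] is the product measure with its sigma-finite structure, known from here on only through
   these two facts. *)
have [m12 [m12W m12B]] : exists m12 : {sigma_finite_measure set (E * F)%type -> \bar R},
    (forall x, P x -> (del ^+ 2 / 2 * (2 ^- N * (d / 2)))%:E <= m12 (W x)) /\
    m12 (@eball R N (2 * r)%R `*` @eball R 1 (r ^+ 2)%R) =
    leb (eball (2 * r)%R) * leb1 (eball (r ^+ 2)%R).
  have [m12 m12E] := sigma_finite_product leb leb1.
  exists m12; split; first by move=> x Px; rewrite m12E; exact: measure_W.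
  by rewrite m12E product_measure1E//; exact: measurable_eball.
pose T := [set w : (E * F) * E | P w.2 /\ W w.2 w.1].
have mT : measurable T.
  rewrite (_ : T = [set w : (E * F) * E | P w.2 /\
     (Q (refl w.1.1 (w.1.2 ord0 ord0) w.2) /\
   (((enorm w.1.1 < 2 * r)%R /\ (enorm w.1.2 < r ^+ 2)%R) /\
    ((0 < enorm w.1.1)%R /\ (0 <= w.1.2 ord0 ord0)%R)))]); last first.
    apply/seteqP; split => -[[z a] x] [] Px.
      move=> [] /= ? ? ? z0 ?; do ! split => //; exact: enorm_gt0.
    by move=> [? [[? ?] [/lt0r_neq0 + ?]]]; rewrite enorm_eq0 => ?; split.
  have m1 : measurable_fun setT (fun w : (E * F) * E => w.1.1) by exact: measurableT_comp.
  have m2 : measurable_fun setT (fun w : (E * F) * E => w.1.2) by exact: measurableT_comp.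
  have ms : measurable_fun setT (fun w : (E * F) * E => w.1.2 ord0 ord0).
    exact: (measurableT_comp (measurable_coord ord0) m2).
  apply: measurable_set_and; first by apply: (measurable_preimageT _ mP).
  apply: measurable_set_and.
    by apply: (measurable_preimageT _ mQ); exact: measurable_reflf.
  apply: measurable_set_and; apply: measurable_set_and.
  - by apply: measurable_set_lt => //; exact: measurable_enorm.
  - by apply: measurable_set_lt => //; exact: measurable_enorm.
  - by apply: measurable_set_lt => //; exact: measurable_enorm.
  - exact: measurable_set_le.
have k0 : (0 <= del ^+ 2 / 2 * (2 ^- N * (d / 2)))%R.
  rewrite !mulr_ge0 ?sqr_ge0 ?invr_ge0 ?exprn_ge0//; exact: ltW.
apply: (@le_trans _ _ (\int[leb]_x m12 [set w | T (w, x)])).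
  apply: integral_ge_indic => //; first exact: measurable_fun_section2.
  move=> x Px; apply: le_trans (m12W x Px) _.
  apply: le_measure; rewrite ?inE//.
  by apply: measurable_preimageT mT; exact: pair2_measurable.
rewrite -(tonelli_set m12 leb mT).
have mB : measurable (@eball R N (2 * r)%R `*` @eball R 1 (r ^+ 2)%R).
  by apply: measurableX; exact: measurable_eball.
apply: (@le_trans _ _ (eta * m12 (@eball R N (2 * r)%R `*` @eball R 1 (r ^+ 2)%R))).
  apply: integral_le_indic => //; first exact: measurable_fun_section1.
    move=> [z a] _; have [hz|hz] := pselect (z != 0%R /\ (0 <= a ord0 ord0)%R); last first.
      rewrite (_ : [set y | T _] = set0) ?measure0//.
      by apply/seteqP; split => x //= [_ []] /= _ _ _ z0 a0; case: hz.
    apply: le_trans (heta z (a ord0 ord0) hz.1 hz.2).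
    apply: le_measure; rewrite ?inE//.
    - by apply: measurable_preimageT mT; exact: pair1_measurable.
    - apply: measurableI => //; apply: measurable_preimageT => //; exact: measurable_refl.
    - by move=> x [Px []].
  move=> [z a] nB; rewrite (_ : [set y | T _] = set0) ?measure0//.
  by apply/seteqP; split => x //= [_ []] /= _ z2 a2 _ _; apply: nB.
by rewrite m12B.
Qed.
End averaging.

(** * Symmetrization and the Riesz rearrangement inequality *)

Section symmetrization.
Context (R : realType) (N : nat).
Local Notation E := 'rV[R]_N.
Local Notation leb := (@lebesgue_rV R N).
Local Open Scope ereal_scope.
Hypothesis N_gt0 : (0 < N)%N.

Lemma lebesgue_eball_lt (r t : R) : (0 <= r)%R -> (r < t)%R ->
  leb (eball r) < leb (eball t).
Proof.
move=> r0 rt; have t0 : (0 <= t)%R by rewrite (le_trans r0)// ltW.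
rewrite (lebesgue_eballE N_gt0 r0) (lebesgue_eballE N_gt0 t0).
rewrite lte_pmul2r ?lebesgue_eball_fin//; last exact: lebesgue_eball_gt0.
by rewrite lte_fin ltrXn2r// -lt0n.
Qed.

Lemma lebesgue_eball_exists (m : R) : (0 <= m)%R ->
  exists2 r : R, (0 <= r)%R & leb (eball r) = m%:E.
Proof.
move=> m0; pose b := fine (leb (eball 1)).
have b0 : (0 < b)%R by rewrite fine_gt0// lebesgue_eball_gt0// lebesgue_eball_lty.
exists ((m / b) `^ (N%:R^-1))%R; first exact: powR_ge0.
rewrite lebesgue_eballE// ?powR_ge0//.
rewrite -powR_mulrn ?powR_ge0// -powRrM mulVf ?pnatr_eq0 -?lt0n//.
rewrite powRr1; last by rewrite divr_ge0// ltW.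
by rewrite -(fineK (lebesgue_eball_fin N 1)) -EFinM divfK// gt_eqF.
Qed.

Lemma symm_radiusP (A : set E) : leb A < +oo ->
  (0 <= symm_radius A)%R /\ leb (symm_set A) = leb A.
Proof.
move=> Aoo; rewrite /symm_set /symm_radius.
have [|r r0 rA] := @lebesgue_eball_exists (fine (leb A)); first exact: fine_ge0.
have : [set r | (0 <= r)%R /\ leb (eball r) = leb A] r.
  by split => //; rewrite rA fineK// ge0_fin_numE.
by move=> /(@getI _ _)[].
Qed.

Lemma measurable_symm_set (A : set E) : measurable (symm_set A).
Proof. exact: measurable_eball. Qed.

Lemma symm_radius_ge0 (A : set E) : leb A < +oo -> (0 <= symm_radius A)%R.
Proof. by move=> /symm_radiusP[]. Qed.

Lemma lebesgue_symm_set (A : set E) : leb A < +oo -> leb (symm_set A) = leb A.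
Proof. by move=> /symm_radiusP[]. Qed.

Lemma subset_eball (r t : R) : (r <= t)%R -> @eball R N r `<=` eball t.
Proof. by move=> rt x; rewrite /eball /= => /lt_le_trans; exact. Qed.

Lemma le_symm_radius (A B : set E) : leb A <= leb B -> leb B < +oo ->
  (symm_radius A <= symm_radius B)%R.
Proof.
move=> AB Boo; have Aoo := le_lt_trans AB Boo.
rewrite leNgt; apply/negP => /(lebesgue_eball_lt (symm_radius_ge0 Boo)).
by rewrite -!/(symm_set _) !lebesgue_symm_set// ltNge AB.
Qed.

Lemma subset_symm_set (A B : set E) : leb A <= leb B -> leb B < +oo ->
  symm_set A `<=` symm_set B.
Proof. by move=> AB Boo; apply: subset_eball; exact: le_symm_radius. Qed.

Lemma lebesgue_small_eball (m : R) : (0 < m)%R ->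
  exists2 r : R, (0 < r)%R & leb (eball r) <= m%:E.
Proof.
move=> m0; have [r r0 rm] := lebesgue_eball_exists (ltW m0).
exists r; last by rewrite rm.
rewrite lt_neqAle r0 andbT; apply/eqP => r0'.
have : leb (eball r) = 0.
  by rewrite -r0' lebesgue_eballE// expr0n gtn_eqF// mul0e.
by rewrite rm => -[] /eqP; rewrite gt_eqF.
Qed.

Lemma lebesgue_setD_eq (A B : set E) : measurable A -> measurable B ->
  leb A = leb B -> leb A < +oo -> leb (A `\` B) = leb (B `\` A).
Proof.
move=> mA mB AB Aoo; have Boo : leb B < +oo by rewrite -AB.
by rewrite !measureD// setIC; congr (_ - _).
Qed.

(** The gain [c] does not depend on [A], which is what the greedy argument needs. If no reflection
    achieved it, [averaging] applied to [A] minus the ball and the ball minus [A], which have equal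
    measure, would be contradicted. *)
Lemma polarize_gain (r d : R) : (0 < r)%R -> (0 < d)%R ->
  exists2 c : R, (0 < c)%R & forall (A : set E) (t : R), measurable A ->
    A `<=` eball r -> leb (eball t) = leb A -> d%:E <= leb (A `\` eball t) ->
    exists z s, [/\ z != 0%R, (0 <= s)%R &
      leb (polarize z s A `\` eball t) + c%:E <= leb (A `\` eball t)].
Proof.
move=> r0 d0; have [del2 del20 hdel2] := lebesgue_small_eball (divr_gt0 d0 (ltr0Sn R 1)).
pose del := (del2 / 2)%R; have del0 : (0 < del)%R by rewrite divr_gt0.
pose k := (del ^+ 2 / 2 * (2 ^- N * (d / 2)))%R.
have k0 : (0 < k)%R by rewrite !mulr_gt0 ?invr_gt0 ?exprn_gt0.
pose Vol := leb (eball (2 * r)%R) * @lebesgue_rV R 1 (eball (r ^+ 2)%R).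
have Volfin : Vol \is a fin_num by rewrite fin_numM ?lebesgue_eball_fin.
have Vol0 : 0 < Vol by rewrite mule_gt0// lebesgue_eball_gt0 ?exprn_gt0// mulr_gt0.
have fVol0 : (0 < fine Vol)%R by rewrite fine_gt0// Vol0 ltey_eq Volfin.
(* [averaging] with [eta = c] would give [k * d <= c * Vol], whereas the factor 2 makes the right
   side [k * d / 2]. *)
pose c := (k * d / (2 * fine Vol))%R.
have c0 : (0 < c)%R by rewrite divr_gt0 ?mulr_gt0.
exists c => // A t mA Ar tA dA.
have mt := @measurable_eball R N t.
have tr : (t <= r)%R.
  rewrite leNgt; apply/negP => /ltW/(@subset_eball r t) rt.
  move: dA; rewrite (_ : _ `\` _ = set0) ?measure0 ?lee_fin ?leNgt ?d0//.
  by apply/seteqP; split => x //= [/Ar/rt].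
apply: contrapT => noz.
have hz z s : z != 0%R -> (0 <= s)%R ->
    leb ((A `\` eball t) `&` refl z s @^-1` (eball t `\` A)) <= c%:E.
  move=> z0 s0; rewrite leNgt; apply/negP => hc; apply: noz; exists z, s; split => //.
  apply: le_trans (lebesgue_polarize_excess z0 s0 t mA).
  by rewrite leeD2l// ltW.
have Aoo : leb A < +oo by rewrite -tA lebesgue_eball_lty.
have PQE : leb (A `\` eball t) = leb (eball t `\` A) by exact: lebesgue_setD_eq.
have := @averaging R N r del d (A `\` eball t) (eball t `\` A) _ _ _ _ _ r0 del0 d0 _ _ c%:E _ hz.
rewrite -/k -/Vol => h; have : (k * d)%:E <= c%:E * Vol.
  apply: le_trans (h _ _ _ _ _ _ _ _).
  - by rewrite EFinM lee_pmul2l ?lte_fin.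
  - exact: measurableD.
  - exact: measurableD.
  - by move=> x [/Ar].
  - by move=> x [/(subset_eball tr)].
  - by move=> x y [_ /negP]; rewrite -leNgt => tx [yt _]; exact: lt_le_trans yt tx.
  - by rewrite /del mulrC divfK.
  - by rewrite -PQE.
  - by rewrite lee_fin ltW.
rewrite -(fineK Volfin) -EFinM lee_fin /c.
have simp (a b : R) : b != 0%R -> (a / (2 * b) * b = a / 2)%R by move=> b0; field.
rewrite simp ?gt_eqF//.
by have := mulr_gt0 k0 d0; lra.
Qed.

(** * Riesz' inequality for bounded sets, by successive polarizations *)

Section riesz_rearrangement.
Variables (K : E -> \bar R).
Hypotheses (K_ge0 : forall x, 0 <= K x) (K_radial : radially_nonincreasing K).

Let mk A B : measurable A -> measurable B -> measurable_fun setT (riesz_kernel K A B).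
Proof. by move=> mA mB; exact: measurable_riesz_kernel. Qed.

Let mk2 A B x : measurable A -> measurable B ->
  measurable_fun setT (fun y => riesz_kernel K A B (x, y)).
Proof. by move=> mA mB; apply: measurable_fun_pair2; exact: mk. Qed.

Let mF A B : measurable A -> measurable B ->
  measurable_fun setT (fun x => \int[leb]_y riesz_kernel K A B (x, y)).
Proof.
move=> mA mB.
exact: (measurable_fun_fubini_tonelli_F _ (mk mA mB) (riesz_kernel_ge0 K_ge0 A B)).
Qed.

Let rk0 A B u : 0 <= riesz_kernel K A B u. Proof. exact: riesz_kernel_ge0. Qed.

(** With [riesz_le_bound], this provides the continuity of [riesz] in measure for a bounded kernel:
    a pair in [A] and [B] has both points in [C] and [D], or its first point outside [C], or its
    first point in [C] and its second outside [D]. *)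
Lemma riesz_le_add (A B C D : set E) : measurable A -> measurable B ->
  measurable C -> measurable D ->
  riesz K A B <= riesz K C D + (riesz K (A `\` C) B + riesz K C (B `\` D)).
Proof.
move=> mA mB mC mD; have mAC := measurableD mA mC; have mBD := measurableD mB mD.
rewrite /riesz -!ge0_integralD//; try (by move=> x _; apply: integral_ge0);
  try exact: mF; last 2 first.
- by move=> x _; rewrite adde_ge0// integral_ge0.
- by apply: emeasurable_funD; exact: mF.
apply: ge0_le_integral => //.
- by move=> x _; exact: integral_ge0.
- exact: mF.
- by do 2? (apply: emeasurable_funD; try exact: mF).
move=> x _; rewrite -!ge0_integralD//; try exact: mk2; last 2 first.
- by move=> y _; rewrite adde_ge0.
- by apply: emeasurable_funD; exact: mk2.
apply: ge0_le_integral => //.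
- exact: mk2.
- by do 2? (apply: emeasurable_funD; try exact: mk2).
move=> y _; rewrite /riesz_kernel /= !in_setD.
by case: (x \in A); case: (x \in C); case: (y \in B); case: (y \in D);
  rewrite /= ?add0e ?adde0 ?adde_ge0// ?leeDl.
Qed.

Lemma riesz_le_bound (A B : set E) (M : \bar R) : measurable A -> measurable B ->
  (forall x, K x <= M) -> riesz K A B <= M * leb B * leb A.
Proof.
move=> mA mB KM; have M0 : 0 <= M by exact: le_trans (K_ge0 0%R) (KM _).
apply: integral_le_indic => //.
- by rewrite mule_ge0.
- exact: mF.
- by move=> x; exact: integral_ge0.
- move=> x xA; apply: integral_le_indic => //.
  + exact: mk2.
  + by move=> y _; rewrite /riesz_kernel; case: ifP.
  + by move=> y yB; rewrite /riesz_kernel /= ifF//; apply/andP => -[_ /set_mem].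
- move=> x xA; apply: integral0_eq => y _; rewrite /riesz_kernel /= ifF//.
  by apply/andP => -[/set_mem].
Qed.

(** Instead of the pairs obtained by finite sequences of polarizations, this records the properties
    that a simultaneous polarization of both sets preserves. *)
Let reach r A B (W : set E * set E) :=
  [/\ measurable W.1 /\ measurable W.2, W.1 `<=` eball r /\ W.2 `<=` eball r,
      leb W.1 = leb A /\ leb W.2 = leb B & riesz K A B <= riesz K W.1 W.2].

Let excess a b (W : set E * set E) := leb (W.1 `\` eball a) + leb (W.2 `\` eball b).

(* Polarizing greedily decreases the total excess by an amount bounded below as
   long as the excess itself is bounded below. *)
Lemma riesz_approx (r a b e : R) (A B : set E) :
  measurable A -> measurable B -> A `<=` eball r -> B `<=` eball r ->
  leb (eball a) = leb A -> leb (eball b) = leb B -> (0 < e)%R ->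
  exists2 W, reach r A B W & excess a b W < e%:E.
Proof.
move=> mA mB Ar Br aA bB e0.
have [r0|r0] := leP r 0%R.
  have emp (C : set E) : C `<=` eball r -> C = set0.
    move=> Cr; apply/seteqP; split => x // /Cr; rewrite /eball /= ltNge.
    by rewrite (le_trans r0)// enorm_ge0.
  exists (A, B); first by split.
  by rewrite /excess /= (emp A)// (emp B)// !set0D !measure0 adde0 lte_fin.
have fexc W : reach r A B W -> excess a b W \is a fin_num.
  move=> [[m1 m2] _ [W1 W2] _]; rewrite fin_numD; apply/andP; split.
    rewrite ge0_fin_numE//; apply: le_lt_trans (lebesgue_eball_lty N a).
    by rewrite aA -W1; apply: le_measure; rewrite ?inE//;
      apply: measurableD => //; exact: measurable_eball.
  rewrite ge0_fin_numE//; apply: le_lt_trans (lebesgue_eball_lty N b).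
  by rewrite bB -W2; apply: le_measure; rewrite ?inE//;
    apply: measurableD => //; exact: measurable_eball.
apply: contrapT => noW.
have ge_e W : reach r A B W -> e%:E <= excess a b W.
  by move=> hW; rewrite leNgt; apply/negP => h; apply: noW; exists W.
have [c c0 hc] := polarize_gain r0 (divr_gt0 e0 (ltr0Sn R 1)).
pose S := [set fine (excess a b W) | W in reach r A B].
have S_inf : has_inf S.
  split; first by exists (fine (excess a b (A, B))), (A, B) => //; split.
  by exists 0%R => _ [W hW <-]; rewrite fine_ge0// adde_ge0.
(* The excess of [W] is within [c] of its infimum, so one more gain of [c] would lead below the
   infimum. One of the two sets of [W] has excess at least [e / 2], the threshold for which [c] was
   chosen. *)
have [_ [W hW <-] hlt] := inf_adherent c0 S_inf.
have [W' hW' hle] : exists2 W', reach r A B W' & excess a b W' + c%:E <= excess a b W.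
  have [[m1 m2] [W1r W2r] [W1 W2] Wr] := hW.
  have pW z s : z != 0%R -> (0 <= s)%R -> reach r A B (polarize z s W.1, polarize z s W.2).
    move=> z0 s0; split => /=.
    - by split; exact: measurable_polarize.
    - by split; exact: polarize_eball.
    - by rewrite !lebesgue_polarize.
    - by apply: le_trans Wr _; exact: riesz_polarize.
  have exc z s (C : set E) t : z != 0%R -> (0 <= s)%R -> measurable C ->
      leb (polarize z s C `\` eball t) <= leb (C `\` eball t).
    move=> z0 s0 mC; apply: le_trans (lebesgue_polarize_excess z0 s0 t mC).
    by rewrite leeDl.
  have [h1|h1] := leP (e / 2)%:E (leb (W.1 `\` eball a)).
    have [z [s [z0 s0 hz]]] := hc _ _ m1 W1r (etrans aA (esym W1)) h1.
    exists (polarize z s W.1, polarize z s W.2); first exact: pW.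
    by rewrite /excess /= addeAC leeD//; exact: exc.
  have h2 : (e / 2)%:E <= leb (W.2 `\` eball b).
    rewrite leNgt; apply/negP => h2; have := ge_e _ hW; rewrite leNgt /excess.
    by rewrite (splitr e) EFinD lteD.
  have [z [s [z0 s0 hz]]] := hc _ _ m2 W2r (etrans bB (esym W2)) h2.
  exists (polarize z s W.1, polarize z s W.2); first exact: pW.
  by rewrite /excess /= -addeA leeD//; exact: exc.
have : (fine (excess a b W') + c <= fine (excess a b W))%R.
  by rewrite -lee_fin EFinD !fineK// fexc.
have : (inf S <= fine (excess a b W'))%R by apply: inf_lbound; [case: S_inf|exists W'].
by move=> h1 h2; move: hlt; rewrite ltNge => /negP; apply; apply: le_trans h2; rewrite lerD2r.
Qed.

Lemma riesz_rearrangement_bounded (r M : R) (A B : set E) :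
  measurable A -> measurable B -> A `<=` eball r -> B `<=` eball r ->
  (forall x, K x <= M%:E) ->
  riesz K A B <= riesz K (symm_set A) (symm_set B).
Proof.
move=> mA mB Ar Br KM.
have Aoo : leb A < +oo.
  apply: le_lt_trans (lebesgue_eball_lty N r); apply: le_measure; rewrite ?inE//.
  exact: measurable_eball.
have Boo : leb B < +oo.
  apply: le_lt_trans (lebesgue_eball_lty N r); apply: le_measure; rewrite ?inE//.
  exact: measurable_eball.
have M0 : (0 <= M)%R by have := le_trans (K_ge0 0%R) (KM _); rewrite lee_fin.
have mAs := measurable_symm_set A; have mBs := measurable_symm_set B.
apply/lee_addgt0Pr => e e0.
(* The error terms sum to at most [L] times the excess; the summand 1 keeps [L] positive when [M] or
   both measures vanish. *)
pose L := (M * (fine (leb A) + fine (leb B)) + 1)%R.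
have L0 : (0 < L)%R by rewrite ltr_wpDl// mulr_ge0// addr_ge0// fine_ge0.
have [W [[m1 m2] _ [W1 W2] rW] exW] := riesz_approx mA mB Ar Br
  (lebesgue_symm_set Aoo) (lebesgue_symm_set Boo) (divr_gt0 e0 L0).
apply: le_trans rW _.
apply: le_trans (riesz_le_add m1 m2 mAs mBs) _.
rewrite leeD2l//.
have mD1 : measurable (W.1 `\` symm_set A) by exact: measurableD.
have mD2 : measurable (W.2 `\` symm_set B) by exact: measurableD.
apply: le_trans (leeD (riesz_le_bound mD1 m2 KM) (riesz_le_bound mAs mD2 KM)) _.
have fA : leb A \is a fin_num by rewrite ge0_fin_numE.
have fB : leb B \is a fin_num by rewrite ge0_fin_numE.
have f1 : leb (W.1 `\` symm_set A) \is a fin_num.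
  by rewrite ge0_fin_numE//; apply: lt_trans (ltry (e / L)); apply: le_lt_trans exW; rewrite leeDl.
have f2 : leb (W.2 `\` symm_set B) \is a fin_num.
  by rewrite ge0_fin_numE//; apply: lt_trans (ltry (e / L)); apply: le_lt_trans exW; rewrite leeDr.
rewrite lebesgue_symm_set// W2; move: exW; rewrite /excess.
rewrite -(fineK fA) -(fineK fB) -(fineK f1) -(fineK f2) -!EFinM -!EFinD lte_fin lee_fin.
have fine0 C : (0 <= fine (leb C))%R by exact: fine_ge0.
rewrite /L; move: (fine0 A) (fine0 B) (fine0 (W.1 `\` symm_set A)) (fine0 (W.2 `\` symm_set B)).
move: (fine (leb A)) (fine (leb B)) (fine (leb (W.1 `\` _))) (fine (leb (W.2 `\` _))).
move=> a b d1 d2 a0 b0 d10 d20; rewrite ltr_pdivlMr; last first.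
  by rewrite ltr_wpDl// mulr_ge0// addr_ge0.
move=> h; apply: le_trans (ltW h).
have [h1 h2 h3 h4] : [/\ 0 <= M * a * d1, 0 <= M * b * d2, 0 <= d1 & 0 <= d2]%R.
  by split => //; rewrite !mulr_ge0.
rewrite (_ : (d1 + d2) * _ = M * a * d1 + M * b * d1 + M * a * d2 + M * b * d2 + d1 + d2)%R;
  last by ring.
rewrite (mulrAC M d2 a); lra.
Qed.

End riesz_rearrangement.

Section riesz_rearrangement_general.
Variables (K : E -> \bar R).
Hypotheses (K_ge0 : forall x, 0 <= K x) (K_radial : radially_nonincreasing K).

Let Kn n x : \bar R := mine (K x) n%:R%:E.

Let Kn_ge0 n x : 0 <= Kn n x.
Proof. by rewrite /Kn le_min K_ge0 lee_fin ler0n. Qed.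

Let Kn_radial n : radially_nonincreasing (Kn n).
Proof.
apply: radialP => x y xy; rewrite /Kn le_min !ge_min lexx orbT andbT.
by rewrite (radial_le K_radial xy).
Qed.

Let Kn_nd x : nondecreasing_seq (Kn ^~ x).
Proof.
move=> m n mn; rewrite /Kn le_min !ge_min lexx /= lee_fin ler_nat mn orbT//.
Qed.

Let Kn_cvg x : Kn ^~ x @ \oo --> K x.
Proof.
rewrite (_ : K x = ereal_sup (range (Kn ^~ x))).
  exact: ereal_nondecreasing_cvgn.
apply/eqP; rewrite eq_le; apply/andP; split; last first.
  by apply: ge_ereal_sup => _ [n _ <-]; rewrite /Kn ge_min lexx.
have := K_ge0 x; case Kx : (K x) => [k| |] //= k0.
  apply: ereal_sup_ubound; exists (Num.truncn k).+1 => //; rewrite /Kn Kx.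
  by apply/min_idPl; rewrite lee_fin ltW// truncnS_gt.
rewrite leye_eq; apply/eqP/eq_infty => t.
apply: (@le_trans _ _ (Kn (Num.truncn t).+1 x)); last by apply: ereal_sup_ubound; eexists.
by rewrite /Kn Kx minye lee_fin ltW// truncnS_gt.
Qed.

(** The kernel may be unbounded, even infinite at the origin. Its truncations [Kn] stay radially
    non-increasing; the left side is the limit of its truncated versions by monotone convergence,
    and on the right each [Kn] lies below [K]. *)
Theorem riesz_rearrangement (r : R) (A B : set E) :
  measurable A -> measurable B -> A `<=` eball r -> B `<=` eball r ->
  riesz K A B <= riesz K (symm_set A) (symm_set B).
Proof.
move=> mA mB Ar Br; have mAs := measurable_symm_set A; have mBs := measurable_symm_set B.
have mk n : measurable_fun setT (riesz_kernel (Kn n) A B) by exact: measurable_riesz_kernel.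
have cvgk z : riesz_kernel (Kn n) A B z @[n --> \oo] --> riesz_kernel K A B z.
  by rewrite /riesz_kernel; case: ifP => _; [exact: Kn_cvg|exact: cvg_cst].
have ndk z : nondecreasing_seq (fun n => riesz_kernel (Kn n) A B z).
  by move=> m n mn; rewrite /riesz_kernel; case: ifP => // _; exact: Kn_nd.
have mk2 n x : measurable_fun setT (fun y => riesz_kernel (Kn n) A B (x, y)).
  by apply: measurable_fun_pair2; exact: mk.
have rk0 n z : 0 <= riesz_kernel (Kn n) A B z by exact: riesz_kernel_ge0.
have lim1 : riesz K A B = limn (fun n => riesz (Kn n) A B).
  rewrite /riesz -monotone_convergence//; last 3 first.
  - by move=> n; exact: (measurable_fun_fubini_tonelli_F _ (mk n) (rk0 n)).
  - by move=> n x _; exact: integral_ge0.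
  - move=> x _ m n mn; apply: ge0_le_integral => //.
    by move=> y _; exact: ndk.
  apply: eq_integral => x _; rewrite -monotone_convergence//.
  by apply: eq_integral => y _; apply/esym/cvg_lim => //; exact: cvgk.
rewrite lim1; apply: lime_le.
  apply: ereal_nondecreasing_is_cvgn => m n mn; apply: ge0_le_integral => //.
  - by move=> x _; exact: integral_ge0.
  - exact: (measurable_fun_fubini_tonelli_F _ (mk m) (rk0 m)).
  - exact: (measurable_fun_fubini_tonelli_F _ (mk n) (rk0 n)).
  - move=> x _; apply: ge0_le_integral => //.
    by move=> y _; exact: ndk.
apply: nearW => n.
apply: le_trans (riesz_rearrangement_bounded (Kn_ge0 n) (Kn_radial n) mA mB Ar Br (M := n%:R) _) _.
  by move=> x; rewrite /Kn ge_min lexx orbT.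
have mkn : measurable_fun setT (riesz_kernel (Kn n) (symm_set A) (symm_set B)).
  exact: measurable_riesz_kernel.
have mkK : measurable_fun setT (riesz_kernel K (symm_set A) (symm_set B)).
  exact: measurable_riesz_kernel.
have rn0 z : 0 <= riesz_kernel (Kn n) (symm_set A) (symm_set B) z by exact: riesz_kernel_ge0.
have rK0 z : 0 <= riesz_kernel K (symm_set A) (symm_set B) z by exact: riesz_kernel_ge0.
apply: ge0_le_integral => //.
- by move=> x _; exact: integral_ge0.
- exact: (measurable_fun_fubini_tonelli_F _ mkn rn0).
- exact: (measurable_fun_fubini_tonelli_F _ mkK rK0).
- move=> x _; apply: ge0_le_integral => //.
  + by apply: measurable_fun_pair2; exact: mkn.
  + by apply: measurable_fun_pair2; exact: mkK.
  + by move=> y _; rewrite /riesz_kernel; case: ifP => // _; rewrite /Kn ge_min lexx.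
Qed.

End riesz_rearrangement_general.

End symmetrization.

Lemma lebesgue_rV_subl (R : realType) N (a : 'rV[R]_N) (A : set 'rV[R]_N) :
  measurable A -> lebesgue_rV ((fun y => a - y) @^-1` A) = lebesgue_rV A.
Proof.
move=> mA; rewrite (_ : (fun y => a - y) = (fun y => a + (-1) *: y)).
  by rewrite lebesgue_rV_affine ?oppr_eq0 ?oner_eq0// normrN1 expr1n invr1 mul1e.
by apply/funext => y; rewrite scaleN1r.
Qed.

(** * Convolution, level sets and comparison of tails *)

Section convolution.
Context (R : realType) (N : nat).
Local Notation E := 'rV[R]_N.
Local Notation leb := (@lebesgue_rV R N).
Local Open Scope ereal_scope.

Definition ind (A : set E) (x : E) : \bar R := (\1_A x)%:E.

Lemma ind_ge0 A x : 0 <= ind A x. Proof. by rewrite lee_fin. Qed.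

Lemma measurable_ind A : measurable A -> measurable_fun setT (ind A).
Proof. by move=> mA; apply/measurable_EFinP; exact: measurable_indic. Qed.

Lemma mule_ind (c : \bar R) A x : c * ind A x = if x \in A then c else 0.
Proof. by rewrite /ind indicE; case: (x \in A); rewrite ?mule1 ?mule0. Qed.

Lemma integral_ind A : measurable A -> \int[leb]_x ind A x = leb A.
Proof. by move=> mA; rewrite integral_indic// setIT. Qed.

Definition conv (K f : E -> \bar R) (x : E) : \bar R :=
  \int[leb]_y (K (x - y)%R * f y).

Variables (K : E -> \bar R).
Hypotheses (K_ge0 : forall x, 0 <= K x) (K_radial : radially_nonincreasing K).

Let mK2 (f g : E -> \bar R) : measurable_fun setT f -> measurable_fun setT g ->
  measurable_fun setT (fun z : E * E => K (z.1 - z.2)%R * f z.2 * g z.1).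
Proof.
move=> mf mg; apply: emeasurable_funM; last exact: measurableT_comp.
apply: emeasurable_funM; last exact: measurableT_comp.
by apply: (measurableT_comp (measurable_radial K_radial)); exact: measurable_subrV.
Qed.

Let mK1 (f : E -> \bar R) : measurable_fun setT f ->
  measurable_fun setT (fun z : E * E => K (z.1 - z.2)%R * f z.2).
Proof.
move=> mf; apply: emeasurable_funM; last exact: measurableT_comp.
by apply: (measurableT_comp (measurable_radial K_radial)); exact: measurable_subrV.
Qed.

Lemma measurable_convK (x : E) (f : E -> \bar R) : measurable_fun setT f ->
  measurable_fun setT (fun y : E => K (x - y)%R * f y).
Proof. by move=> mf; exact: (measurable_fun_pair2 x (mK1 mf)). Qed.

Lemma conv_ge0 f x : (forall y, 0 <= f y) -> 0 <= conv K f x.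
Proof. by move=> f0; apply: integral_ge0 => y _; rewrite mule_ge0. Qed.

Lemma measurable_conv f : measurable_fun setT f -> (forall y, 0 <= f y) ->
  measurable_fun setT (conv K f).
Proof.
move=> mf f0; apply: (measurable_fun_fubini_tonelli_F _ (mK1 mf)) => z.
by rewrite mule_ge0.
Qed.

Lemma le_conv f g x : measurable_fun setT f -> measurable_fun setT g ->
  (forall y, 0 <= f y) -> (forall y, f y <= g y) -> conv K f x <= conv K g x.
Proof.
move=> mf mg f0 fg; apply: ge0_le_integral => //.
- by move=> y _; rewrite mule_ge0.
- exact: measurable_convK.
- exact: measurable_convK.
- by move=> y _; rewrite lee_wpmul2l.
Qed.

Lemma KN (x y : E) : K (x - y)%R = K (y - x)%R.
Proof. by apply: radial_eq => //; rewrite -enormN opprB. Qed.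

Lemma conv_sym f g : measurable_fun setT f -> measurable_fun setT g ->
  (forall y, 0 <= f y) -> (forall y, 0 <= g y) ->
  \int[leb]_x (conv K f x * g x) = \int[leb]_x (f x * conv K g x).
Proof.
move=> mf mg f0 g0.
transitivity (\int[leb]_x \int[leb]_y (K ((x : E) - (y : E))%R * f y * g x)).
  apply: eq_integral => x _; rewrite muleC -ge0_integralZl//.
  - by apply: eq_integral => y _; rewrite muleC.
  - exact: measurable_convK.
  - by move=> y _; rewrite mule_ge0.
rewrite (fubini_tonelli _ (mK2 mf mg)); last by move=> z; rewrite !mule_ge0.
apply: eq_integral => y _; rewrite -ge0_integralZl//.
- by apply: eq_integral => x _ /=; rewrite KN (muleC _ (f y)) muleA.
- exact: measurable_convK.
- by move=> x _; rewrite mule_ge0.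
Qed.

Lemma riesz_conv A B : measurable A -> measurable B ->
  riesz K A B = \int[leb]_x (conv K (ind B) x * ind A x).
Proof.
move=> mA mB; apply: eq_integral => x _; rewrite muleC -ge0_integralZl//; last 3 first.
- by apply: measurable_convK; exact: measurable_ind.
- by move=> y _; rewrite mule_ge0// ind_ge0.
- exact: ind_ge0.
apply: eq_integral => y _; rewrite /riesz_kernel /= /ind !indicE.
by case: (x \in A); case: (y \in B); rewrite /= ?mule0 ?mul0e ?mule1 ?mul1e.
Qed.

Lemma conv1 (x : E) : conv K (cst 1) x = \int[leb]_y K y.
Proof.
have mr : measurable_fun setT (fun y : E => x - y)%R by apply: measurable_subrV.
transitivity (\int[leb]_y K (x - (y : E))%R); first by apply: eq_integral => y _; rewrite mule1.
apply: (ge0_integral_preserving mr) => //; last exact: measurable_radial.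
by move=> A; exact: lebesgue_rV_subl.
Qed.

Lemma integral_conv f : measurable_fun setT f -> (forall y, 0 <= f y) ->
  \int[leb]_x conv K f x = (\int[leb]_y K y) * \int[leb]_y f y.
Proof.
move=> mf f0; have := @conv_sym f (cst 1) mf (measurable_cst _) f0 (fun=> lee01).
under eq_integral do rewrite mule1; move=> ->.
have k0 : 0 <= \int[leb]_y K y by exact: integral_ge0.
transitivity (\int[leb]_x ((\int[leb]_y K y) * f x)); last by rewrite ge0_integralZl.
by apply: eq_integral => x _; rewrite conv1 muleC.
Qed.

End convolution.

Section radial_convolution.
Context (R : realType) (N : nat).
Local Notation E := 'rV[R]_N.
Local Open Scope ereal_scope.

(** For finite numbers the difference of the two sides is [(j - j') * (b - b')]. An infinite [j']
    cannot be subtracted, but then [j = j']. *)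
Lemma rearrangement_2terms (j j' b b' : \bar R) : 0 <= j' -> j' <= j ->
  0 <= b' -> b' <= b -> j' * b + j * b' <= j * b + j' * b'.
Proof.
move=> j0 jj b0 bb; have [j'oo|j'fin] := eqVneq j' +oo.
  have -> : j = j' by apply/eqP; rewrite eq_le jj andbT j'oo leey.
  by [].
have jf : j' \is a fin_num by rewrite ge0_fin_numE// lt_neqAle j'fin leey.
have -> : j = (j - j') + j' by rewrite subeK.
have a0 : 0 <= j - j' by rewrite sube_ge0// jf ?orbT.
have bp : 0 <= b by exact: le_trans bb.
move: (j - j') a0 => a a0.
rewrite (ge0_muleDl b a0 j0) (ge0_muleDl b' a0 j0) addeA leeD2r// addeC leeD2r//.
exact: lee_wpmul2l.
Qed.

(** The reflection across the bisector of [x] and [x'] exchanges the two points. Summed over a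
    mirror pair of integration points, the comparison becomes a two-term rearrangement: the near
    point has the larger value of [f] and, seen from [x'], the larger kernel. *)
Lemma radial_conv (K f : E -> \bar R) : (forall x, 0 <= K x) -> (forall x, 0 <= f x) ->
  radially_nonincreasing K -> radially_nonincreasing f ->
  radially_nonincreasing (conv K f).
Proof.
move=> K0 f0 Kr fr; apply: radialP => x x' xx'.
have mf := measurable_radial fr.
have [->|xneq] := eqVneq x x'; first by [].
(* Normal and level of the perpendicular bisector; [s >= 0] expresses that [x'] is no farther from
   the origin than [x]. *)
pose z := (x - x')%R; pose s := ((dot x x - dot x' x') / 2)%R.
have z0 : z != 0%R by rewrite subr_eq0.
have s0 : (0 <= s)%R by rewrite divr_ge0// subr_ge0 -ler_enorm.
have xz : (dot x z - s = dot z z / 2)%R.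
  by rewrite /s /z !(dotBl, dotBr) (dotC x' x); field.
have sx : refl z s x = x'.
  rewrite /refl xz (_ : 2 * (dot z z / 2) / dot z z = 1)%R ?scale1r ?/z ?subKr//.
  by field; rewrite dot_eq0.
have sx' : refl z s x' = x by rewrite -sx reflK.
have x's : (dot x' z - s <= 0)%R.
  by rewrite -sx dot_refl// xz oppr_le0 divr_ge0// dot_ge0.
have K1 y : K (x - y)%R = K (x' - refl z s y)%R.
  by rewrite -{1}sx'; apply: radial_eq => //; exact: enorm_reflC.
have K2 y : K (x - refl z s y)%R = K (x' - y)%R by rewrite K1 reflK.
apply: (@le_integral_sym _ _ _ _ (refl z s)).
- exact: measurable_refl.
- by move=> A; exact: lebesgue_refl.
- exact: measurable_convK.
- exact: measurable_convK.
- by move=> y; rewrite mule_ge0.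
- by move=> y; rewrite mule_ge0.
have side y : (dot y z <= s)%R ->
    K (x' - refl z s y)%R * f y + K (x' - y)%R * f (refl z s y) <=
    K (x' - y)%R * f y + K (x' - refl z s y)%R * f (refl z s y).
  move=> ys; apply: rearrangement_2terms => //; apply: radial_le => //.
    by apply: refl_same_side; rewrite -mulrNN mulr_ge0// oppr_ge0// subr_le0.
  exact: enorm_refl_ge.
move=> y; rewrite K1 K2; case: (leP (dot y z) s) => [/side//|ys].
have := side (refl z s y) (dot_refl_le z0 ys); rewrite reflK.
by rewrite addeC [X in _ <= X -> _]addeC.
Qed.

End radial_convolution.

(** * Layer-cake formulas *)

Section layer_cake.
Context (R : realType) (N : nat).
Local Notation E := 'rV[R]_N.
Local Notation leb := (@lebesgue_rV R N).
Local Notation mu := (@lebesgue_measure R).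
Local Open Scope ereal_scope.

Lemma measurable_superlevel (f : E -> \bar R) (t : \bar R) :
  measurable_fun setT f -> measurable [set y | t < f y].
Proof.
move=> mf; rewrite (_ : [set _ | _] = [set: E] `&` [set y | t < f y]).
  exact: emeasurable_fun_o_infty.
by rewrite setTI.
Qed.

Lemma lebesgue_between (t : R) (x : \bar R) :
  mu [set s : R | (t < s)%R /\ s%:E < x] = maxe (x - t%:E) 0.
Proof.
case: x => [r| |].
- rewrite (_ : [set _ | _] = `]t, r[%classic).
    rewrite lebesgue_measure_itv /= lte_fin -EFinB maxEle lee_fin subr_le0 leNgt.
    by case: ifP => // _; rewrite if_neg.
  by apply/seteqP; split => s /=; rewrite in_itv /= lte_fin; [case=> -> ->|case/andP].
- rewrite (_ : [set _ | _] = `]t, +oo[%classic).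
    by rewrite lebesgue_measure_itv /= ltry addye// max_l// leey.
  by apply/seteqP; split => s /=; rewrite in_itv /= andbT ltry; [case|].
- rewrite (_ : [set _ | _] = set0); first by rewrite measure0 addNye max_r.
  by apply/seteqP; split => s //= [_]; rewrite ltNge leNye.
Qed.

Let measurable_layer (t : R) (f : E -> \bar R) : measurable_fun setT f ->
  measurable [set z : measurableTypeR R * E | (t < z.1)%R /\ z.1%:E < f z.2].
Proof.
move=> mf; apply: measurable_set_and.
  exact: (@measurable_set_lt _ _ _ (cst t) fst).
apply: measurable_boolP; apply: measurable_fun_lte; last exact: measurableT_comp.
by apply/measurable_EFinP.
Qed.

(** Tonelli on the region above height [t] and below the graph of [f]. The weight [psi] lets one
    formula serve both the integral of a product ([layer_cake0]) and that of a tail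
    ([layer_cake_measure]). *)
Lemma layer_cake (t : R) (f psi : E -> \bar R) : measurable_fun setT f ->
  measurable_fun setT psi -> (forall y, 0 <= psi y) ->
  \int[mu]_(s in `]t, +oo[) \int[leb]_y (psi y * ind [set y | s%:E < f y] y) =
  \int[leb]_y (psi y * maxe (f y - t%:E) 0).
Proof.
move=> mf mpsi psi0; have mS := measurable_layer t mf; set S := [set z | _] in mS.
pose g (z : measurableTypeR R * E) := psi z.2 * (\1_S z)%:E.
have mg : measurable_fun setT g.
  apply: emeasurable_funM; first exact: measurableT_comp.
  by apply/measurable_EFinP; exact: measurable_indic.
have g0 z : 0 <= g z by rewrite mule_ge0// lee_fin.
rewrite integral_mkcond; transitivity (\int[mu]_s \int[leb]_y g (s, y)).
  apply: eq_integral => s _; rewrite patchE; case: ifPn => [|sN].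
    rewrite inE /= in_itv /= andbT => ts; apply: eq_integral => y _.
    rewrite /g /=; congr (_ * _); rewrite /ind !indicE;
      case: (boolP ((s, y) \in S)) => [/set_mem[_ /= h]|hS].
      by rewrite mem_set.
    rewrite (_ : (y \in _) = false)//; apply/negP => /set_mem /= h.
    by move/negP: hS; apply; apply/mem_set.
  rewrite [LHS](_ : _ = 0)//; apply/esym/integral0_eq => y _; rewrite /g indicE.
  rewrite (_ : (s, y) \in S = false) ?mule0//; apply/negP => /set_mem[/= ts _].
  by move/negP: sN; apply; rewrite inE /= in_itv /= ts.
rewrite (fubini_tonelli _ mg g0); apply: eq_integral => y _.
rewrite -lebesgue_between -integral_mul_indic//.
have := measurable_preimageT (@pair2_measurable _ _ _ _ y) mS.
by apply.
Qed.

Lemma layer_cake0 (f psi : E -> \bar R) : measurable_fun setT f ->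
  measurable_fun setT psi -> (forall y, 0 <= psi y) -> (forall y, 0 <= f y) ->
  \int[mu]_(s in `]0%R, +oo[) \int[leb]_y (psi y * ind [set y | s%:E < f y] y) =
  \int[leb]_y (psi y * f y).
Proof.
move=> mf mpsi psi0 f0; rewrite layer_cake//; apply: eq_integral => y _.
by rewrite sube0 max_l.
Qed.

Lemma layer_cake_measure (t : R) (f : E -> \bar R) : measurable_fun setT f ->
  \int[mu]_(s in `]t, +oo[) leb [set y | s%:E < f y] =
  \int[leb]_y maxe (f y - t%:E) 0.
Proof.
move=> mf; transitivity (\int[leb]_y (1 * maxe (f y - t%:E) 0)).
  rewrite -(layer_cake t mf (psi := cst 1))//.
  apply: eq_integral => s _; under eq_integral do rewrite mul1e.
  by rewrite integral_ind//; exact: measurable_superlevel.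
by apply: eq_integral => y _; rewrite mul1e.
Qed.

Lemma measurable_superlevel_integral (f psi : E -> \bar R) : measurable_fun setT f ->
  measurable_fun setT psi -> (forall y, 0 <= psi y) ->
  measurable_fun setT (fun s : measurableTypeR R =>
    \int[leb]_y (psi y * ind [set y | s%:E < f y] y)).
Proof.
move=> mf mpsi psi0.
have mS : measurable [set z : measurableTypeR R * E | z.1%:E < f z.2].
  apply: measurable_boolP; apply: measurable_fun_lte; last exact: measurableT_comp.
  by apply/measurable_EFinP.
set S := [set z | _] in mS.
pose g (z : measurableTypeR R * E) := psi z.2 * (\1_S z)%:E.
have mg : measurable_fun setT g.
  apply: emeasurable_funM; first exact: measurableT_comp.
  by apply/measurable_EFinP; exact: measurable_indic.
have g0 z : 0 <= g z by rewrite mule_ge0// lee_fin.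
exact: (measurable_fun_fubini_tonelli_F _ mg g0).
Qed.

End layer_cake.

(** * Domination through tails and through masses on sets *)

Section concentration.
Context (R : realType) (N : nat).
Local Notation E := 'rV[R]_N.
Local Notation leb := (@lebesgue_rV R N).
Local Notation mu := (@lebesgue_measure R).
Local Open Scope ereal_scope.
Hypothesis N_gt0 : (0 < N)%N.
Implicit Types f g u v : E -> \bar R.

Definition tail (t : R) f (x : E) : \bar R := maxe (f x - t%:E) 0.

Lemma tail_ge0 t f x : 0 <= tail t f x.
Proof. by rewrite /tail le_max lexx orbT. Qed.

Lemma measurable_tail t f : measurable_fun setT f -> measurable_fun setT (tail t f).
Proof. by move=> mf; apply: measurable_maxe => //; exact: emeasurable_funB. Qed.

Lemma tail_gt t f x : t%:E <= f x -> f x = tail t f x + t%:E.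
Proof. by move=> tf; rewrite /tail max_l ?subeK// sube_ge0. Qed.

Lemma tail_le t f x : f x <= t%:E -> tail t f x = 0.
Proof. by move=> ft; rewrite /tail max_r// sube_le0. Qed.

Lemma le_tailD t f x : f x <= tail t f x + t%:E.
Proof. by case: (leP t%:E (f x)) => [/tail_gt {1}->//|/ltW h]; rewrite tail_le// add0e. Qed.

Definition mass_le f g := forall A : set E, measurable A -> leb A < +oo ->
  \int[leb]_x (f x * ind A x) <= \int[leb]_x (g x * ind (symm_set A) x).

Definition tail_integral_le f g := forall t, (0 <= t)%R ->
  \int[leb]_x tail t f x <= \int[leb]_x tail t g x.

(** The level set [A] of [f] above [t] realizes the tail: its integral is the mass of [f] on [A]
    less [t%:E * leb A], while for [g] on the ball of the same measure the analogous difference is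
    at most the tail. The finite quantity [t%:E * leb A] is added to both sides rather than
    subtracted. *)
Lemma tail_integral_le_of_mass_le f g : measurable_fun setT f -> measurable_fun setT g ->
  (forall x, 0 <= f x) -> (forall x, 0 <= g x) -> leb [set x | 0 < f x] < +oo ->
  mass_le f g -> tail_integral_le f g.
Proof.
move=> mf mg f0 g0 ffin fg t t0; pose A := [set x | t%:E < f x].
have mA : measurable A by exact: measurable_superlevel.
have Aoo : leb A < +oo.
  apply: le_lt_trans ffin; apply: le_measure; rewrite ?inE//.
    exact: measurable_superlevel.
  by move=> x; apply: le_lt_trans; rewrite lee_fin.
have mAs := @measurable_symm_set R N A.
have t0' : 0 <= t%:E by rewrite lee_fin.
have tindE (B : set E) : measurable B -> \int[leb]_x (t%:E * ind B x) = t%:E * leb B.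
  by move=> mB; rewrite integral_mul_indic.
have mti (B : set E) : measurable B -> measurable_fun setT (fun x => t%:E * ind B x).
  by move=> mB; apply: measurable_funeM; exact: measurable_ind.
have tA : t%:E * leb A \is a fin_num by rewrite fin_numM// ge0_fin_numE.
rewrite -(leeD2rE _ _ tA) -{1}tindE// -ge0_integralD//; last 4 first.
- by move=> x _; exact: tail_ge0.
- exact: measurable_tail.
- by move=> x _; rewrite mule_ge0// ind_ge0.
- exact: mti.
have -> : \int[leb]_x (tail t f x + t%:E * ind A x) = \int[leb]_x (f x * ind A x).
  apply: eq_integral => x _; rewrite !mule_ind; case: ifPn => [/set_mem /= /ltW|xA].
    by move=> /tail_gt <-.
  rewrite adde0 tail_le// leNgt; apply: contra xA => h; exact/mem_set.
apply: le_trans (fg A mA Aoo) _.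
rewrite -(lebesgue_symm_set N_gt0 Aoo) -tindE// -ge0_integralD//; last 4 first.
- by move=> x _; exact: tail_ge0.
- exact: measurable_tail.
- by move=> x _; rewrite mule_ge0// ind_ge0.
- exact: mti.
apply: ge0_le_integral => //.
- by move=> x _; rewrite mule_ge0// ind_ge0.
- by apply: emeasurable_funM => //; exact: measurable_ind.
- by apply: emeasurable_funD; [exact: measurable_tail|exact: mti].
move=> x _; rewrite !mule_ind; case: ifP => _; first exact: le_tailD.
by rewrite adde0 tail_ge0.
Qed.

(* The level [T] of [u] at the boundary of the ball [D] realizes the supremum
   in the dual description of the mass of [u] in [D]. *)
Lemma layer_min_le v u (D : set E) : measurable_fun setT v ->
  (forall x, 0 <= v x) -> (forall x, 0 <= u x) -> radially_nonincreasing u ->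
  \int[leb]_x u x < +oo ->
  (forall x y, (enorm y <= enorm x)%R -> D x -> D y) ->
  tail_integral_le v u ->
  \int[mu]_(s in `]0%R, +oo[) mine (leb [set x | s%:E < v x]) (leb D) <=
  \int[leb]_x (u x * ind D x).
Proof.
move=> mv v0 u0 ur uoo hD vu.
have mu_u := measurable_radial ur.
have mD := measurable_radial_downset hD.
have [D0|Dpos] := eqVneq (leb D) 0.
  rewrite integral0_eq => [|s _]; last by rewrite D0 min_r.
  by apply: integral_ge0 => x _; rewrite mule_ge0// ind_ge0.
have D_gt0 : 0 < leb D by rewrite lt0e Dpos measure_ge0.
(* [T] bounds [u] from above off [D] and from below on [D]; the value 0 covers the case where [D] is
   the whole space. It is finite because [u] is integrable and [D] has positive measure. *)
pose T := ereal_sup ([set 0] `|` u @` (~` D)).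
have T0 : 0 <= T by apply: ereal_sup_ubound; left.
have uT x : ~ D x -> u x <= T by move=> Dx; apply: ereal_sup_ubound; right; exists x.
have Tu x : D x -> T <= u x.
  move=> Dx; apply: ge_ereal_sup => _ [->//|[y Dy <-]].
  apply: radial_le => //; rewrite leNgt; apply/negP => /ltW yx; exact: Dy (hD _ _ yx Dx).
have Tfin : T \is a fin_num.
  rewrite ge0_fin_numE// ltNge leye_eq; apply/negP => /eqP Too.
  have : +oo * leb D <= \int[leb]_x u x.
    by apply: integral_ge_indic => // x /Tu; rewrite Too.
  by rewrite gt0_mulye// leNgt uoo.
have [t tE t0] : exists2 t, T = t%:E & (0 <= t)%R.
  by exists (fine T); [rewrite fineK|exact: fine_ge0].
rewrite {}tE in uT Tu.
have mtail f : measurable_fun setT f -> measurable_fun setT (tail t f) by exact: measurable_tail.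
have t0' : 0 <= t%:E by rewrite lee_fin.
have -> : \int[leb]_x (u x * ind D x) = \int[leb]_x tail t u x + t%:E * leb D.
  rewrite -(integral_mul_indic _ mD t0') -ge0_integralD//; last 4 first.
  - by move=> x _; exact: tail_ge0.
  - exact: mtail.
  - by move=> x _; rewrite mule_ge0// lee_fin.
  - by apply: measurable_funeM; exact: measurable_ind.
  apply: eq_integral => x _; rewrite -/(ind D x) !mule_ind; case: ifPn => [/set_mem|xD].
    by move=> /Tu/tail_gt.
  by rewrite adde0 tail_le//; apply: uT => /mem_set; rewrite (negbTE xD).
apply: (@le_trans _ _ (\int[leb]_x tail t v x + t%:E * leb D)); last by rewrite leeD2r// vu.
rewrite -layer_cake_measure// addeC.
have mlev (f : E -> \bar R) : measurable_fun setT f ->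
    measurable_fun setT (fun s : measurableTypeR R => leb [set x | s%:E < f x]).
  move=> mf; rewrite (_ : (fun s : measurableTypeR R => _) =
    (fun s : measurableTypeR R => \int[leb]_y (cst 1 y * ind [set y | s%:E < f y] y))).
    exact: measurable_superlevel_integral.
  apply/funext => s; rewrite -integral_ind; last exact: measurable_superlevel.
  by apply: eq_integral => x _; rewrite mul1e.
(* The height [t] splits the range of [s]: the minimum is bounded by [leb D] up to [t], and by the
   measure of the level set of [v] beyond it. *)
have -> : t%:E * leb D = \int[mu]_(s in `]0%R, t]) leb D.
  have mt : mu `]0%R, t]%classic = t%:E.
    rewrite lebesgue_measure_itv /= lte_fin.
    by case: ltgtP t0 => // [_|<-] _; rewrite ?sube0.
  by rewrite -{1}mt muleC -integral_cst//; exact: measurable_itv.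
rewrite [X in X <= _]integral_mkcond [X in _ <= X + _]integral_mkcond.
rewrite [X in _ <= _ + X]integral_mkcond.
have mc (I : interval R) (f : measurableTypeR R -> \bar R) : measurable_fun setT f ->
    measurable_fun setT (f \_ [set` I]).
  move=> mf; apply/(measurable_restrictT _ _).1 => //; exact: measurable_funTS.
have rge (I : interval R) (f : measurableTypeR R -> \bar R) s : (forall s, 0 <= f s) ->
    0 <= (f \_ [set` I]) s by move=> f0; rewrite patchE; case: ifP.
rewrite -ge0_integralD//; last 4 first.
- by move=> s _; apply: rge.
- by apply: mc.
- by move=> s _; apply: rge.
- by apply: mc; exact: mlev.
apply: ge0_le_integral => //.
- by move=> s _; apply: rge => s'; rewrite le_min !measure_ge0.
- apply: mc; apply: measurable_mine => //; exact: mlev.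
- by apply: emeasurable_funD; apply: mc => //; exact: mlev.
move=> s _; rewrite !patchE !mem_setE !in_itv /= !andbT.
case: (ltP 0%R s) => s0 /=; last by rewrite adde_ge0//; case: ifP.
case: (leP s t) => st; first by rewrite adde0 ge_min lexx orbT.
by rewrite add0e ge_min lexx.
Qed.

End concentration.

(** * Comparison of convolutions *)

Section conv_comparison.
Context (R : realType) (N : nat).
Local Notation E := 'rV[R]_N.
Local Notation leb := (@lebesgue_rV R N).
Local Notation mu := (@lebesgue_measure R).
Local Open Scope ereal_scope.
Hypothesis N_gt0 : (0 < N)%N.
Implicit Types (f g u v : E -> \bar R) (A : set E).

Lemma tonelli_domain d1 d2 (T1 : measurableType d1) (T2 : measurableType d2)
    (m1 : {sigma_finite_measure set T1 -> \bar R})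
    (m2 : {sigma_finite_measure set T2 -> \bar R}) (D1 : set T1) (D2 : set T2)
    (h : T1 * T2 -> \bar R) : measurable D1 -> measurable D2 ->
  measurable_fun setT h -> (forall z, 0 <= h z) ->
  \int[m1]_(x in D1) \int[m2]_(y in D2) h (x, y) =
  \int[m2]_(y in D2) \int[m1]_(x in D1) h (x, y).
Proof.
move=> mD1 mD2 mh h0.
pose g (z : T1 * T2) := if (z.1 \in D1) && (z.2 \in D2) then h z else 0.
have mg : measurable_fun setT g.
  by apply: measurable_fun_ifT => //; apply: measurable_and; exact: measurable_mem.
have g0 z : 0 <= g z by rewrite /g; case: ifP.
transitivity (\int[m1]_x \int[m2]_y g (x, y)).
  rewrite integral_mkcond; apply: eq_integral => x _; rewrite patchE.
  case: ifPn => xD; last first.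
    by rewrite [LHS](_ : _ = 0)//; apply/esym/integral0_eq => y _; rewrite /g /= (negbTE xD).
  rewrite integral_mkcond; apply: eq_integral => y _.
  by rewrite patchE /g /= xD.
rewrite (fubini_tonelli _ mg g0); apply/esym.
rewrite integral_mkcond; apply: eq_integral => y _; rewrite patchE.
case: ifPn => yD; last first.
  by rewrite [LHS](_ : _ = 0)//; apply/esym/integral0_eq => x _; rewrite /g /= (negbTE yD) andbF.
rewrite integral_mkcond; apply: eq_integral => x _.
by rewrite patchE /g /= yD andbT.
Qed.

Lemma measurable_fubini_domain1 d1 d2 (T1 : measurableType d1) (T2 : measurableType d2)
    (m2 : {sigma_finite_measure set T2 -> \bar R}) (D2 : set T2)
    (h : T1 * T2 -> \bar R) : measurable D2 ->
  measurable_fun setT h -> (forall z, 0 <= h z) ->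
  measurable_fun setT (fun x => \int[m2]_(y in D2) h (x, y)).
Proof.
move=> mD2 mh h0; pose g (z : T1 * T2) := if z.2 \in D2 then h z else 0.
have mg : measurable_fun setT g.
  by apply: measurable_fun_ifT => //; exact: measurable_mem.
have g0 z : 0 <= g z by rewrite /g; case: ifP.
rewrite (_ : (fun x => _) = fun x => \int[m2]_y g (x, y)).
  exact: (measurable_fun_fubini_tonelli_F _ mg g0).
apply/funext => x; rewrite integral_mkcond; apply: eq_integral => y _.
by rewrite patchE /g.
Qed.

Lemma measurable_fubini_domain2 d1 d2 (T1 : measurableType d1) (T2 : measurableType d2)
    (m1 : {sigma_finite_measure set T1 -> \bar R}) (D1 : set T1)
    (h : T1 * T2 -> \bar R) : measurable D1 ->
  measurable_fun setT h -> (forall z, 0 <= h z) ->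
  measurable_fun setT (fun y => \int[m1]_(x in D1) h (x, y)).
Proof.
move=> mD1 mh h0.
have := @measurable_fubini_domain1 _ _ T2 T1 m1 D1 (fun z => h (z.2, z.1)) mD1.
by apply=> //; apply: (measurableT_comp mh); exact: measurable_fun_pair.
Qed.

Lemma measurable_superlevel_measure f : measurable_fun setT f ->
  measurable_fun setT (fun s : measurableTypeR R => leb [set x | s%:E < f x]).
Proof.
move=> mf; rewrite (_ : (fun s : measurableTypeR R => _) =
  (fun s : measurableTypeR R => \int[leb]_y (cst 1 y * ind [set y | s%:E < f y] y))).
  exact: measurable_superlevel_integral.
apply/funext => s; rewrite -integral_ind; last exact: measurable_superlevel.
by apply: eq_integral => x _; rewrite mul1e.
Qed.

(** Slicing [v] into level sets reduces the left side to the Riesz inequality for sets, which puts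
    [psi], the convolution with the indicator of the ball, in place of the convolution with that of
    [A]. Slicing [psi] as well leaves a double integral of the smaller of the measures of two level
    sets; exchanging the integrals, [layer_min_le] on each level set of [psi] brings in [u]. *)
Lemma conv_mass_le (K : E -> \bar R) v u (r : R) A :
  (forall x, 0 <= K x) -> radially_nonincreasing K ->
  measurable_fun setT v -> (forall x, 0 <= v x) -> (forall x, ~ eball r x -> v x = 0) ->
  (forall x, 0 <= u x) -> radially_nonincreasing u -> \int[leb]_x u x < +oo ->
  tail_integral_le v u -> measurable A -> A `<=` eball r ->
  \int[leb]_x (conv K v x * ind A x) <= \int[leb]_x (conv K u x * ind (symm_set A) x).
Proof.
move=> K0 Kr mv v0 vr u0 ur uoo vu mA Ar.
have mAs := @measurable_symm_set R N A.
have mu_u := measurable_radial ur.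
have ind0 (B : set E) y : 0 <= ind B y by exact: ind_ge0.
have mind (B : set E) : measurable B -> measurable_fun setT (ind B) by exact: measurable_ind.
pose psi := conv K (ind (symm_set A)).
have psi0 y : 0 <= psi y by exact: conv_ge0.
have mpsi : measurable_fun setT psi by apply: measurable_conv => //; exact: mind.
have psir : radially_nonincreasing psi.
  apply: radial_conv => //; apply: radialP => x y xy; rewrite /ind !indicE lee_fin ler_nat.
  have : x \in symm_set A -> y \in symm_set A.
    by rewrite !inE /symm_set /eball /=; exact: le_lt_trans.
  by case: (x \in _) => [->|].
have mS s : measurable [set x | s%:E < v x] by exact: measurable_superlevel.
have mD s : measurable [set x | s%:E < psi x] by exact: measurable_superlevel.
have mlv := measurable_superlevel_measure mv.
have mlp := measurable_superlevel_measure mpsi.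
rewrite conv_sym//; last exact: mind.
under eq_integral do rewrite muleC.
rewrite -(layer_cake0 mv)//; last 2 first.
- by apply: measurable_conv => //; exact: mind.
- by move=> y; exact: conv_ge0.
pose h (z : measurableTypeR R * measurableTypeR R) : \bar R :=
  mine (leb [set x | z.1%:E < v x]) (leb [set x | z.2%:E < psi x]).
have h0 z : 0 <= h z by rewrite le_min !measure_ge0.
have mh : measurable_fun setT h.
  apply: measurable_mine.
    exact: (measurableT_comp mlv measurable_fst).
  exact: (measurableT_comp mlp measurable_snd).
apply: (@le_trans _ _ (\int[mu]_(s in `]0%R, +oo[) \int[mu]_(tau in `]0%R, +oo[) h (s, tau))).
  apply: ge0_le_integral => //.
  - by move=> s _; apply: integral_ge0 => y _; rewrite mule_ge0// conv_ge0.
  - apply: measurable_funTS; apply: measurable_superlevel_integral => //.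
      by apply: measurable_conv => //; exact: mind.
    by move=> y; exact: conv_ge0.
  - apply: measurable_funTS.
    exact: (@measurable_fubini_domain1 _ _ _ _ mu _ h (measurable_itv _) mh h0).
  move=> s; rewrite /= in_itv /= andbT => s0.
  have Sr : [set x | s%:E < v x] `<=` eball r.
    by move=> x /= sv; apply: contrapT => /vr vx; move: sv; rewrite vx lte_fin ltNge ltW.
  have Soo : leb [set x | s%:E < v x] < +oo.
    apply: le_lt_trans (lebesgue_eball_lty N r); apply: le_measure; rewrite ?inE//.
    exact: measurable_eball.
  rewrite -riesz_conv//.
  apply: le_trans (riesz_rearrangement N_gt0 K0 Kr (mS s) mA Sr Ar) _.
  rewrite riesz_conv//; last exact: measurable_symm_set.
  under eq_integral do rewrite muleC.
  have mSs := @measurable_symm_set R N [set x | s%:E < v x].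
  rewrite -(layer_cake0 mpsi (mind _ mSs))//.
  apply: ge0_le_integral => //.
  - by move=> tau _; apply: integral_ge0 => y _; rewrite mule_ge0.
  - by apply: measurable_funTS; apply: measurable_superlevel_integral => //; exact: mind.
  - by apply: measurable_funTS; exact: (measurable_fun_pair2 s mh).
  move=> tau _; rewrite /h /= le_min; apply/andP; split.
    rewrite -(lebesgue_symm_set N_gt0 Soo) -integral_ind//; apply: ge0_le_integral => //.
    - by move=> y _; rewrite mule_ge0.
    - by apply: emeasurable_funM; exact: mind.
    - exact: mind.
    - by move=> y _; rewrite mule_ind; case: ifP.
  rewrite -integral_ind//; apply: ge0_le_integral => //.
  - by move=> y _; rewrite mule_ge0.
  - by apply: emeasurable_funM; exact: mind.
  - exact: mind.
  - by move=> y _; rewrite muleC mule_ind; case: ifP.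
rewrite (@tonelli_domain _ _ _ _ mu mu _ _ h (measurable_itv _) (measurable_itv _) mh h0).
rewrite conv_sym//; last exact: mind.
rewrite -/psi -(layer_cake0 mpsi mu_u)//.
apply: ge0_le_integral => //.
- by move=> tau _; apply: integral_ge0.
- apply: measurable_funTS.
  exact: (@measurable_fubini_domain2 _ _ _ _ mu _ h (measurable_itv _) mh h0).
- by apply: measurable_funTS; exact: measurable_superlevel_integral.
move=> tau _; rewrite /h /=; apply: layer_min_le => // x y xy /=.
by move=> /lt_le_trans; apply; exact: radial_le.
Qed.

End conv_comparison.

(** * Schwarz symmetrization *)

Section schwarz_symmetrization.
Context (R : realType) (N : nat).
Local Notation E := 'rV[R]_N.
Local Notation leb := (@lebesgue_rV R N).
Local Notation mu := (@lebesgue_measure R).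
Local Open Scope ereal_scope.
Hypothesis N_gt0 : (0 < N)%N.
Variables (F : E -> R) (r : R).
Hypotheses (mF : measurable_fun setT F) (F_ball : forall x, ~ eball r x -> F x = 0%R).

(** The maximum with 0 keeps these sets bounded for negative [s] too, so that their radius [rho] is
    a monotone function on the whole line. *)
Let level s : set E := [set y | (Num.max s 0 < F y)%R].

Let level_gt0 s : (0 < s)%R -> [set y | (s < F y)%R] = level s.
Proof. by move=> s0; rewrite /level max_l// ltW. Qed.

Let mlevel s : measurable (level s).
Proof. exact: measurable_set_lt. Qed.

Let level_ball s : level s `<=` eball r.
Proof.
move=> x; rewrite /level /= => Fx; apply: contrapT => /F_ball Fx0.
by move: Fx; rewrite Fx0 gt_max ltxx andbF.
Qed.

Let level_lty s : leb (level s) < +oo.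
Proof.
apply: le_lt_trans (lebesgue_eball_lty N r); apply: le_measure; rewrite ?inE//.
exact: measurable_eball.
Qed.

Let rho (s : R) : R := symm_radius (level s).

Let rho_nonincreasing : nonincreasing_fun rho.
Proof.
move=> s t st; apply: le_symm_radius => //; apply: le_measure; rewrite ?inE//.
move=> x; rewrite /level /=; apply: le_lt_trans.
by rewrite ge_max !le_max st lexx !orbT.
Qed.

Let Z : set (measurableTypeR R * E) := [set z : measurableTypeR R * E | (enorm z.2 < rho z.1)%R].

(** A monotone radius is Borel. Joint measurability in height and position is what permits
    exchanging integrals in [schwarz]. *)
Let mZ : measurable Z.
Proof.
apply: measurable_set_lt; first exact: measurable_enorm.
apply: (measurableT_comp _ measurable_fst).
exact: nonincreasing_measurable.
Qed.

Let mZi : measurable_fun setT (fun z => (\1_Z z)%:E : \bar R).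
Proof. by apply/measurable_EFinP; exact: measurable_indic. Qed.

Let schwarzE x : schwarz F x = \int[mu]_(s in `]0%R, +oo[) (\1_Z (s, x))%:E.
Proof.
apply: eq_integral => s; rewrite inE /= in_itv /= andbT => s0.
by rewrite (level_gt0 s0).
Qed.

Lemma schwarz_ge0 x : 0 <= schwarz F x.
Proof. by apply: integral_ge0 => s _; rewrite lee_fin. Qed.

Lemma radial_schwarz : radially_nonincreasing (schwarz F).
Proof.
have m1 x : measurable_fun setT (fun s : measurableTypeR R => (\1_Z (s, x))%:E : \bar R).
  exact: (measurable_fun_pair1 x mZi).
apply: radialP => x y xy; rewrite !schwarzE; apply: ge0_le_integral => //.
- exact: measurable_funTS.
- exact: measurable_funTS.
- move=> s _; rewrite !indicE lee_fin ler_nat.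
  have : (s, x) \in Z -> (s, y) \in Z by rewrite !inE; exact: le_lt_trans.
  by case: (_ \in Z) => [->|].
Qed.

(** At each height the claim compares the measure of [A] intersected with a level set and that of
    the two corresponding balls. The balls are nested, so their intersection has the smaller of the
    two measures. *)
Lemma schwarz_mass_le : (forall x, 0 <= F x)%R -> mass_le (EFin \o F) (schwarz F).
Proof.
move=> F0 A mA Aoo; have mAs := @measurable_symm_set R N A.
have mind (B : set E) : measurable B -> measurable_fun setT (ind B) by exact: measurable_ind.
have ind0 (B : set E) y : 0 <= ind B y by exact: ind_ge0.
have mEF : measurable_fun setT (EFin \o F) by exact/measurable_EFinP.
under eq_integral do rewrite muleC.
rewrite -(layer_cake0 mEF (mind _ mA))//.
pose h (z : measurableTypeR R * E) : \bar R := ind (symm_set A) z.2 * (\1_Z z)%:E.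
have h0 z : 0 <= h z by rewrite mule_ge0// lee_fin.
have mh : measurable_fun setT h.
  by apply: emeasurable_funM => //; apply: measurableT_comp => //; exact: mind.
apply: (@le_trans _ _ (\int[mu]_(s in `]0%R, +oo[) \int[leb]_x h (s, x))); last first.
  have mI : measurable (`]0%R, +oo[%classic : set (measurableTypeR R)) by exact: measurable_itv.
  have := @tonelli_domain R _ _ _ _ mu leb _ setT h mI measurableT mh h0.
  move=> ->; apply: ge0_le_integral => //.
  - by move=> x _; apply: integral_ge0.
  - apply: (@measurable_fubini_domain2 R _ _ _ _ mu _ h) => //.
  - apply: emeasurable_funM; first exact: (measurable_radial radial_schwarz).
    exact: mind.
  - move=> x _; rewrite schwarzE muleC -ge0_integralZl//.
    by apply: measurable_funTS; exact: (measurable_fun_pair1 x mZi).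
apply: ge0_le_integral => //.
- by move=> s _; apply: integral_ge0 => y _; rewrite mule_ge0.
- by apply: measurable_funTS; apply: measurable_superlevel_integral => //; exact: mind.
- apply: measurable_funTS.
  exact: (measurable_fun_fubini_tonelli_F _ mh h0).
move=> s; rewrite /= in_itv /= andbT => s0.
have -> : [set y | s%:E < (F y)%:E] = level s.
  by rewrite -(level_gt0 s0); apply/seteqP; split => y /=; rewrite lte_fin.
have indI (B C : set E) : measurable B -> measurable C ->
    \int[leb]_y (ind B y * ind C y) = leb (B `&` C).
  move=> mB mC; rewrite -integral_ind; last exact: measurableI.
  by apply: eq_integral => y _; rewrite /ind indicI EFinM.
have -> : \int[leb]_x h (s, x) = leb (symm_set A `&` symm_set (level s)).
  rewrite -indI//; last exact: measurable_symm_set.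
rewrite indI//.
have [AS|SA] := leP (leb A) (leb (level s)).
  rewrite (setIidl (subset_symm_set N_gt0 AS (level_lty s))).
  rewrite lebesgue_symm_set//; apply: le_measure; rewrite ?inE//.
  exact: measurableI.
rewrite (setIidr (subset_symm_set N_gt0 (ltW SA) Aoo)).
rewrite lebesgue_symm_set//; apply: le_measure; rewrite ?inE//.
exact: measurableI.
Qed.

End schwarz_symmetrization.

(** * Maximum principle and Picard iteration *)

Section subsolution.
Context (R : realType) (N : nat).
Local Notation E := 'rV[R]_N.
Local Notation leb := (@lebesgue_rV R N).
Local Open Scope ereal_scope.
Hypothesis N_gt0 : (0 < N)%N.

Let e1 : 'I_N := Ordinal N_gt0.

Lemma measurable_singleton0 : measurable [set (0%R : E)].
Proof.
rewrite (_ : [set 0%R] = (@enorm R N) @^-1` [set 0%R]).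
  by apply: measurable_preimageT => //; exact: measurable_enorm.
apply/seteqP; split => x /=; first by move=> ->; rewrite enorm0.
by move=> /eqP; rewrite enorm_eq0 => /eqP.
Qed.

Lemma lebesgue_set1 : leb [set (0%R : E)] = 0.
Proof.
apply/eqP; rewrite eq_le measure_ge0 andbT; apply/lee_addgt0Pr => e e0; rewrite add0e.
have [r r0 hr] := lebesgue_small_eball N_gt0 e0.
apply: le_trans hr; apply: le_measure; rewrite ?inE; last 2 first.
- exact: measurable_eball.
- by move=> _ ->; rewrite /eball /= enorm0.
exact: measurable_singleton0.
Qed.

(** The origin is a null set, so [K] is positive at some other point, and monotonicity spreads this
    bound over the ball through that point. *)
Lemma radial_gt0 (K : E -> \bar R) : (forall x, 0 <= K x) -> radially_nonincreasing K ->
  0 < \int[leb]_x K x ->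
  exists t rho : R, [/\ (0 < t)%R, (0 < rho)%R & forall x, eball rho x -> t%:E <= K x].
Proof.
move=> K0 Kr Kpos.
have [x0 [x00 Kx0]] : exists x0, x0 != 0%R /\ 0 < K x0.
  apply: contrapT => nx.
  have Kz x : x != 0%R -> K x = 0.
    move=> x0; apply/eqP; rewrite eq_le K0 andbT leNgt; apply/negP => h.
    by apply: nx; exists x.
  move: Kpos; rewrite (_ : \int[leb]_x K x = 0) ?ltxx//.
  have mK := measurable_radial Kr.
  rewrite (@ge0_ae_eq_integral _ _ _ leb setT K (cst 0))//; first exact: integral0.
  exists [set 0%R]; split; [exact: measurable_singleton0|exact: lebesgue_set1|].
  by move=> x /= h; apply/eqP/negPn/negP => /Kz Kx; apply: h.
have [t t0 tK] : exists2 t : R, (0 < t)%R & t%:E <= K x0.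
  move: Kx0; case: (K x0) => [t| |]//.
  - by rewrite lte_fin => t0; exists t.
  - by exists 1%R => //; rewrite leey.
exists t, (enorm x0); split => //; first exact: enorm_gt0.
by move=> x /ltW xx0; apply: le_trans tK _; exact: radial_le xx0.
Qed.

Lemma radial_halfspace_gt0 (K : E -> \bar R) : (forall x, 0 <= K x) ->
  radially_nonincreasing K -> 0 < \int[leb]_x K x ->
  exists a m : R, [/\ (0 < a)%R, (0 < m)%R &
    m%:E <= \int[leb]_z (K z * ind [set z : E | (a <= z ord0 e1)%R] z)].
Proof.
move=> K0 Kr /(radial_gt0 K0 Kr)[t [rho [t0 rho0 tK]]].
(* The ball of radius [rho / 4] about [c] lies in [eball rho], and its points have first coordinate
   at least [rho / 4]. *)
pose c : E := ((rho / 2) *: delta_mx ord0 e1)%R.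
pose B := (fun x : E => x - c)%R @^-1` eball (rho / 4).
have mB : measurable B.
  by apply: measurable_preimageT; [exact: measurable_subrV|exact: measurable_eball].
have mS : measurable [set z : E | (rho / 4 <= z ord0 e1)%R].
  by apply: measurable_set_le => //; exact: measurable_coord.
have lB : leb B = leb (eball (rho / 4)) by rewrite lebesgue_rV_shift//; exact: measurable_eball.
have rho4 : (0 < rho / 4)%R by rewrite divr_gt0.
exists (rho / 4)%R, (t * fine (leb B))%R; split => //.
  by rewrite mulr_gt0// fine_gt0// lB lebesgue_eball_gt0//= lebesgue_eball_lty.
rewrite EFinM fineK ?lB ?lebesgue_eball_fin// -lB.
apply: integral_ge_indic => //.
- by rewrite lee_fin ltW.
- by apply: emeasurable_funM; [exact: measurable_radial|exact: measurable_ind].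
- by move=> x; rewrite mule_ge0// ind_ge0.
move=> x Bx; rewrite mule_ind ifT.
  apply: tK; rewrite /eball /= enorm_lt ?ltW//.
  have := dot_sub_le (x - c)%R (- c)%R; rewrite opprK subrK dotNl dotNr opprK.
  move: Bx; rewrite /B /eball /= enorm_lt ?(ltW rho4)// => Bx.
  have -> : dot c c = (rho ^+ 2 / 4)%R.
    rewrite /c dotZl dotZr /dot (bigD1 e1)//= big1 ?addr0 => [|i ie].
      by rewrite !mxE !eqxx /=; field.
    by rewrite !mxE eqxx (negbTE ie) mul0r.
  move=> h; apply: le_lt_trans h _.
  have : (0 < rho ^+ 2)%R by rewrite exprn_gt0.
  move: Bx; rewrite exprMn => Bx r2; rewrite (_ : 4^-1 ^+ 2 = 16^-1 :> R)%R in Bx; last by field.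
  lra.
apply/mem_set => /=.
have := le_lt_trans (coord_le_enorm (x - c)%R e1) Bx.
by rewrite !mxE !eqxx /= mulr1 ltr_norml => /andP[h _]; lra.
Qed.

(* The weight [1 - q], with [q] exponential in the first coordinate, is a strict
   supersolution of [kr * phi = conv K phi] on bounded sets. *)
Lemma conv_subsolution_eq0 (K : E -> \bar R) (kr r : R) (A : set E) (f : E -> \bar R) :
  (forall x, 0 <= K x) -> radially_nonincreasing K -> \int[leb]_x K x = kr%:E ->
  (0 < kr)%R -> measurable A -> A `<=` eball r ->
  measurable_fun setT f -> (forall x, 0 <= f x) -> (forall x, ~ A x -> f x = 0) ->
  \int[leb]_x f x < +oo ->
  {ae leb, forall x, A x -> kr%:E * f x <= conv K f x} ->
  {ae leb, forall x, f x = 0}.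
Proof.
move=> K0 Kr Kint kr0 mA Ar mf f0 fA foo fK.
have mK := measurable_radial Kr.
have [a [m [a0 m0 hm]]] : exists a m : R, [/\ (0 < a)%R, (0 < m)%R &
    m%:E <= \int[leb]_z (K z * ind [set z : E | (a <= z ord0 e1)%R] z)].
  by apply: radial_halfspace_gt0 => //; rewrite Kint lte_fin.
(* A step of length [a] in the first coordinate multiplies [q] by [2 * kr / m], enough to outweigh
   the small mass [m]. The normalization of [q] keeps it at most 1 up to first coordinate [r + a],
   which leaves room for one step from [A]. *)
pose lam := (ln (2 * kr / m) / a)%R.
pose q (x : E) := expR (lam * (x ord0 e1 - r - a))%R.
have mS : measurable [set z : E | (a <= z ord0 e1)%R].
  by apply: measurable_set_le => //; exact: measurable_coord.
have mkr : (m <= kr)%R.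
  rewrite -lee_fin -Kint; apply: le_trans hm _; apply: ge0_le_integral => //.
  - by move=> x _; rewrite mule_ge0// ind_ge0.
  - by apply: emeasurable_funM => //; exact: measurable_ind.
  - by move=> x _; rewrite mule_ind; case: ifP.
have lam0 : (0 < lam)%R.
  rewrite divr_gt0// ln_gt0// ltr_pdivlMr// mul1r; lra.
have q0 x : (0 < q x)%R by exact: expR_gt0.
have q1 (x : E) : (x ord0 e1 <= r + a)%R -> (q x <= 1)%R.
  by move=> h; rewrite -expR0 ler_expR mulr_ge0_le0 ?(ltW lam0)//; lra.
have qmono (x y : E) : (x ord0 e1 <= y ord0 e1)%R -> (q x <= q y)%R.
  by move=> h; rewrite ler_expR ler_pM2l//; lra.
pose shift (y : E) : E := (y + a *: delta_mx ord0 e1)%R.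
have shift1 y : ((shift y) ord0 e1 = y ord0 e1 + a)%R by rewrite !mxE !eqxx /= mulr1.
have qshift y : (q (shift y) * m = 2 * kr * q y)%R.
  rewrite /q shift1 (_ : lam * (_ + a - r - a) = lam * a + lam * (y ord0 e1 - r - a))%R; last by ring.
  rewrite expRD /lam divfK ?gt_eqF// lnK ?posrE ?divr_gt0 ?mulr_gt0//.
  by rewrite mulrAC divfK ?gt_eqF.
have Acoord (x : E) : A x -> (x ord0 e1 < r)%R.
  by move=> /Ar; apply: le_lt_trans; apply: le_trans (coord_le_enorm x e1); exact: ler_norm.
have mq : measurable_fun setT q.
  apply: (measurableT_comp (@measurable_expR R)); apply: measurable_funM => //.
  apply: measurable_funB => //; apply: measurable_funB => //; exact: measurable_coord.
pose phi (x : E) : \bar R := (1 - q x)%:E * ind A x.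
have mphi : measurable_fun setT phi.
  apply: emeasurable_funM; last exact: measurable_ind.
  by apply/measurable_EFinP; exact: measurable_funB.
have phi0 x : 0 <= phi x.
  rewrite /phi mule_ind; case: ifPn => // /set_mem/Acoord xr.
  by rewrite lee_fin subr_ge0 q1//; lra.
have mEq : measurable_fun setT (EFin \o q) by exact/measurable_EFinP.
(* The constant 1 dominates [phi] plus [q (shift y)] times the indicator of [H]: in [A] because [q]
   grows with the first coordinate, outside because [q (shift y) <= 1]. Seen from [y], the
   half-space [H] carries kernel mass at least [m], which contributes
   [q (shift y) * m = 2 * kr * q y]. *)
have hconv y : A y -> conv K phi y + (2 * kr * q y)%:E <= kr%:E.
  move=> Ay; have yr := Acoord _ Ay.
  have -> : kr%:E = conv K (cst 1) y by rewrite conv1.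
  pose H := [set x : E | (a <= (x - y) ord0 e1)%R].
  have mH : measurable H.
    apply: measurable_set_le => //; apply: (measurableT_comp (measurable_coord e1)).
    exact: measurable_subrV.
  apply: (@le_trans _ _ (conv K phi y + conv K (fun x => (q (shift y))%:E * ind H x) y)).
    rewrite leeD2l// -qshift EFinM.
    rewrite /conv (_ : \int[leb]_x _ =
      \int[leb]_x ((q (shift y))%:E * (K (x - y)%R * ind H x))); last first.
      by apply: eq_integral => x _; rewrite KN// muleCA.
    rewrite ge0_integralZl//; last 3 first.
    - apply: emeasurable_funM; last exact: measurable_ind.
      by apply: (measurableT_comp mK); exact: measurable_subrV.
    - by move=> x _; rewrite mule_ge0// ind_ge0.
    - by rewrite lee_fin ltW.
    rewrite lee_pmul2l ?lte_fin//; apply: le_trans hm _.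
    have mKS : measurable_fun setT (fun z => K z * ind [set z : E | (a <= z ord0 e1)%R] z).
      by apply: emeasurable_funM => //; exact: measurable_ind.
    have KS0 z : 0 <= K z * ind [set z : E | (a <= z ord0 e1)%R] z by rewrite mule_ge0// ind_ge0.
    have mr : measurable_fun setT (fun x : E => x - y)%R by exact: measurable_subrV.
    have pr (B : set E) : measurable B -> leb ((fun x => x - y)%R @^-1` B) = leb B.
      by move=> mB; exact: lebesgue_rV_shift.
    by rewrite -(ge0_integral_preserving mr pr mKS KS0).
  have mHq : measurable_fun setT (fun x => (q (shift y))%:E * ind H x).
    by apply: measurable_funeM; exact: measurable_ind.
  have Hq0 x : 0 <= (q (shift y))%:E * ind H x by rewrite mule_ge0 ?ind_ge0// lee_fin ltW.
  rewrite /conv -ge0_integralD//; try exact: measurable_convK;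
    try by move=> x _; rewrite mule_ge0.
  apply: ge0_le_integral => //.
  - by move=> x _; rewrite adde_ge0// mule_ge0.
  - by apply: emeasurable_funD; exact: measurable_convK.
  - exact: measurable_convK.
  move=> x _; rewrite -ge0_muleDr//; apply: lee_wpmul2l => //.
  rewrite /phi !mule_ind; case: ifPn => [/set_mem xA|_]; case: ifPn => [/set_mem xH|_].
  - rewrite -EFinD lee_fin; suff : (q (shift y) <= q x)%R by lra.
    by apply: qmono; rewrite shift1; move: xH; rewrite /H /= !mxE; lra.
  - by rewrite adde0 lee_fin; have := q0 x; lra.
  - by rewrite add0e lee_fin q1// shift1; lra.
  - by rewrite adde0.
have mfq : measurable_fun setT (fun x => f x * (q x)%:E) by exact: emeasurable_funM.
have fq0 x : 0 <= f x * (q x)%:E by rewrite mule_ge0// lee_fin ltW.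
have m_conv_phi : measurable_fun setT (conv K phi) by exact: measurable_conv.
have conv_phi0 x : 0 <= conv K phi x by exact: conv_ge0.
have kfp0 x : 0 <= kr%:E * f x * phi x.
  by apply: mule_ge0 => //; rewrite mule_ge0// lee_fin ltW.
(* The subsolution inequality is integrated against [phi] and the convolution moved onto [phi] by
   symmetry, where [hconv] applies. As [f] is integrable, the integral of [f * q] must vanish, and
   [q] is positive. *)
have key : kr%:E * (\int[leb]_x f x + \int[leb]_x (f x * (q x)%:E)) <= kr%:E * \int[leb]_x f x.
  rewrite -ge0_integralD//.
  have -> : kr%:E * \int[leb]_x (f x + f x * (q x)%:E) =
      \int[leb]_x (kr%:E * f x * phi x + f x * (2 * kr * q x)%:E).
    rewrite -ge0_integralZl//; last 3 first.
    - exact: emeasurable_funD.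
    - by move=> x _; rewrite adde_ge0.
    - by rewrite lee_fin ltW.
    apply: eq_integral => x _; rewrite /phi mule_ind.
    have [xA|xA] := pselect (A x); last by rewrite fA// !(mul0e, mule0, adde0).
    rewrite mem_set// (muleC kr%:E (f x)) -muleA -ge0_muleDr; last 2 first.
    - by rewrite -EFinM lee_fin mulr_ge0 ?(ltW kr0)// subr_ge0 q1//; have := Acoord _ xA; lra.
    - by rewrite lee_fin !mulr_ge0// ltW.
    rewrite -{1}(mule1 (f x)) -ge0_muleDr ?lee_fin//; last exact: ltW.
    rewrite (muleC kr%:E) -muleA; congr (_ * _); rewrite -!EFinD -!EFinM; congr EFin; ring.
  rewrite ge0_integralD//; last 3 first.
  - by apply: emeasurable_funM => //; exact: measurable_funeM.
  - by move=> x _; rewrite mule_ge0// lee_fin !mulr_ge0// ltW.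
  - by apply: emeasurable_funM => //; apply/measurable_EFinP; exact: measurable_funM.
  apply: (@le_trans _ _ (\int[leb]_x (conv K f x * phi x) +
      \int[leb]_x (f x * (2 * kr * q x)%:E))).
    rewrite leeD2r//; apply: ae_ge0_le_integral => //.
    - by apply: emeasurable_funM => //; exact: measurable_funeM.
    - by move=> x _; rewrite mule_ge0// conv_ge0.
    - by apply: emeasurable_funM => //; exact: measurable_conv.
    apply: filterS fK => x fKx _; have [xA|xA] := pselect (A x).
      by rewrite lee_wpmul2r// fKx.
    by rewrite /phi mule_ind memNset// !mule0.
  rewrite conv_sym// -ge0_integralD//; last 4 first.
  - by move=> x _; rewrite mule_ge0.
  - exact: emeasurable_funM.
  - by move=> x _; rewrite mule_ge0// lee_fin !mulr_ge0// ltW.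
  - by apply: emeasurable_funM => //; apply/measurable_EFinP; exact: measurable_funM.
  rewrite -ge0_integralZl//; last by rewrite lee_fin ltW.
  apply: ge0_le_integral => //.
  - by move=> x _; rewrite adde_ge0// mule_ge0// lee_fin !mulr_ge0// ltW.
  - apply: emeasurable_funD; first exact: emeasurable_funM.
    by apply: emeasurable_funM => //; apply/measurable_EFinP; exact: measurable_funM.
  - exact: measurable_funeM.
  move=> x _; have [xA|xA] := pselect (A x); last by rewrite fA// !(mul0e, mule0) adde0.
  rewrite -ge0_muleDr//; last by rewrite lee_fin !mulr_ge0// ltW.
  by rewrite (muleC kr%:E); apply: lee_wpmul2l => //; exact: hconv.
have ffin : \int[leb]_x f x \is a fin_num by rewrite ge0_fin_numE// integral_ge0.
move: key; rewrite lee_pmul2l ?lte_fin// -{2}(adde0 (\int[leb]_x f x)) leeD2lE// => key.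
have int0 : \int[leb]_x `|f x * (q x)%:E| = 0.
  apply/eqP; rewrite eq_le; apply/andP; split; last exact: integral_ge0.
  by apply: le_trans key; apply: ge0_le_integral => // [|x _];
    [exact: measurableT_comp|rewrite gee0_abs].
have /(ae_eq_integral_abs _ measurableT mfq).1 := int0.
apply: filterS => x /(_ I) /= /eqP; rewrite mule_eq0 => /orP[/eqP//|].
by rewrite eqe gt_eqF.
Qed.

End subsolution.

(** * Picard iterates and their limit *)

Section iteration.
Context (R : realType) (N : nat).
Local Notation E := 'rV[R]_N.
Local Notation leb := (@lebesgue_rV R N).
Local Open Scope ereal_scope.

(** The case [k = +oo] matters because the kernel may be infinite at the origin: if some term of [s]
    is positive the right side is infinite, otherwise the limit is 0. *)
Lemma mule_lim_le (k : \bar R) (s : (\bar R)^nat) : 0 <= k -> (forall n, 0 <= s n) ->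
  nondecreasing_seq s -> k * limn s <= limn (fun n => k * s n).
Proof.
move=> k0 s0 sn; have cs := ereal_nondecreasing_is_cvgn sn.
have [kfin|] := boolP (k \is a fin_num); first by rewrite limeMl// fin_num_abs.
rewrite ge0_fin_numE// -leNgt leye_eq => /eqP koo.
have cks : cvgn (fun n => k * s n).
  by apply: ereal_nondecreasing_is_cvgn => i j ij; apply: lee_wpmul2l => //; exact: sn.
have [[m sm]|sz] := pselect (exists m, 0 < s m).
  apply: (@le_trans _ _ +oo); first exact: leey.
  have -> : +oo = k * s m by rewrite koo gt0_mulye.
  apply: lime_ge => //; exists m => // n /= mn.
  by apply: lee_wpmul2l => //; exact: sn.
have -> : limn s = 0.
  rewrite (_ : s = cst 0) ?lim_cst//; apply/funext => n; apply/eqP.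
  by rewrite eq_le s0 andbT leNgt; apply/negP => sn0; apply: sz; exists n.
by rewrite mule0; apply: lime_ge => //; near=> n; rewrite mule_ge0.
Unshelve. all: by end_near. Qed.

Variables (K : E -> \bar R) (kr c : R).
Hypotheses (K_ge0 : forall x, 0 <= K x) (K_radial : radially_nonincreasing K).
Hypotheses (kr_gt0 : (0 < kr)%R) (c_ge0 : (0 <= c)%R).

Definition step (A : set E) (h f : E -> \bar R) (x : E) : \bar R :=
  (kr + c)^-1%:E * (conv K f x + h x) * ind A x.

Definition iterate (A : set E) (h : E -> \bar R) (n : nat) : E -> \bar R :=
  iter n (step A h) (cst 0).

Definition solution (A : set E) (h : E -> \bar R) (x : E) : \bar R :=
  limn (fun n => iterate A h n x).

Variables (A : set E) (h : E -> \bar R).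
Hypotheses (mA : measurable A) (mh : measurable_fun setT h) (h0 : forall x, 0 <= h x).

Let q0 : 0 <= (kr + c)^-1%:E.
Proof. by rewrite lee_fin invr_ge0 addr_ge0// ltW. Qed.

Let kc0 : (0 < kr + c)%R. Proof. by rewrite ltr_wpDr. Qed.

Lemma step_ge0 f x : (forall y, 0 <= f y) -> 0 <= step A h f x.
Proof.
by move=> f0; rewrite /step !mule_ge0 ?ind_ge0// adde_ge0// conv_ge0.
Qed.

Lemma measurable_step f : measurable_fun setT f -> (forall y, 0 <= f y) ->
  measurable_fun setT (step A h f).
Proof.
move=> mf f0; apply: emeasurable_funM; last exact: measurable_ind.
by apply: measurable_funeM; apply: emeasurable_funD => //; exact: measurable_conv.
Qed.

Lemma iterate_ge0 n x : 0 <= iterate A h n x.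
Proof. by elim: n x => [//|n IH] x; exact: step_ge0. Qed.

Lemma measurable_iterate n : measurable_fun setT (iterate A h n).
Proof.
elim: n => [|n IH]; first exact: measurable_cst.
by apply: measurable_step => // y; exact: iterate_ge0.
Qed.

Lemma iterate_nondecreasing x : nondecreasing_seq (fun n => iterate A h n x).
Proof.
apply/nondecreasing_seqP => n; elim: n x => [|n IH] x; first exact: iterate_ge0.
rewrite /iterate /= /step; apply: lee_wpmul2r; first exact: ind_ge0.
apply: lee_wpmul2l => //; rewrite leeD2r//; apply: le_conv => //.
- exact: measurable_iterate.
- exact: (measurable_iterate n.+1).
- exact: iterate_ge0.
Qed.

Lemma iterate_cvg x : (fun n => iterate A h n x) @ \oo --> solution A h x.
Proof. exact: (ereal_nondecreasing_is_cvgn (@iterate_nondecreasing x)). Qed.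

Lemma iterate_le_solution n x : iterate A h n x <= solution A h x.
Proof.
apply: lime_ge; first exact: (ereal_nondecreasing_is_cvgn (@iterate_nondecreasing x)).
by exists n => // m /= nm; exact: iterate_nondecreasing.
Qed.

Lemma solution_ge0 x : 0 <= solution A h x.
Proof. exact: le_trans (iterate_ge0 0 x) (iterate_le_solution 0 x). Qed.

Lemma measurable_solution : measurable_fun setT (solution A h).
Proof.
apply: (emeasurable_fun_cvg (iterate A h)); first exact: measurable_iterate.
by move=> x _; exact: iterate_cvg.
Qed.

Lemma iterate_outside n x : ~ A x -> iterate A h n x = 0.
Proof. by case: n => [//|n] nA; rewrite /iterate /= /step mule_ind memNset. Qed.

Lemma solution_outside x : ~ A x -> solution A h x = 0.
Proof.
move=> nA; apply: (cvg_lim (@ereal_hausdorff R)).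
by under eq_fun do rewrite iterate_outside//; exact: cvg_cst.
Qed.

(** This half of the fixed-point equation makes the difference between a given solution and the
    limit of the iterates a subsolution in [solution_unique]. *)
Lemma solution_super x : A x ->
  conv K (solution A h) x + h x <= (kr + c)%:E * solution A h x.
Proof.
move=> xA.
have nd n m : (n <= m)%N -> conv K (iterate A h n) x <= conv K (iterate A h m) x.
  move=> nm; apply: le_conv => //.
  - exact: measurable_iterate.
  - exact: measurable_iterate.
  - exact: iterate_ge0.
  - by move=> y; exact: iterate_nondecreasing.
have le1 : conv K (solution A h) x <= limn (fun n => conv K (iterate A h n) x).
  rewrite /conv -monotone_convergence//; last 3 first.
  - by move=> n; apply: measurable_convK => //; exact: measurable_iterate.
  - by move=> n y _; rewrite mule_ge0// iterate_ge0.
  - move=> y _ i j ij; apply: lee_wpmul2l => //; exact: iterate_nondecreasing.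
  apply: ge0_le_integral => //.
  - by move=> y _; rewrite mule_ge0// solution_ge0.
  - by apply: measurable_convK => //; exact: measurable_solution.
  - apply: (emeasurable_fun_cvg (fun n (y : E) => K (x - y)%R * iterate A h n y)).
      by move=> n; apply: measurable_convK => //; exact: measurable_iterate.
    move=> y _; apply: ereal_nondecreasing_is_cvgn => i j ij.
    by apply: lee_wpmul2l => //; exact: iterate_nondecreasing.
  - move=> y _; apply: mule_lim_le => //; last exact: iterate_nondecreasing.
    by move=> n; exact: iterate_ge0.
have bound n : conv K (iterate A h n) x + h x <= (kr + c)%:E * solution A h x.
  apply: le_trans (lee_wpmul2l _ (iterate_le_solution n.+1 x)); last by rewrite lee_fin ltW.
  rewrite /iterate /= /step mule_ind mem_set// muleA -EFinM divff ?mul1e//.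
  by rewrite gt_eqF.
(* An infinite datum cannot be moved to the other side, but then [bound 0] already has an infinite
   left side. *)
have [hoo|hfin] := eqVneq (h x) +oo.
  apply: le_trans (bound 0%N); rewrite hoo addey; last first.
    by rewrite gt_eqF// (lt_le_trans _ (conv_ge0 _ _ _))// => y; exact: solution_ge0.
  by rewrite addey// gt_eqF// (lt_le_trans _ (conv_ge0 _ _ _))// => y; exact: iterate_ge0.
have hf : h x \is a fin_num by rewrite ge0_fin_numE// lt_neqAle hfin leey.
rewrite -leeBrDr//; apply: le_trans le1 _; apply: lime_le.
  by apply: ereal_nondecreasing_is_cvgn => i j; exact: nd.
by near=> n; rewrite leeBrDr.
Unshelve. all: by end_near. Qed.

End iteration.

(** * Integrable solutions are limits of the Picard iterates *)

Section uniqueness.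
Context (R : realType) (N : nat).
Local Notation E := 'rV[R]_N.
Local Notation leb := (@lebesgue_rV R N).
Local Open Scope ereal_scope.
Hypothesis N_gt0 : (0 < N)%N.
Variables (K : E -> \bar R) (kr c r : R) (A : set E) (h : E -> \bar R).
Hypotheses (K_ge0 : forall x, 0 <= K x) (K_radial : radially_nonincreasing K).
Hypotheses (K_int : \int[leb]_x K x = kr%:E) (kr_gt0 : (0 < kr)%R) (c_ge0 : (0 <= c)%R).
Hypotheses (mA : measurable A) (A_ball : A `<=` eball r).
Hypotheses (mh : measurable_fun setT h) (h0 : forall x, 0 <= h x).

Let kc0 : (0 < kr + c)%R. Proof. by rewrite ltr_wpDr. Qed.

Lemma ae_le_conv f g x : measurable_fun setT f -> measurable_fun setT g ->
  (forall y, 0 <= f y) -> (forall y, 0 <= g y) -> {ae leb, forall y, f y <= g y} ->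
  conv K f x <= conv K g x.
Proof.
move=> mf mg f0 g0 fg; apply: ae_ge0_le_integral => //.
- by move=> y _; rewrite mule_ge0.
- exact: measurable_convK.
- by move=> y _; rewrite mule_ge0.
- exact: measurable_convK.
- by apply: filterS fg => y fgy _; rewrite lee_wpmul2l.
Qed.

(** The equation is split into positive and negative parts of [w], with each term on the side where
    it is non-negative, so that it is meaningful in [\bar R] whatever the values of the convolutions
    and of [h]. *)
Lemma solution_unique (w : E -> R) : measurable_fun setT w ->
  \int[leb]_x `|w x|%:E < +oo -> (forall x, ~ A x -> w x = 0%R) ->
  {ae leb, forall x, A x ->
    (kr + c)%:E * (EFin \o w)^\+ x + conv K (EFin \o w)^\- x =
    (kr + c)%:E * (EFin \o w)^\- x + conv K (EFin \o w)^\+ x + h x} ->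
  {ae leb, forall x, (w x)%:E = solution K kr c A h x}.
Proof.
move=> mw wint wA eqw; set wp := (EFin \o w)^\+; set wm := (EFin \o w)^\-.
have mEw : measurable_fun setT (EFin \o w) by apply/measurable_EFinP.
have mwp : measurable_fun setT wp by exact: measurable_funepos.
have mwm : measurable_fun setT wm by exact: measurable_funeneg.
have wp0 x : 0 <= wp x by rewrite funepos_ge0.
have wm0 x : 0 <= wm x by rewrite funeneg_ge0.
have wpE x : wp x = (Num.max (w x) 0)%:E by rewrite /wp funeposE /= EFin_max.
have wmE x : wm x = (Num.max (- w x) 0)%:E by rewrite /wm funenegE /= EFin_max.
have wpA x : ~ A x -> wp x = 0 by move=> /wA wx; rewrite wpE wx maxxx.
have wmA x : ~ A x -> wm x = 0 by move=> /wA wx; rewrite wmE wx oppr0 maxxx.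
have le_abs (g : E -> \bar R) : measurable_fun setT g -> (forall x, 0 <= g x) ->
    (forall x, g x <= `|w x|%:E) -> \int[leb]_x g x < +oo.
  move=> mg g0 gw; apply: le_lt_trans wint; apply: ge0_le_integral => //.
  by apply/measurable_EFinP; exact: measurableT_comp.
have wmint : \int[leb]_x wm x < +oo.
  by apply: le_abs => // x; rewrite wmE lee_fin ge_max -normrN ler_norm normr_ge0.
have wpint : \int[leb]_x wp x < +oo.
  by apply: le_abs => // x; rewrite wpE lee_fin ge_max ler_norm normr_ge0.
(* Where [w] is negative, [wp] vanishes and the equation bounds [(kr + c)%:E * wm x] by
   [conv K wm x]; elsewhere [wm] vanishes. So [wm] is a subsolution. *)
have wm_eq0 : {ae leb, forall x, wm x = 0}.
  apply: (conv_subsolution_eq0 N_gt0 K_ge0 K_radial K_int kr_gt0 mA A_ball) => //.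
  apply: filterS eqw => x eqx xA.
  have [wx|wx] := leP 0%R (w x).
    by rewrite wmE max_r ?oppr_le0// mule0 conv_ge0.
  have := eqx xA; rewrite -/wp -/wm wpE max_r ?(ltW wx)// mule0 add0e => ->.
  rewrite -addeA; apply: le_trans (leeDl _ _); last by rewrite adde_ge0// conv_ge0.
  by apply: lee_wpmul2r => //; rewrite lee_fin lerDl.
have conv_wm0 x : conv K wm x = 0.
  apply/eqP; rewrite eq_le conv_ge0// andbT.
  apply: (@le_trans _ _ (conv K (cst 0) x)).
    by apply: ae_le_conv => //; apply: filterS wm_eq0 => y ->.
  by rewrite /conv integral0_eq// => y _; rewrite mule0.
have eqp : {ae leb, forall x, A x -> (kr + c)%:E * wp x = conv K wp x + h x}.
  apply: filterS2 eqw wm_eq0 => x eqx wmx xA; have := eqx xA.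
  by rewrite -/wp -/wm wmx conv_wm0 adde0 mule0 add0e.
(* [wp] is almost everywhere a fixed point of the monotone map [step], and the iteration starts
   below it. *)
have it_le n : {ae leb, forall x, iterate K kr c A h n x <= wp x}.
  elim: n => [|n IH]; first exact: aeW.
  apply: filterS eqp => x eqx; have [xA|xA] := pselect (A x); last first.
    by rewrite iterate_outside.
  rewrite /iterate /= /step mule_ind mem_set//.
  have -> : wp x = (kr + c)^-1%:E * (conv K wp x + h x).
    by rewrite -eqx// muleA -EFinM mulVf ?mul1e// gt_eqF.
  apply: lee_wpmul2l; first by rewrite lee_fin invr_ge0 ltW.
  rewrite leeD2r//; apply: ae_le_conv => //.
  - exact: measurable_iterate.
  - by move=> y; exact: iterate_ge0.
have sol_le : {ae leb, forall x, solution K kr c A h x <= wp x}.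
  apply: filterS (ae_foralln it_le) => x itx; apply: lime_le.
    by apply: ereal_nondecreasing_is_cvgn; exact: iterate_nondecreasing.
  by near=> n.
set s := solution K kr c A h in sol_le *.
have ms : measurable_fun setT s by exact: measurable_solution.
have s0 x : 0 <= s x by exact: solution_ge0.
pose f x := maxe (wp x - s x) 0.
have mf : measurable_fun setT f by apply: measurable_maxe => //; exact: emeasurable_funB.
have f0 x : 0 <= f x by rewrite /f le_max lexx orbT.
have f_le x : f x <= wp x by rewrite /f ge_max wp0 andbT -[leRHS]sube0 leeB.
have fs : {ae leb, forall x, wp x = f x + s x}.
  apply: filterS sol_le => x sx; rewrite /f max_l ?sube_ge0//; last first.
    by rewrite wpE orbT.
  by rewrite subeK// ge0_fin_numE// (le_lt_trans sx)// wpE ltry.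
have fA x : ~ A x -> f x = 0.
  by move=> xA; apply/eqP; rewrite eq_le f0 andbT -(wpA x xA).
have conv_fs x : conv K wp x <= conv K f x + conv K s x.
  rewrite /conv -ge0_integralD//; last 4 first.
  - by move=> y _; rewrite mule_ge0.
  - exact: measurable_convK.
  - by move=> y _; rewrite mule_ge0.
  - exact: measurable_convK.
  apply: (@le_trans _ _ (conv K (fun y => f y + s y) x)); last first.
    by rewrite le_eqVlt; apply/orP; left; apply/eqP; apply: eq_integral => y _; exact: ge0_muleDr.
  apply: ae_le_conv => //; first exact: emeasurable_funD.
  - by move=> y; rewrite adde_ge0.
  - by apply: filterS fs => y ->.
have f_eq0 : {ae leb, forall x, f x = 0}.
  apply: (conv_subsolution_eq0 N_gt0 K_ge0 K_radial K_int kr_gt0 mA A_ball) => //.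
    by apply: le_lt_trans wpint; exact: ge0_le_integral.
  apply: filterS3 eqp fs sol_le => x eqx fsx sx xA.
  have sfin : (kr + c)%:E * s x \is a fin_num.
    by rewrite fin_numM// ge0_fin_numE// (le_lt_trans sx)// wpE ltry.
  apply: (@le_trans _ _ ((kr + c)%:E * f x)).
    by rewrite lee_wpmul2r// lee_fin lerDl.
  rewrite -(leeD2rE _ _ sfin) -ge0_muleDr// -fsx eqx//.
  apply: (@le_trans _ _ (conv K f x + conv K s x + h x)); first by rewrite leeD2r.
  rewrite -addeA leeD2l//; exact: (@solution_super _ _ K kr c).
apply: filterS3 f_eq0 fs wm_eq0 => x fx0 + wmx; rewrite fx0 add0e => <-.
have : (- w x)%:E <= wm x by rewrite wmE lee_fin le_max lexx.
rewrite wmx lee_fin => wx.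
by rewrite wpE max_l// -oppr_le0.
Unshelve. all: by end_near. Qed.

End uniqueness.

Section comparison.
Context (R : realType) (N : nat).
Local Notation E := 'rV[R]_N.
Local Notation leb := (@lebesgue_rV R N).
Local Open Scope ereal_scope.
Hypothesis N_gt0 : (0 < N)%N.

Lemma tail_mono t (f g : E -> \bar R) x : f x <= g x -> tail t f x <= tail t g x.
Proof. by move=> fg; rewrite /tail ge_max le_max leeB//= le_max lexx orbT. Qed.

Variables (K : E -> \bar R) (kr c r : R) (A : set E) (F : E -> R).
Hypotheses (K_ge0 : forall x, 0 <= K x) (K_radial : radially_nonincreasing K).
Hypotheses (kr_gt0 : (0 < kr)%R) (c_ge0 : (0 <= c)%R).
Hypotheses (mA : measurable A) (A_ball : A `<=` eball r).
Hypotheses (mF : measurable_fun setT F) (F0 : forall x, (0 <= F x)%R).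
Hypothesis F_out : forall x, ~ A x -> F x = 0%R.

Local Notation As := (symm_set A).
Local Notation h := (EFin \o F).
Local Notation hs := (schwarz F).

Let kc0 : (0 < kr + c)%R. Proof. by rewrite ltr_wpDr. Qed.

Let q0 : 0 <= (kr + c)^-1%:E.
Proof. by rewrite lee_fin invr_ge0 ltW. Qed.

Let F_ball x : ~ eball r x -> F x = 0%R.
Proof. by move=> xr; apply: F_out => /A_ball. Qed.

Let h0 x : 0 <= h x. Proof. by rewrite lee_fin. Qed.
Let mh : measurable_fun setT h. Proof. exact/measurable_EFinP. Qed.
Let hs0 x : 0 <= hs x. Proof. exact: schwarz_ge0. Qed.
Let hsr : radially_nonincreasing hs. Proof. exact: (radial_schwarz N_gt0 mF F_ball). Qed.
Let mhs : measurable_fun setT hs. Proof. exact: measurable_radial. Qed.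
Let mAs : measurable As. Proof. exact: measurable_symm_set. Qed.

Lemma lebesgue_bounded_lty : leb A < +oo.
Proof.
apply: le_lt_trans (lebesgue_eball_lty N r); apply: le_measure; rewrite ?inE//.
exact: measurable_eball.
Qed.

Lemma radial_iterate n : radially_nonincreasing (iterate K kr c As hs n).
Proof.
elim: n => [|n IH]; first exact: radialP.
apply: radialP => x y xy; rewrite /iterate /= /step !mule_ind.
case: ifPn => [/set_mem xA|_]; last first.
  by case: ifPn => // _; rewrite mule_ge0// adde_ge0// conv_ge0// => z; exact: iterate_ge0.
rewrite mem_set; last exact: le_lt_trans xA.
apply: lee_wpmul2l => //; apply: leeD; last exact: radial_le.
by apply: radial_le xy; apply: radial_conv => // z; exact: iterate_ge0.
Qed.

Lemma radial_solution : radially_nonincreasing (solution K kr c As hs).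
Proof.
apply: radialP => x y xy; apply: lee_lim.
- by apply: ereal_nondecreasing_is_cvgn; exact: iterate_nondecreasing.
- by apply: ereal_nondecreasing_is_cvgn; exact: iterate_nondecreasing.
by near=> n; apply: radial_le xy; exact: radial_iterate.
Unshelve. all: by end_near. Qed.

Hypothesis u_int : \int[leb]_x solution K kr c As hs x < +oo.

(** Only the part [B'] of a test set inside [A] contributes to the iterate on [A]. Its ball lies in
    both [symm_set B] and [symm_set A], so the cut-off of the symmetrized iterate is invisible
    there, and [conv_mass_le] and [schwarz_mass_le] handle the two summands. The integrability
    assumption [u_int] passes to the iterates, as [conv_mass_le] requires. *)
Lemma iterate_tail_integral_le n :
  tail_integral_le (iterate K kr c A h n) (iterate K kr c As hs n).
Proof.
have Aoo := lebesgue_bounded_lty.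
elim: n => [|n IH]; first by move=> t t0.
set v := iterate K kr c A h n in IH; set u := iterate K kr c As hs n in IH.
have mv : measurable_fun setT v by exact: measurable_iterate.
have mu : measurable_fun setT u by exact: measurable_iterate.
have mu1 : measurable_fun setT (iterate K kr c As hs n.+1) by exact: measurable_iterate.
have v0 x : 0 <= v x by exact: iterate_ge0.
have u0 x : 0 <= u x by exact: iterate_ge0.
have mcv : measurable_fun setT (conv K v) by exact: measurable_conv.
have mcu : measurable_fun setT (conv K u) by exact: measurable_conv.
have mi (B : set E) : measurable B -> measurable_fun setT (ind B) by exact: measurable_ind.
have i0 (B : set E) x : 0 <= ind B x by exact: ind_ge0.
apply: tail_integral_le_of_mass_le => //.
- exact: measurable_iterate.
- by move=> x; exact: iterate_ge0.
- by move=> x; exact: iterate_ge0.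
- apply: le_lt_trans Aoo; apply: le_measure; rewrite ?inE//.
    by apply: measurable_superlevel; exact: measurable_iterate.
  move=> x /= vx; apply: contrapT => xA.
  by move: vx; rewrite /step mule_ind memNset ?ltxx.
move=> B mB Boo; set B' := B `&` A.
have mB' : measurable B' by exact: measurableI.
have B'B : leb B' <= leb B by apply: le_measure; rewrite ?inE//; exact: subIsetl.
have B'A : leb B' <= leb A by apply: le_measure; rewrite ?inE//; exact: subIsetr.
have mBs' := @measurable_symm_set R N B'.
have split_ind (f g : E -> \bar R) (D : set E) : measurable D -> measurable_fun setT f ->
    measurable_fun setT g -> (forall x, 0 <= f x) -> (forall x, 0 <= g x) ->
    \int[leb]_x ((kr + c)^-1%:E * (f x + g x) * ind D x) =
    (kr + c)^-1%:E * (\int[leb]_x (f x * ind D x) + \int[leb]_x (g x * ind D x)).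
  move=> mD mf mg f0 g0.
  rewrite -ge0_integralD//; last 4 first.
  - by move=> x _; rewrite mule_ge0.
  - by apply: emeasurable_funM => //; exact: mi.
  - by move=> x _; rewrite mule_ge0.
  - by apply: emeasurable_funM => //; exact: mi.
  rewrite -ge0_integralZl//; last 2 first.
  - by apply: emeasurable_funD; apply: emeasurable_funM => //; exact: mi.
  - by move=> x _; rewrite adde_ge0// mule_ge0.
  by apply: eq_integral => x _; rewrite -ge0_muleDl// muleA.
have -> : \int[leb]_x (iterate K kr c A h n.+1 x * ind B x) =
    \int[leb]_x ((kr + c)^-1%:E * (conv K v x + h x) * ind B' x).
  apply: eq_integral => x _; rewrite /iterate /= /step -muleA; congr (_ * _).
  by rewrite /B' setIC /ind -EFinM indicI.
apply: (@le_trans _ _ (\int[leb]_x ((kr + c)^-1%:E * (conv K u x + hs x) *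
    ind (symm_set B') x))).
  rewrite !split_ind//; last 2 first.
  - by move=> x; exact: conv_ge0.
  - by move=> x; exact: conv_ge0.
  apply: lee_wpmul2l => //; apply: leeD.
    apply: (@conv_mass_le _ _ N_gt0 K v u r) => //.
    - by move=> x xr; apply: iterate_outside => /A_ball.
    - exact: radial_iterate.
    - apply: le_lt_trans u_int; apply: ge0_le_integral => //.
        exact: measurable_solution.
      by move=> x _; exact: iterate_le_solution.
    - by move=> x [_ /A_ball].
  apply: (schwarz_mass_le N_gt0 mF F_ball) => //.
  exact: le_lt_trans Aoo.
apply: ge0_le_integral => //.
- by move=> x _; rewrite !mule_ge0// adde_ge0// conv_ge0.
- apply: emeasurable_funM; last exact: mi.
  by apply: measurable_funeM; exact: emeasurable_funD.
- by apply: emeasurable_funM; [exact: mu1|apply: mi; exact: measurable_symm_set].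
move=> x _; rewrite mule_ind; case: ifPn => [/set_mem xB'|_]; last first.
  by rewrite mule_ge0// iterate_ge0.
rewrite !mule_ind /iterate /= /step mule_ind !mem_set//.
- exact: subset_symm_set xB'.
- exact: subset_symm_set xB'.
Qed.

(** Monotone convergence of the tails serves the left side; on the right every iterate is below its
    limit. *)
Lemma solution_tail_integral_le :
  tail_integral_le (solution K kr c A h) (solution K kr c As hs).
Proof.
move=> t t0; set v := iterate K kr c A h.
have nd x : nondecreasing_seq (fun n => tail t (v n) x).
  by move=> i j ij; apply: tail_mono; exact: iterate_nondecreasing.
have mt n : measurable_fun setT (tail t (v n)).
  by apply: measurable_tail; exact: measurable_iterate.
apply: (@le_trans _ _ (\int[leb]_x limn (fun n => tail t (v n) x))).
  apply: ge0_le_integral => //.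
  - by move=> x _; exact: tail_ge0.
  - by apply: measurable_tail; exact: measurable_solution.
  - apply: (emeasurable_fun_cvg (fun n => tail t (v n))) => //.
    by move=> x _; apply: ereal_nondecreasing_is_cvgn; exact: nd.
  move=> x _; have cv : cvgn (fun n => tail t (v n) x).
    by apply: ereal_nondecreasing_is_cvgn; exact: nd.
  rewrite {1}/tail ge_max; apply/andP; split; last first.
    by apply: lime_ge => //; near=> n; exact: tail_ge0.
  rewrite leeBlDr//; apply: lime_le.
    by apply: ereal_nondecreasing_is_cvgn; exact: iterate_nondecreasing.
  near=> n; apply: le_trans (le_tailD t (v n) x) _; rewrite leeD2r//.
  by apply: lime_ge => //; exists n => // m /= nm; exact: nd.
rewrite monotone_convergence//; last by move=> n x _; exact: tail_ge0.
apply: lime_le.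
  apply: ereal_nondecreasing_is_cvgn => i j ij; apply: ge0_le_integral => //.
  - by move=> x _; exact: tail_ge0.
  - by move=> x _; exact: nd.
near=> n; apply: le_trans (iterate_tail_integral_le n t0) _.
apply: ge0_le_integral => //.
- by move=> x _; exact: tail_ge0.
- by apply: measurable_tail; exact: measurable_iterate.
- by apply: measurable_tail; exact: measurable_solution.
by move=> x _; apply: tail_mono; exact: iterate_le_solution.
Unshelve. all: by end_near. Qed.

End comparison.

(** * Comparison of norms *)

Section norm_comparison.
Context (R : realType) (N : nat).
Local Notation E := 'rV[R]_N.
Local Notation leb := (@lebesgue_rV R N).
Local Open Scope ereal_scope.

Lemma ge0_integral_scale (b : R) (f : E -> \bar R) : (0 < b)%R ->
  measurable_fun setT f -> (forall x, 0 <= f x) ->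
  \int[leb]_x f (b *: x)%R = (b ^- N)%:E * \int[leb]_x f x.
Proof.
move=> b0 mf f0; have bN : (0 <= b ^- N)%R by rewrite invr_ge0 exprn_ge0// ltW.
have mphi : measurable_fun setT (fun x : E => b *: x)%R by apply: measurable_scalerV.
have := @ge0_integral_pushforward _ _ _ _ _ _ mphi leb setT f measurableT mf (fun _ _ => f0 _).
rewrite preimage_setT => <-.
rewrite -(@ge0_integral_mscale _ _ _ leb setT measurableT (NngNum bN))//.
apply: eq_measure_integral => A mA _; rewrite /mscale /=.
rewrite -[RHS](_ : leb ((fun x : E => b *: x)%R @^-1` A) = _)//.
by rewrite lebesgue_rV_scale ?gt_eqF// gtr0_norm.
Qed.

Hypothesis N_gt0 : (0 < N)%N.

(* Scaling [z] by [a `^ ((p - 1) / N)] turns the integral into [a `^ p] times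
   its value at [a = 1]: the power function is a superposition of the
   functions [a |-> (a - t)^+]. *)
Lemma power_tail (p : R) : (1 < p)%R -> exists2 C : R, (0 < C)%R &
  forall a : \bar R, 0 <= a ->
  \int[leb]_z maxe (a - (enorm z `^ (N%:R / (p - 1)))%:E) 0 = C%:E * (a `^ p).
Proof.
move=> p1; set s := (N%:R / (p - 1))%R.
have N0 : (0 < N%:R :> R)%R by rewrite ltr0n.
have s0 : (0 < s)%R by rewrite divr_gt0// subr_gt0.
have ps1 : (1 `^ s = 1 :> R)%R by rewrite powR1.
have mg (a : \bar R) : measurable_fun setT (fun z : E => maxe (a - (enorm z `^ s)%:E) 0).
  apply: measurable_maxe => //; apply: emeasurable_funB => //; apply/measurable_EFinP.
  exact: (measurableT_comp (measurable_powR s) (@measurable_enorm _ _ R N id (@measurable_id _ _ _))).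
have g0 (a : \bar R) (z : E) : 0 <= maxe (a - (enorm z `^ s)%:E) 0 by rewrite le_max lexx orbT.
have [I IE] : exists I : \bar R -> \bar R, forall a,
    I a = \int[leb]_z maxe (a - (enorm z `^ s)%:E) 0
  by exists (fun a => \int[leb]_z maxe (a - (enorm z `^ s)%:E) 0).
have mi (D : set E) : measurable D -> measurable_fun setT (ind D) by exact: measurable_ind.
have I1oo : I 1 < +oo.
  apply: le_lt_trans (lebesgue_eball_lty N 2).
  rewrite IE -integral_ind; last exact: measurable_eball.
  apply: ge0_le_integral => //.
  - by apply: mi; exact: measurable_eball.
  move=> z _; rewrite ge_max ind_ge0 andbT -[ind _ _]mul1e mule_ind.
  case: ifPn => [_|z2].
    by rewrite -EFinB lee_fin gerBl powR_ge0.
  have z2' : (2 <= enorm z)%R.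
    by rewrite leNgt; apply: contra z2 => z2; exact/mem_set.
  rewrite -EFinB lee_fin subr_le0 -[leLHS]ps1 ge0_ler_powR ?nnegrE ?ler01 ?(ltW s0) ?enorm_ge0//.
  by apply: le_trans z2'; rewrite ler1n.
have I1gt : 0 < I 1.
  have h1 : (0 < 1 - (2^-1 : R) `^ s)%R.
    by rewrite subr_gt0 -[ltRHS]ps1 gt0_ltr_powR ?nnegrE ?invr_ge0 ?ler01// invf_lt1// ltr1n.
  apply: (@lt_le_trans _ _ ((1 - (2^-1 : R) `^ s)%:E * leb (eball 2^-1))).
    by rewrite mule_gt0// lebesgue_eball_gt0// invr_gt0.
  rewrite IE -integral_ind; last exact: measurable_eball.
  rewrite -ge0_integralZl//; last 3 first.
  - by apply: mi; exact: measurable_eball.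
  - by move=> z _; exact: ind_ge0.
  - by rewrite lee_fin ltW.
  apply: ge0_le_integral => //.
  - by move=> z _; rewrite mule_ge0 ?ind_ge0// lee_fin ltW.
  - by apply: measurable_funeM; by apply: mi; exact: measurable_eball.
  move=> z _; rewrite mule_ind; case: ifPn => [/set_mem zb|_] //.
  rewrite le_max -EFinB lee_fin lerB//.
  by rewrite ge0_ler_powR ?nnegrE ?enorm_ge0 ?(ltW s0) ?invr_ge0// ltW.
have I1E : I 1 = (fine (I 1%E))%:E by rewrite fineK// ge0_fin_numE// ltW.
exists (fine (I 1%E)); first by rewrite -lte_fin -I1E.
move=> a a0; rewrite -IE -I1E.
have p0 : (0 < p)%R by apply: lt_trans p1; rewrite ltr01.
case: a a0 => [a| |//]; last first.
  move=> _; rewrite poweRyr ?gt_eqF// gt0_muley//.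
  rewrite IE (eq_integral (cst +oo)); last first.
    by move=> z _; rewrite addye// max_l// leey.
  rewrite integral_cst// gt0_mulye// (lt_le_trans (@lebesgue_eball_gt0 R N 1 ltr01))//.
  by apply: le_measure; rewrite ?inE//; exact: measurable_eball.
rewrite lee_fin le_eqVlt => /predU1P[<-|a0].
  rewrite poweR0r ?gt_eqF// mule0 IE; apply: integral0_eq => z _.
  by rewrite max_r// -EFinB lee_fin sub0r oppr_le0 powR_ge0.
set b := (a `^ s^-1)%R.
have b0 : (0 < b)%R by rewrite powR_gt0.
have bs : (b `^ s = a)%R by rewrite /b -powRrM mulVf ?gt_eqF// powRr1// ltW.
have eqI : a%:E * I 1 = (b ^- N)%:E * I a%:E.
  rewrite !IE -(ge0_integral_scale b0 (mg a%:E) (g0 a%:E)).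
  rewrite -ge0_integralZl//; last by rewrite lee_fin ltW.
  apply: eq_integral => z _; rewrite enormZ (gtr0_norm b0) powRM ?enorm_ge0 ?(ltW b0)// bs.
  rewrite -!EFinB -!EFin_max -EFinM; congr EFin.
  by rewrite maxr_pMr ?(ltW a0)// mulr0 mulrBr mulr1.
have bN : (b ^+ N != 0)%R by rewrite expf_neq0// gt_eqF.
have -> : I a%:E = (b ^+ N * a)%:E * I 1.
  by rewrite EFinM -muleA eqI muleA -EFinM divff// mul1e.
rewrite muleC poweR_EFin; congr (_ * _%:E).
rewrite -powR_mulrn ?(ltW b0)// -powRrM -[X in (_ * X)%R](powRr1 (ltW a0)) -powRD.
  by congr powR; rewrite /s invf_div divfK ?gt_eqF//; ring.
by rewrite (gt_eqF a0) implybT.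
Qed.

(** For [p = +oo], the tail of [g] at its essential supremum is zero, hence so is that of [f]. For
    [p = 1] the tail at 0 is the function itself. For the exponents between, [power_tail] writes the
    integral of the power as an integral of tails over all heights. *)
Lemma Lnorm_le_of_tail (p : \bar R) (f g : E -> \bar R) : 1 <= p ->
  measurable_fun setT f -> measurable_fun setT g ->
  (forall x, 0 <= f x) -> (forall x, 0 <= g x) -> tail_integral_le f g ->
  'N[leb]_p[f]%E <= 'N[leb]_p[g]%E.
Proof.
move=> p1 mf mg f0 g0 fg; rewrite unlock.
case: p p1 => [p| |//]; last first.
  move=> _; case: ifPn => // _; set S := ess_sup_inf.ess_sup leb (abse \o g).
  have gS : {ae leb, forall x, `|g x| <= S} by exact: (ess_sup_inf.ess_sup_ge leb (abse \o g)).
  apply/ess_sup_inf.ess_supP; case: S gS => [t| |] gS.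
  - have [t0|t0] := leP 0%R t; last first.
      apply: filterS gS => x gx; have := le_trans (abse_ge0 _) gx.
      by rewrite lee_fin leNgt t0.
    have mt : measurable_fun setT (tail t f) by exact: measurable_tail.
    have : \int[leb]_x `|tail t f x| = 0.
      apply/eqP; rewrite eq_le integral_ge0// andbT.
      under eq_integral do rewrite gee0_abs ?tail_ge0//.
      apply: le_trans (fg t t0) _.
      rewrite (ae_eq_integral (cst 0))//.
      + by rewrite integral0.
      + exact: measurable_tail.
      apply: filterS gS => x gx _; rewrite /= tail_le//.
      by apply: le_trans gx; exact: lee_abs.
    move/(ae_eq_integral_abs _ measurableT mt).1.
    apply: filterS => x /(_ I) /= fx; rewrite gee0_abs//.
    by apply: le_trans (le_tailD t f x) _; rewrite fx add0e.
  - by apply: aeW => x; rewrite leey.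
  - by apply: filterS gS => x; rewrite leeNy_eq; case: (g x).
rewrite lee_fin => p1.
have p0 : (0 < p)%R by apply: lt_le_trans p1; rewrite ltr01.
apply: gt0_ler_poweR.
- by rewrite invr_ge0 ltW.
- by rewrite in_itv /= integral_ge0// => [|x _]; rewrite ?leey// poweR_ge0.
- by rewrite in_itv /= integral_ge0// => [|x _]; rewrite ?leey// poweR_ge0.
have mp (h : E -> \bar R) : measurable_fun setT h ->
    measurable_fun setT (fun x => `|h x| `^ p).
  by move=> mh; apply: (measurableT_comp (measurable_poweR p)); exact: measurableT_comp.
move: p1; rewrite le_eqVlt => /predU1P[p1|p1].
  have tail0 (h : E -> \bar R) : (forall x, 0 <= h x) ->
      \int[leb]_x (`|h x| `^ p) = \int[leb]_x tail 0 h x.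
    move=> h0; apply: eq_integral => x _.
    by rewrite -p1 poweRe1// gee0_abs// /tail sube0 max_l.
  by rewrite !tail0//; exact: fg.
have [C C0 CE] := power_tail p1.
set s := (N%:R / (p - 1))%R in CE.
have mt (h : E -> \bar R) : measurable_fun setT h ->
    measurable_fun setT (fun z : E * E => tail (enorm z.2 `^ s) h z.1).
  move=> mh; apply: measurable_maxe => //; apply: emeasurable_funB.
    exact: measurableT_comp.
  apply/measurable_EFinP.
  exact: (measurableT_comp (measurable_powR s) (@measurable_enorm _ _ R N snd measurable_snd)).
have intE (h : E -> \bar R) : measurable_fun setT h -> (forall x, 0 <= h x) ->
    C%:E * \int[leb]_x (`|h x| `^ p) =
    \int[leb]_z \int[leb]_x tail (enorm (z : E) `^ s) h x.
  move=> mh h0; rewrite -ge0_integralZl//; last 3 first.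
  - exact: mp.
  - by move=> x _; exact: poweR_ge0.
  - by rewrite lee_fin ltW.
  rewrite -(fubini_tonelli _ (mt h mh)); last by move=> z; exact: tail_ge0.
  by apply: eq_integral => x _; rewrite gee0_abs// -CE.
have Cf : C%:E \is a fin_num by [].
have Cp : 0 < C%:E by rewrite lte_fin.
rewrite -(lee_pmul2l Cf Cp) (intE f mf f0) (intE g mg g0).
apply: ge0_le_integral => //.
- by move=> z _; apply: integral_ge0 => x _; exact: tail_ge0.
- by apply: (measurable_fun_fubini_tonelli_G _ (mt f mf)) => z; exact: tail_ge0.
- by apply: (measurable_fun_fubini_tonelli_G _ (mt g mg)) => z; exact: tail_ge0.
- by move=> z _; apply: fg; exact: powR_ge0.
Qed.

End norm_comparison.

Section lp_facts.
Context (R : realType) (N : nat).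
Local Notation E := 'rV[R]_N.
Local Notation leb := (@lebesgue_rV R N).
Local Open Scope ereal_scope.

Lemma Lp_measurable (A : set E) (p : \bar R) (f : E -> R) : Lp A p f ->
  measurable_fun setT (f \_ A) /\ Lp_norm A p f < +oo.
Proof.
move=> Af; have mf := sub_Lfun_mfun Af; have ff := sub_Lfun_finLfun Af.
by split; [exact: set_mem mf|exact: set_mem ff].
Qed.

Lemma ae_eq_Lnorm (p : \bar R) (f g : E -> \bar R) : 1 <= p ->
  measurable_fun setT f -> measurable_fun setT g -> {ae leb, forall x, f x = g x} ->
  ('N[leb]_p[f] = 'N[leb]_p[g])%E.
Proof.
move=> p1 mf mg fg; rewrite unlock; case: p p1 => [p p1| _|//].
- congr poweR; apply: ae_eq_integral => //.
  + by apply: (measurableT_comp (measurable_poweR p)); exact: measurableT_comp.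
  + by apply: (measurableT_comp (measurable_poweR p)); exact: measurableT_comp.
  + by apply: filterS fg => x ->.
- case: ifPn => // _; apply: ess_sup_inf.eq_ess_sup.
  by apply: filterS fg => x /= ->.
Qed.

(** For finite [p], the pointwise bound of [|w|] by the indicator of [A] plus the power of [|w|]
    replaces Hoelder's inequality. *)
Lemma Lnorm_bounded_integral (p : \bar R) (A : set E) (w : E -> R) : 1 <= p ->
  measurable A -> leb A < +oo -> measurable_fun setT w -> (forall x, ~ A x -> w x = 0%R) ->
  ('N[leb]_p[EFin \o w])%E < +oo -> \int[leb]_x `|w x|%:E < +oo.
Proof.
move=> p1 mA Aoo mw wA; rewrite unlock.
have mi : measurable_fun setT (ind A) by exact: measurable_ind.
have mw1 : measurable_fun setT (fun x => `|w x|%:E).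
  by apply/measurable_EFinP; exact: measurableT_comp.
case: p p1 => [p p1| _|//]; last first.
  have [A0|A0] := eqVneq (leb A) 0.
    move=> _; rewrite (ae_eq_integral (cst 0))//; first by rewrite integral0.
    by exists A; split => // x /= h; apply: contrapT => /wA wx; apply: h => _; rewrite wx normr0.
  rewrite (lt_le_trans (y := leb A)) ?lt0e ?A0 ?measure_ge0//; last by apply: le_measure; rewrite ?inE.
  set S := ess_sup_inf.ess_sup _ _ => Soo.
  have wS : {ae leb, forall x, `|(w x)%:E| <= S}.
    exact: (ess_sup_inf.ess_sup_ge leb (abse \o (EFin \o w))).
  pose S' := Num.max (fine S) 0%R.
  have S'0 : 0 <= S'%:E by rewrite lee_fin le_max lexx orbT.
  apply: (@le_lt_trans _ _ (\int[leb]_x (S'%:E * ind A x))); last first.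
    by rewrite integral_mul_indic// lte_mul_pinfty.
  apply: ae_ge0_le_integral => //.
  - by move=> x _; rewrite mule_ge0 ?ind_ge0.
  - exact: measurable_funeM.
  apply: filterS wS => x wx _; rewrite mule_ind; case: ifPn => [_|xA]; last first.
    by rewrite wA ?normr0// => /mem_set; apply/negP.
  move: wx Soo; rewrite /S' abse_EFin; case: (S) => [s| |]//.
  by rewrite !lee_fin => ws _ /=; rewrite le_max ws.
rewrite lee_fin in p1; have p0 : (0 < p)%R by apply: lt_le_trans p1; rewrite ltr01.
move=> /lty_poweRy; rewrite gt_eqF ?invr_gt0// => /(_ isT) wpoo.
have mp : measurable_fun setT (fun x => `|(EFin \o w) x| `^ p).
  apply: (measurableT_comp (measurable_poweR p)); apply: measurableT_comp => //.
  exact/measurable_EFinP.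
apply: (@le_lt_trans _ _ (\int[leb]_x (ind A x + `|(EFin \o w) x| `^ p))).
  apply: ge0_le_integral => //.
  - exact: emeasurable_funD.
  move=> x _; have [xA|xA] := pselect (A x); last first.
    by rewrite wA// normr0 adde_ge0 ?ind_ge0 ?poweR_ge0.
  rewrite /ind indicE mem_set// abse_EFin poweR_EFin -EFinD lee_fin.
  have [w1|w1] := leP `|w x|%R 1%R.
    by apply: le_trans w1 _; rewrite lerDl powR_ge0.
  apply: (@le_trans _ _ (`|w x| `^ p)%R); last by rewrite lerDr.
  by rewrite -[leLHS]powRr1// ler_powR// ltW.
rewrite ge0_integralD//; last 2 first.
- by move=> x _; exact: ind_ge0.
- by move=> x _; exact: poweR_ge0.
by rewrite integral_ind// lte_add_pinfty.
Qed.

End lp_facts.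

(** * The stationary nonlocal problem *)

Section kernel.
Context (R : realType) (N : nat).
Local Notation E := 'rV[R]_N.
Local Notation leb := (@lebesgue_rV R N).
Local Open Scope ereal_scope.

Lemma ae_preimage (phi : E -> E) (P : E -> Prop) : measurable_fun setT phi ->
  (forall A, measurable A -> leb A = 0 -> leb (phi @^-1` A) = 0) ->
  {ae leb, forall x, P x} -> {ae leb, forall x, P (phi x)}.
Proof.
move=> mphi phi0 [B [mB B0 PB]]; exists (phi @^-1` B); split => //.
- exact: measurable_preimageT.
- exact: phi0.
- by move=> x /= Px; apply: PB.
Qed.

Lemma measurable_rescaled (J : E -> R) (eps : R) : measurable_fun setT J ->
  measurable_fun setT (rescaled J eps).
Proof.
move=> mJ; apply: measurable_funM => //; apply: (measurableT_comp mJ).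
by apply: measurable_scalerV.
Qed.

(** [K] is an everywhere radial and non-negative representative of the kernel: the radial
    representative of [J] may be negative on a null set, hence the maximum with 0. *)
Lemma rescaled_kernel (J : E -> R) (eps : R) : (0 < N)%N -> (0 < eps)%R ->
  (forall x, 0 <= J x)%R -> ae_radially_nonincreasing J -> measurable_fun setT J ->
  Lp_norm setT 1 J = 1 -> second_moment J < +oo ->
  exists (K : E -> \bar R) (kr : R), [/\ forall x, 0 <= K x, radially_nonincreasing K,
    \int[leb]_x K x = kr%:E, (0 < kr)%R &
    {ae leb, forall x, (rescaled J eps x)%:E = K x}].
Proof.
move=> N0 e0 J0 [g gr Jg] mJ J1 J2.
have intJ : \int[leb]_x (J x)%:E = 1.
  rewrite -J1 /Lp_norm patch_setT Lnorm1; apply: eq_integral => x _.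
  by rewrite /= ger0_norm.
have mJ2 : measurable_fun setT (fun x => (enorm x ^+ 2 * J x)%:E).
  apply/measurable_EFinP; apply: measurable_funM => //; apply: measurable_funX.
  exact: (@measurable_enorm _ _ R N id (@measurable_id _ _ _)).
have J20 (x : E) : 0 <= (enorm x ^+ 2 * J x)%:E by rewrite lee_fin mulr_ge0// sqr_ge0.
(* Otherwise [J] would vanish almost everywhere off the origin, against its norm 1. The factor
   [2 / fine (second_moment J)] is thereby positive. *)
have J2gt : 0 < second_moment J.
  rewrite lt0e integral_ge0 ?andbT//; apply/eqP => J2z.
  have : \int[leb]_x `|(enorm x ^+ 2 * J x)%:E| = 0.
    by rewrite -J2z; apply: eq_integral => x _; rewrite gee0_abs.
  move/(ae_eq_integral_abs _ measurableT mJ2).1 => Jae.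
  have : \int[leb]_x (J x)%:E = 0.
    rewrite (ae_eq_integral (cst 0))//; first by rewrite integral0.
      exact/measurable_EFinP.
    have x0 : {ae leb, forall x : E, x != 0%R}.
      exists [set 0%R]; split; first exact: measurable_singleton0.
        exact: lebesgue_set1.
      by move=> x /= /negP; rewrite negbK => /eqP.
    apply: filterS2 Jae x0 => x /(_ I) Jx xn0 _ /=; apply/eqP; move: Jx => /eqP.
    by rewrite /= !eqe mulf_eq0 expf_eq0/= enorm_eq0 (negbTE xn0).
  by rewrite intJ => /eqP; rewrite eqe oner_eq0.
pose C := (2 / fine (second_moment J) / eps ^+ (N + 2))%R.
have C0 : (0 < C)%R.
  rewrite /C !divr_gt0 ?exprn_gt0//; apply: fine_gt0.
  by rewrite J2gt.
have ei0 : (0 < eps^-1)%R by rewrite invr_gt0.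
pose g0 (x : E) : \bar R := maxe (g x) 0.
have g00 x : 0 <= g0 x by rewrite /g0 le_max lexx orbT.
have g0r : radially_nonincreasing g0.
  by apply: radialP => x y xy; rewrite /g0 ge_max !le_max lexx orbT andbT (radial_le gr).
have Jg0 : {ae leb, forall x, (J x)%:E = g0 x}.
  by apply: filterS Jg => x; rewrite /g0 => <-; rewrite max_l// lee_fin.
have mg0 := measurable_radial g0r.
have intg0 : \int[leb]_x g0 x = 1.
  rewrite -intJ; apply: ae_eq_integral => //; first exact/measurable_EFinP.
  by apply: filterS Jg0 => x -> _.
exists (fun x => C%:E * g0 (eps^-1 *: x)%R), (C * (eps^-1) ^- N)%R; split.
- by move=> x; rewrite mule_ge0// lee_fin ltW.
- apply: radialP => x y xy; apply: lee_wpmul2l; first by rewrite lee_fin ltW.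
  by apply: radial_le => //; rewrite !enormZ ler_wpM2l.
- rewrite ge0_integralZl//; last 2 first.
  + by apply: (measurableT_comp mg0); apply: measurable_scalerV.
  + by rewrite lee_fin ltW.
  by rewrite ge0_integral_scale// intg0 mule1.
- by rewrite mulr_gt0// invr_gt0 exprn_gt0.
have : {ae leb, forall x, (J (eps^-1 *: x)%R)%:E = g0 (eps^-1 *: x)%R}.
  apply: (@ae_preimage (fun x => eps^-1 *: x)%R (fun x => (J x)%:E = g0 x)) => //.
    by apply: measurable_scalerV.
  by move=> A mA A0; rewrite lebesgue_rV_scale ?gt_eqF// A0 mule0.
by apply: filterS => x <-; rewrite /rescaled EFinM.
Qed.

End kernel.

Section stationary_problem.
Context (R : realType) (N : nat).
Local Notation E := 'rV[R]_N.
Local Notation leb := (@lebesgue_rV R N).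
Local Open Scope ereal_scope.
Variables (K : E -> \bar R) (kr eps : R) (J : E -> R).
Hypotheses (K_ge0 : forall x, 0 <= K x) (K_radial : radially_nonincreasing K).
Hypotheses (K_int : \int[leb]_x K x = kr%:E) (kr_gt0 : (0 < kr)%R).
Hypotheses (mJ : measurable_fun setT J).
Hypothesis (JK : {ae leb, forall x, (rescaled J eps x)%:E = K x}).

Let mk x : measurable_fun setT (fun y : E => rescaled J eps (x - y)).
Proof.
by apply: (measurableT_comp (measurable_rescaled eps mJ)); apply: measurable_subrV.
Qed.

Let kK x : {ae leb, forall y : E, (rescaled J eps (x - y)%R)%:E = K (x - y)%R}.
Proof.
apply: (@ae_preimage _ _ (fun y => x - y)%R (fun z => (rescaled J eps z)%:E = K z)) => //.
  by apply: measurable_subrV.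
by move=> A mA A0; rewrite lebesgue_rV_subl.
Qed.

(** Meant for [q] the positive part of [w] and [b] that of [- w x], and for the converse choice:
    [w y - w x] is the difference of the two sums [q y + b]. Both are non-negative, and their
    integrability justifies splitting the integral. *)
Lemma integral_rescaled x (q : E -> \bar R) (b : R) : measurable_fun setT q ->
  (forall y, 0 <= q y) -> (forall y, q y \is a fin_num) -> (0 <= b)%R ->
  conv K q x < +oo ->
  leb.-integrable setT (fun y => (rescaled J eps (x - y) * (fine (q y) + b))%:E) /\
  \int[leb]_y (rescaled J eps (x - y) * (fine (q y) + b))%:E = conv K q x + (kr * b)%:E.
Proof.
move=> mq q0 qfin b0 qoo.
have mf : measurable_fun setT (fun y : E => (rescaled J eps (x - y) * (fine (q y) + b))%:E).
  apply/measurable_EFinP; apply: measurable_funM => //; apply: measurable_funD => //.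
  exact: measurableT_comp.
have mg : measurable_fun setT (fun y : E => K (x - y)%R * (q y + b%:E)).
  by apply: measurable_convK => //; exact: emeasurable_funD.
have fg : {ae leb, forall y : E,
    (rescaled J eps (x - y) * (fine (q y) + b))%:E = K (x - y)%R * (q y + b%:E)}.
  by apply: filterS (kK x) => y <-; rewrite EFinM EFinD fineK.
have intg : \int[leb]_y (K (x - y)%R * (q y + b%:E)) = conv K q x + (kr * b)%:E.
  transitivity (\int[leb]_y (K (x - y)%R * q y + b%:E * (K (x - y)%R * 1))).
    apply: eq_integral => y _; rewrite ge0_muleDr//.
    by rewrite mule1 (muleC b%:E).
  have mK1 : measurable_fun setT (fun y : E => K (x - y)%R * 1).
    by apply: (@measurable_convK _ _ K K_radial x (cst 1)).
  rewrite ge0_integralD//; last 4 first.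
  - by move=> y _; rewrite mule_ge0.
  - exact: measurable_convK.
  - by move=> y _; rewrite !mule_ge0.
  - exact: measurable_funeM.
  congr (_ + _); rewrite ge0_integralZl//; last by move=> y _; rewrite mule_ge0.
  by rewrite -[X in _ * X]/(conv K (cst 1) x) conv1// K_int muleC -EFinM.
have g0 (y : E) : 0 <= K (x - y)%R * (q y + b%:E).
  by rewrite mule_ge0// adde_ge0.
split.
  apply/integrableP; split => //.
  rewrite (ae_eq_integral (fun y : E => K (x - y)%R * (q y + b%:E)))//.
  - by rewrite intg lte_add_pinfty// ltry.
  - exact: measurableT_comp.
  - by apply: filterS fg => y -> _; rewrite gee0_abs.
rewrite -intg; apply: ae_eq_integral => //.
by apply: filterS fg => y -> _.
Qed.

Lemma integral_rescaled_diff x (w w' : E -> R) : measurable_fun setT w ->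
  measurable_fun setT w' -> {ae leb, forall y, w y = w' y} ->
  conv K (EFin \o w')^\+ x < +oo -> conv K (EFin \o w')^\- x < +oo ->
  \int[leb]_y (rescaled J eps (x - y) * (w y - w' x))%:E =
  (conv K (EFin \o w')^\+ x + kr%:E * (EFin \o w')^\- x) -
  (conv K (EFin \o w')^\- x + kr%:E * (EFin \o w')^\+ x).
Proof.
move=> mw mw' ww' poo noo.
have mEw : measurable_fun setT (EFin \o w') by apply/measurable_EFinP.
have pE y : (EFin \o w')^\+ y = (Num.max (w' y) 0)%:E by rewrite funeposE /= EFin_max.
have nE y : (EFin \o w')^\- y = (Num.max (- w' y) 0)%:E by rewrite funenegE /= EFin_max.
have p0 y : 0 <= (EFin \o w')^\+ y by rewrite funepos_ge0.
have n0 y : 0 <= (EFin \o w')^\- y by rewrite funeneg_ge0.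
have b0 a : (0 <= Num.max a 0 :> R)%R by rewrite le_max lexx orbT.
have mp := measurable_funepos mEw; have mn := measurable_funeneg mEw.
have pfin y : (EFin \o w')^\+ y \is a fin_num by rewrite pE.
have nfin y : (EFin \o w')^\- y \is a fin_num by rewrite nE.
have [ip intp] := integral_rescaled mp p0 pfin (b0 (- w' x))%R poo.
have [im intm] := integral_rescaled mn n0 nfin (b0 (w' x)) noo.
rewrite nE pE -!EFinM -intp -intm -integralB_EFin//.
apply: ae_eq_integral => //.
- apply/measurable_EFinP; apply: measurable_funM => //.
  exact: measurable_funB.
- by apply: emeasurable_funB; [exact: measurable_int ip|exact: measurable_int im].
apply: filterS ww' => y wy _; rewrite -EFinB -mulrBr; congr (_ * _)%:E.
rewrite wy pE nE /= opprD addrACA; congr (_ + _)%R.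
- by case: (leP (w' y) 0%R) => w0; [rewrite max_l|rewrite max_r]; lra.
- by case: (leP (w' x) 0%R) => w0; [rewrite max_l|rewrite max_r]; lra.
Qed.

Hypothesis N_gt0 : (0 < N)%N.

(** [h'] extends the datum measurably to the whole space. Since [w] vanishes off [A] only almost
    everywhere, it is replaced by [w'], its restriction extended by zero. The convolutions of the
    two parts of [w'] have finite integral, so they are finite almost everywhere and the equation
    can be rearranged. *)
Lemma solves_SNP_solution (p : \bar R) (c r : R) (A : set E) (h h' : E -> \bar R)
    (w : E -> R) : 1 <= p -> (0 <= c)%R -> measurable A -> A `<=` eball r ->
  measurable_fun setT h' -> (forall x, 0 <= h' x) -> (forall x, A x -> h x = h' x) ->
  solves_SNP p J c A h eps w ->
  [/\ measurable_fun setT w, {ae leb, forall x, (w x)%:E = solution K kr c A h' x} &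
    \int[leb]_x solution K kr c A h' x < +oo].
Proof.
move=> p1 c0 mA Ar mh h0 hh' [wp eqw wA].
have [mw woo] := Lp_measurable wp; rewrite /Lp_norm in woo.
rewrite !patch_setT in mw woo.
pose w' := w \_ A.
have w'A x : ~ A x -> w' x = 0%R by move=> xA; rewrite /w' patchE memNset.
have w'E x : A x -> w' x = w x by move=> xA; rewrite /w' patchE mem_set.
have ww' : {ae leb, forall x, w x = w' x}.
  apply: filterS wA => x wx; have [xA|xA] := pselect (A x); first by rewrite w'E.
  by rewrite w'A// wx.
have mw' : measurable_fun setT w' by apply/(measurable_restrictT _ mA);
  exact: (measurable_funS measurableT _ mw).
have mEw : measurable_fun setT (EFin \o w') by apply/measurable_EFinP.
have Aoo : leb A < +oo.
  apply: le_lt_trans (lebesgue_eball_lty N r); apply: le_measure; rewrite ?inE//.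
  exact: measurable_eball.
have w'int : \int[leb]_x `|w' x|%:E < +oo.
  apply: (Lnorm_bounded_integral p1 mA) => //.
  rewrite -(@ae_eq_Lnorm _ _ p (EFin \o w))//; first exact/measurable_EFinP.
  by apply: filterS ww' => x /= ->.
have part (q : E -> \bar R) : measurable_fun setT q -> (forall x, 0 <= q x) ->
    (forall x, q x <= `|w' x|%:E) -> {ae leb, forall x, conv K q x < +oo}.
  move=> mq q0 qw; have mc : measurable_fun setT (conv K q) by exact: measurable_conv.
  have ic : leb.-integrable setT (conv K q).
    apply/integrableP; split => //.
    under eq_integral do rewrite gee0_abs ?conv_ge0//.
    rewrite integral_conv// K_int lte_mul_pinfty// ?lee_fin ?(ltW kr_gt0)//.
    apply: le_lt_trans w'int; apply: ge0_le_integral => //.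
    by apply/measurable_EFinP; exact: measurableT_comp.
  by apply: filterS (integrable_ae measurableT ic) => x /(_ I); rewrite ge0_fin_numE// conv_ge0.
have mp := measurable_funepos mEw; have mn := measurable_funeneg mEw.
have p0 y : 0 <= (EFin \o w')^\+ y by rewrite funepos_ge0.
have n0 y : 0 <= (EFin \o w')^\- y by rewrite funeneg_ge0.
have pE y : (EFin \o w')^\+ y = (Num.max (w' y) 0)%:E by rewrite funeposE /= EFin_max.
have nE y : (EFin \o w')^\- y = (Num.max (- w' y) 0)%:E by rewrite funenegE /= EFin_max.
have poo : {ae leb, forall x, conv K (EFin \o w')^\+ x < +oo}.
  by apply: part => // x; rewrite pE lee_fin ge_max ler_norm normr_ge0.
have noo : {ae leb, forall x, conv K (EFin \o w')^\- x < +oo}.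
  by apply: part => // x; rewrite nE lee_fin ge_max -normrN ler_norm normr_ge0.
have w'sol : {ae leb, forall x, (w' x)%:E = solution K kr c A h' x}.
  apply: (solution_unique N_gt0 K_ge0 K_radial K_int kr_gt0 c0 mA Ar mh h0) => //.
  apply: filterS3 eqw poo noo => x eqx px nx xA; have := eqx xA.
  rewrite -(w'E x xA) (integral_rescaled_diff mw mw' ww' px nx) hh'//.
  move: px nx; have := conv_ge0 K_ge0 x p0; have := conv_ge0 K_ge0 x n0.
  rewrite pE nE.
  case: (conv K _ x) => [a| |]//; case: (conv K _ x) => [b| |]//.
  set P := Num.max (w' x) 0%R; set Q := Num.max (- w' x)%R 0%R.
  have -> : w' x = (P - Q)%R.
    by rewrite /P /Q; case: (leP (w' x) 0%R) => wx; [rewrite max_l|rewrite max_r]; lra.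
  move=> _ _ _ _ <-; rewrite -!EFinM -!EFinD; congr EFin; ring.
have wsol : {ae leb, forall x, (w x)%:E = solution K kr c A h' x}.
  by apply: filterS2 w'sol ww' => x <- ->.
split => //; apply: le_lt_trans w'int; rewrite le_eqVlt; apply/orP; left; apply/eqP.
have msol : measurable_fun setT (solution K kr c A h') by exact: measurable_solution.
apply: ae_eq_integral => //.
  by apply/measurable_EFinP; exact: measurableT_comp.
apply: filterS w'sol => x wx _; rewrite -abse_EFin wx gee0_abs//.
exact: solution_ge0.
Qed.

End stationary_problem.

Theorem theorem1 (R : realType) (N : nat) (c : R) (p : \bar R) (r : R)
    (J : 'rV[R]_N -> R) (Omega : set 'rV[R]_N) (F : 'rV[R]_N -> R)
    (v u : R -> 'rV[R]_N -> R) (V U : 'rV[R]_N -> R)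
    (N_ge1 : (1 <= N)%N) (c_ge0 : 0 <= c) (p_ge1 : (1 <= p)%E)
    (r_gt1 : 1 < r) (r_le2 : r <= 2)
    (J_ge0 : forall x, 0 <= J x)
    (J_radial : ae_radially_nonincreasing J)
    (J_L1 : Lp setT 1%E J) (J_Lr : Lp setT r%:E J)
    (J_norm : Lp_norm setT 1%E J = 1%E)
    (J_moment : (second_moment J < +oo)%E)
    (Omega_open : open Omega) (Omega_bounded : bounded_set Omega)
    (Omega_smooth : smooth_boundary Omega)
    (F_Lp : Lp Omega p F) (F_ge0 : forall x, Omega x -> 0 <= F x)
    (v_sol : forall eps : R, 0 < eps ->
      unique_solution_SNP p J c Omega (EFin \o F) eps (v eps))
    (u_sol : forall eps : R, 0 < eps ->
      unique_solution_SNP p J c (symm_set Omega) (schwarz (F \_ Omega)) eps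
        (u eps))
    (V_sol : unique_solution_SLP p c Omega (EFin \o F) V)
    (U_sol : unique_solution_SLP p c (symm_set Omega) (schwarz (F \_ Omega)) U)
    (v_cvg : Lp_norm Omega p (v eps \- V) @[eps --> (0 : R)^'+] --> 0%E)
    (u_cvg : Lp_norm (symm_set Omega) p (u eps \- U) @[eps --> (0 : R)^'+]
             --> 0%E) :
  forall eps : R, 0 < eps ->
    ae_radially_nonincreasing (u eps) /\
    (Lp_norm Omega p (v eps) <= Lp_norm (symm_set Omega) p (u eps))%E.
Proof.
move=> eps eps0.
have mO : measurable Omega by exact: open_measurable_rV.
have [rho Or] : exists rho, Omega `<=` eball rho.
  have [M [_ HM]] := Omega_bounded.
  (* Boundedness gives a bound in the sup norm for every number above [M], here [|M| + 1]; the
     factor [N] passes to the Euclidean norm, and the last summand makes the inequality strict. *)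
  exists (N%:R * (`|M| + 1) + 1) => x Ox; rewrite /eball /= ltr_pwDr//.
  have M0 : 0 <= `|M| + 1 by rewrite addr_ge0.
  apply: enorm_le_coord => // i; have := HM (`|M| + 1).
  rewrite (le_lt_trans (ler_norm M)) ?ltrDl// => /(_ isT x Ox); apply: le_trans.
  by rewrite -[leRHS]/(mx_norm x) mx_normrE; exact: (le_bigmax _ (fun j => `|x j.1 j.2|) (ord0, i)).
have mF : measurable_fun setT (F \_ Omega) by exact: (Lp_measurable F_Lp).1.
have F0 x : 0 <= (F \_ Omega) x.
  by rewrite patchE; case: ifPn => // /set_mem; exact: F_ge0.
have Fout x : ~ Omega x -> (F \_ Omega) x = 0 by move=> xO; rewrite patchE memNset.
have mEF : measurable_fun setT (EFin \o (F \_ Omega)) by exact/measurable_EFinP.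
have EF0 x : (0 <= (EFin \o (F \_ Omega)) x)%E by rewrite lee_fin.
have FE x : Omega x -> (EFin \o F) x = (EFin \o (F \_ Omega)) x.
  by move=> xO; rewrite /= patchE mem_set.
have Fball x : ~ eball rho x -> (F \_ Omega) x = 0 by move=> xr; apply: Fout => /Or.
have mJ : measurable_fun setT J.
  by have [+ _] := Lp_measurable J_L1; rewrite patch_setT.
have [K [kr [K0 Kr Kint kr0 JK]]] :=
  rescaled_kernel N_ge1 eps0 J_ge0 J_radial mJ J_norm J_moment.
have [sv _] := v_sol eps eps0; have [su _] := u_sol eps eps0.
have hsr : radially_nonincreasing (schwarz (F \_ Omega)) by exact: (radial_schwarz N_ge1 mF Fball).
have [mv vE _] := solves_SNP_solution (h' := EFin \o (F \_ Omega)) K0 Kr Kint kr0 mJ JK N_ge1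
  p_ge1 c_ge0 mO Or mEF EF0 FE sv.
have [mu uE uoo] := solves_SNP_solution K0 Kr Kint kr0 mJ JK N_ge1
  p_ge1 c_ge0 (measurable_symm_set Omega) (fun x h => h : eball (symm_radius Omega) x)
  (measurable_radial hsr) (schwarz_ge0 _) (fun _ _ => erefl) su.
have srad := radial_solution N_ge1 K0 Kr kr0 c_ge0 Or mF Fout.
split; first by exists (solution K kr c (symm_set Omega) (schwarz (F \_ Omega))).
have stail := solution_tail_integral_le N_ge1 K0 Kr kr0 c_ge0 mO Or mF F0 Fout uoo.
(* The limit of the iterates vanishes off [A], so the norm on [A] becomes a norm on the whole space,
   where the tails are compared. *)
have Lnorm_sol (A : set 'rV[R]_N) (w : 'rV[R]_N -> R) h : measurable A ->
    measurable_fun setT w -> measurable_fun setT h -> (forall x, 0 <= h x)%E ->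
    {ae lebesgue_rV, forall x, (w x)%:E = solution K kr c A h x} ->
    Lp_norm A p w = ('N[lebesgue_rV]_p[solution K kr c A h])%E.
  move=> mA mw mh h0 wE; rewrite /Lp_norm; apply: (ae_eq_Lnorm p_ge1).
  - apply/measurable_EFinP; apply/(measurable_restrictT _ mA).
    exact: (measurable_funS measurableT _ mw).
  - exact: measurable_solution.
  apply: filterS wE => x wx; rewrite /= patchE; case: ifPn => // xA.
  by rewrite solution_outside// => /mem_set; apply/negP.
rewrite (Lnorm_sol _ _ _ mO mv mEF EF0 vE).
rewrite (Lnorm_sol _ _ _ (measurable_symm_set _) mu (measurable_radial hsr) (schwarz_ge0 _) uE).
apply: (Lnorm_le_of_tail N_ge1) => //.
- exact: measurable_solution.
- exact: measurable_radial.
- exact: solution_ge0.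
- by move=> x; apply: solution_ge0 => //;
    [exact: measurable_symm_set|exact: measurable_radial|exact: schwarz_ge0].
Qed.
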